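(* Let $M$ be a manifold, $E$ an oriented vector bundle over $M$ of rank $4n$, $h$ a neutral metric of $E$, and $\nabla$ an $h$-connection of $E$ (a connection with $\nabla h=0$). Suppose that $\nabla$ is flat, i.e., its curvature tensor vanishes. Let $K$ be a Lie subgroup of $G:=\{A_0\in SO(2n,2n)\mid A_0\Lambda_n=\Lambda_nA_0\}$. Then for a $K$-nilpotent structure $N$ of $(E,h,\nabla)$, there exists a $K$-admissible frame field $e$ of $N$ on a neighborhood of each point of $M$ such that each local section of $E$ which appears in $e$ is parallel with respect to $\nabla$.
   Context: Everything is smooth. $h$ neutral means that $h$ is a bundle metric of signature $(2n,2n)$. An ordered pseudo-orthonormal local frame field $e=(e_1,\dots,e_{4n})$ of $(E,h)$ always has $e_1,\dots,e_{2n}$ space-like ($h(e_i,e_i)=1$) and $e_{2n+1},\dots,e_{4n}$ time-like ($h(e_i,e_i)=-1$). Let $\varepsilon\in\{+,-\}$. Set $I_{1,\pm}:=\pm1$ and $I_{n,\pm}:={\rm diag}(\pm1,1,\dots,1)$ ($n\times n$) for $n\ge2$; $I'_{4n,\varepsilon}:={\rm diag}(I_n,I_n,I_n,I_{n,\varepsilon})$ (block diagonal), and $$\Lambda_n:=\left[\begin{array}{cccc}O_n&-I_n&O_n&I_n\\ I_n&O_n&I_n&O_n\\ O_n&I_n&O_n&-I_n\\ I_n&O_n&I_n&O_n\end{array}\right],$$ with $I_n$, $O_n$ the $n\times n$ unit and zero matrices. A section $N$ of ${\rm End}\,E$ is an $\varepsilon$-nilpotent structure of $(E,h)$ if on a neighborhood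 of each point of $M$ there is an ordered pseudo-orthonormal local frame field $e$ of $(E,h)$ giving the orientation of $E$ with $NeI'_{4n,\varepsilon}=eI'_{4n,\varepsilon}\Lambda_n$ (frames are treated as row vectors); such an $e$ is called an admissible frame field of $N$. For a Lie subgroup $K$ of $SO(2n,2n)$, an $\varepsilon$-nilpotent structure $N$ of $(E,h)$ ($\varepsilon=+$ or $-$) is called a $K$-nilpotent structure of $(E,h,\nabla)$ if there exist an open cover $\{U_\lambda\}_{\lambda\in\Lambda}$ of $M$ and a family $\{e_\lambda\}_{\lambda\in\Lambda}$ of admissible frame fields of $N$ such that (i) each $e_\lambda$ is defined on $U_\lambda$; (ii) if $U_\lambda\cap U_\mu\ne\emptyset$, then $e_\mu I'_{4n,\varepsilon}=e_\lambda I'_{4n,\varepsilon}A_{\lambda\mu}$ on $U_\lambda\cap U_\mu$ for a function $A_{\lambda\mu}$ valued in $K$; (iii) the connection form $\omega_\lambda$ of $\nabla$ with respect to $e_\lambda I'_{4n,\varepsilon}$, defined by $\nabla(e_\lambda I'_{4n,\varepsilon})=e_\lambda I'_{4n,\varepsilon}\omega_\lambda$, is valued in the Lie algebra of $K$. The family $\{e_\lambda\}$ determines a principal $K$-bundle $P$ over $M$ associated with $E$, of which each $e_\lambda I'_{4n,\varepsilon}$ is a local section; $N$ is considered together with such a family. An admissible frame field $e$ of $N$ defined on an open set $U$ is a $K$-admissible frame field if $eI'_{4n,\varepsilon}$ is a local section of $P$, i.e., if for each $\lambda$ with $U\cap U_\lambda\ne\emptyset$ there is a $K$-valued function $A_\lambda$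 on $U\cap U_\lambda$ with $eI'_{4n,\varepsilon}=e_\lambda I'_{4n,\varepsilon}A_\lambda$. *)

(* Defs.v *)
From HB Require Import structures.
From mathcomp Require Import all_boot all_order all_algebra.
From mathcomp Require Import all_classical all_reals all_analysis.
Import numFieldNormedType.Exports.
Import Order.TTheory GRing.Theory Num.Theory.

Set Implicit Arguments.
Unset Strict Implicit.
Unset Printing Implicit Defensive.

Local Open Scope classical_set_scope.
Local Open Scope ring_scope.

(* Local objects (functions, sections, vector fields, frames on an open set U)
   are represented by total functions whose values outside U are irrelevant.
   In all predicates of the form "P U f" the set U is meant to be open. *)

Section Manifolds.
Variable R : realType.

(* C^oo on an open set D: all iterated directional derivatives of g are
   (Frechet) differentiable at every point of D. *)
Definition euclid_smooth m (D : set 'rV[R]_m) (g : 'rV[R]_m -> R) : Prop :=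
  forall (vs : seq 'rV[R]_m) (p : 'rV[R]_m), D p ->
    differentiable (foldr (fun v f => fun q => 'D_v f q) g vs) p.

(* The tangent space at x is modelled on R^m through a preferred chart
   chart_at x around x. *)
Record manifold (m : nat) := Manifold {
  point :> topologicalType;
  chart_idx : Type;
  chart_dom : chart_idx -> set point;
  chart : chart_idx -> point -> 'rV[R]_m;
  chartV : chart_idx -> 'rV[R]_m -> point;
  chart_at : point -> chart_idx;
  manifold_hausdorff : hausdorff_space point;
  manifold_second_countable : @second_countable point;
  chart_at_dom : forall x, chart_dom (chart_at x) x;
  chart_dom_open : forall c, open (chart_dom c);
  chart_img_open : forall c, open (chart c @` chart_dom c);
  chartK : forall c x, chart_dom c x -> chartV c (chart c x) = x;
  chart_continuous : forall c x, chart_dom c x ->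
    {for x, continuous (chart c)};
  chartV_continuous : forall c x, chart_dom c x ->
    {for chart c x, continuous (chartV c)};
  chart_transition : forall c c' k,
    euclid_smooth (chart c @` (chart_dom c `&` chart_dom c'))
                  (fun p => chart c' (chartV c p) 0 k)
}.

Section OneManifold.
Variables (m : nat) (M : manifold m).

Definition smooth_on (U : set M) (f : M -> R) : Prop :=
  forall c : chart_idx M,
    euclid_smooth (chart c @` (U `&` chart_dom c)) (f \o chartV c).

(* Derivative of the function f along the tangent vector v at x. *)
Definition tderiv (x : M) (v : 'rV[R]_m) (f : M -> R) : R :=
  'D_v (f \o chartV (chart_at x)) (chart (chart_at x) x).

(* X y is expressed in the preferred chart at y; the k-th component of X in
   the chart c is the derivative of the k-th coordinate of c along X. *)
Definition smooth_vector_field (U : set M) (X : M -> 'rV[R]_m) : Prop :=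
  forall (c : chart_idx M) (k : 'I_m),
    smooth_on (U `&` chart_dom c)
              (fun y => tderiv y (X y) (fun z => chart c z 0 k)).

(* [X, Y]^k = X(Y^k) - Y(X^k) in the preferred chart at x. *)
Definition lie_bracket (X Y : M -> 'rV[R]_m) (x : M) : 'rV[R]_m :=
  \row_k (tderiv x (X x)
            (fun y => tderiv y (Y y) (fun z => chart (chart_at x) z 0 k))
        - tderiv x (Y x)
            (fun y => tderiv y (X y) (fun z => chart (chart_at x) z 0 k))).

End OneManifold.

Definition smooth_map m m' (M : manifold m) (M' : manifold m')
    (U : set M) (F : M -> M') : Prop :=
  (forall V : set M', open V -> open (U `&` F @^-1` V)) /\
  forall (c : chart_idx M') (k : 'I_m'),
    smooth_on (U `&` F @^-1` chart_dom c) (fun x => chart c (F x) 0 k).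

(* A Lie subgroup of the linear Lie group S: a Lie group together with an
   injective immersive homomorphism into the square matrices, with image in S
   (the topology of the Lie group may be finer than that of S).
   The group axioms follow from the injectivity of the inclusion. *)
Record lie_subgroup r (S : set 'M[R]_r) := LieSubgroup {
  ls_dim : nat;
  ls_man :> manifold ls_dim;
  ls_one : ls_man;
  ls_mul : ls_man -> ls_man -> ls_man;
  ls_inv : ls_man -> ls_man;
  ls_incl : ls_man -> 'M[R]_r;
  ls_incl_inj : injective ls_incl;
  ls_incl_one : ls_incl ls_one = 1%:M;
  ls_incl_mul : forall a b, ls_incl (ls_mul a b) = ls_incl a *m ls_incl b;
  ls_incl_inv : forall a, ls_incl (ls_inv a) *m ls_incl a = 1%:M;
  ls_incl_sub : forall a, S (ls_incl a);
  ls_incl_smooth : forall i j, smooth_on setT (fun a => ls_incl a i j);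
  ls_incl_immersion : forall (a : ls_man) (v : 'rV[R]_ls_dim),
    (forall i j, tderiv a v (fun b => ls_incl b i j) = 0) -> v = 0;
  ls_mul_continuous :
    continuous (fun ab : (ls_man * ls_man)%type => ls_mul ab.1 ab.2);
  (* smoothness in the product charts of ls_man * ls_man *)
  ls_mul_smooth : forall (c1 c2 c : chart_idx ls_man) (k : 'I_ls_dim),
    euclid_smooth
      [set w : 'rV[R]_(ls_dim + ls_dim) | exists a b : ls_man,
        [/\ chart_dom c1 a, chart_dom c2 b, chart_dom c (ls_mul a b)
          & w = row_mx (chart c1 a) (chart c2 b)]]
      (fun w => chart c (ls_mul (chartV c1 (lsubmx w))
                                (chartV c2 (rsubmx w))) 0 k);
  ls_inv_smooth : smooth_map setT ls_inv
}.

(* The image of the tangent space at the identity. *)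
Definition lie_algebra r (S : set 'M[R]_r) (K : lie_subgroup S)
    : set 'M[R]_r :=
  [set W | exists v : 'rV[R]_(ls_dim K),
     W = \matrix_(i, j) tderiv (ls_one K) v (fun b => ls_incl b i j)].

End Manifolds.

Section Bundles.
Variables (R : realType) (m : nat) (M : manifold R m).

Record vbundle (r : nat) := VBundle {
  fiber : M -> lmodType R;
  triv_idx : Type;
  triv_dom : triv_idx -> set M;
  triv : triv_idx -> forall x, {linear fiber x -> 'rV[R]_r};
  trivV : triv_idx -> forall x, 'rV[R]_r -> fiber x;
  triv_dom_open : forall a, open (triv_dom a);
  triv_cover : forall x, exists a, triv_dom a x;
  trivK : forall a x, triv_dom a x -> cancel (triv a x) (trivV a x);
  trivVK : forall a x, triv_dom a x -> cancel (trivV a x) (triv a x);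
  triv_transition : forall a b (i j : 'I_r),
    smooth_on (triv_dom a `&` triv_dom b)
              (fun x => triv b x (trivV a x (delta_mx 0 i)) 0 j)
}.

Definition is_basis r (V : lmodType R) (b : 'I_r -> V) : Prop :=
  forall v : V, exists! c : 'rV[R]_r, v = \sum_i c 0 i *: b i.

(* The row vector b times the matrix A. *)
Definition basis_mul r (V : lmodType R) (b : 'I_r -> V) (A : 'M[R]_r)
    : 'I_r -> V :=
  fun j => \sum_i A i j *: b i.

Section OneBundle.
Variables (r : nat) (E : vbundle r).

Definition section : Type := forall x : M, fiber E x.

Definition smooth_section (U : set M) (s : section) : Prop :=
  forall (a : triv_idx E) (i : 'I_r),
    smooth_on (U `&` triv_dom a) (fun x => triv a x (s x) 0 i).

Definition frame_at (e : 'I_r -> section) (x : M) : 'I_r -> fiber E x :=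
  fun i => e i x.

Definition frame_mul (e : 'I_r -> section) (A : 'M[R]_r) : 'I_r -> section :=
  fun j x => basis_mul (frame_at e x) A j.

Definition smooth_frame (U : set M) (e : 'I_r -> section) : Prop :=
  (forall i, smooth_section U (e i)) /\
  (forall x, U x -> is_basis (frame_at e x)).

Record orientation := Orientation {
  positive : forall x, ('I_r -> fiber E x) -> Prop;
  positive_basis : forall x (b : 'I_r -> fiber E x),
    positive b -> is_basis b;
  positive_change : forall x (b : 'I_r -> fiber E x) (A : 'M[R]_r),
    positive b -> (positive (basis_mul b A) <-> 0 < \det A);
  positive_local : forall x, exists (U : set M) (e : 'I_r -> section),
    [/\ open U, U x, smooth_frame U e
      & forall y, U y -> positive (frame_at e y)]
}.

(* nabla x v s is the covariant derivative at x, along the tangent vector v,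
   of the section s, which is only required to be smooth near x.  It depends
   only on the germ of s at x: take for f in nabla_leibniz the indicator
   function of a neighborhood of x. *)
Record connection := Connection {
  nabla : forall x : M, 'rV[R]_m -> section -> fiber E x;
  nabla_linear : forall (U : set M) (x : M) (s : section) (a : R)
      (v w : 'rV[R]_m),
    open U -> U x -> smooth_section U s ->
    nabla x (a *: v + w) s = a *: nabla x v s + nabla x w s;
  nabla_add : forall (U : set M) (x : M) (v : 'rV[R]_m) (s t : section),
    open U -> U x -> smooth_section U s -> smooth_section U t ->
    nabla x v (fun y => s y + t y) = nabla x v s + nabla x v t;
  nabla_leibniz : forall (U : set M) (x : M) (v : 'rV[R]_m) (f : M -> R)
      (s : section),
    open U -> U x -> smooth_on U f -> smooth_section U s ->
    nabla x v (fun y => f y *: s y) = tderiv x v f *: s x + f x *: nabla x v s;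
  nabla_smooth : forall (U : set M) (X : M -> 'rV[R]_m) (s : section),
    open U -> smooth_vector_field U X -> smooth_section U s ->
    smooth_section U (fun y => nabla y (X y) s)
}.

Definition curvature (D : connection) (X Y : M -> 'rV[R]_m) (s : section)
    : section :=
  fun x => nabla D x (X x) (fun y => nabla D y (Y y) s)
         - nabla D x (Y x) (fun y => nabla D y (X y) s)
         - nabla D x (lie_bracket X Y x) s.

Definition flat (D : connection) : Prop :=
  forall (U : set M) (X Y : M -> 'rV[R]_m) (s : section), open U ->
    smooth_vector_field U X -> smooth_vector_field U Y ->
    smooth_section U s ->
    forall x, U x -> curvature D X Y s x = 0.

Definition parallel_on (D : connection) (U : set M) (s : section) : Prop :=
  forall (x : M) (v : 'rV[R]_m), U x -> nabla D x v s = 0.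

(* W is the value on the tangent vector v at x of the connection form of D
   with respect to the frame e, i.e. nabla e = e omega and W = omega(v). *)
Definition connection_form_at (D : connection) (e : 'I_r -> section)
    (x : M) (v : 'rV[R]_m) (W : 'M[R]_r) : Prop :=
  forall j, nabla D x v (e j) = basis_mul (frame_at e x) W j.

Definition smooth_endomorphism
    (N : forall x, {linear fiber E x -> fiber E x}) : Prop :=
  forall (U : set M) (s : section), open U -> smooth_section U s ->
    smooth_section U (fun x => N x (s x)).

End OneBundle.
End Bundles.

Section Matrices.
Variables (R : realType) (n : nat).

(* The square matrices of order 4n. *)
Local Notation M4 := 'M[R]_((n + n) + (n + n)).

Definition J_mx : M4 := block_mx 1%:M 0 0 (- 1%:M).

Definition SO : set M4 := [set A | A^T *m J_mx *m A = J_mx /\ \det A = 1].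

(* eps = true stands for +, eps = false for -. *)
Definition I_eps (eps : bool) : 'M[R]_n :=
  \matrix_(i, j) if i != j then 0
                 else if (i == 0 :> nat) && ~~ eps then -1 else 1.

Definition I'_eps (eps : bool) : M4 :=
  block_mx 1%:M 0 0 (block_mx 1%:M 0 0 (I_eps eps)).

Definition Lambda : M4 :=
  block_mx (block_mx 0 (- 1%:M) 1%:M 0) (block_mx 0 1%:M 1%:M 0)
           (block_mx 0 1%:M 1%:M 0)     (block_mx 0 (- 1%:M) 1%:M 0).

Definition G : set M4 := [set A | SO A /\ A *m Lambda = Lambda *m A].

End Matrices.

Section Nilpotent.
Variables (R : realType) (m : nat) (M : manifold R m) (n : nat).
Local Notation rk := ((n + n) + (n + n))%N.
Variable E : vbundle M rk.

(* The first 2n vectors are space-like, the last 2n time-like. *)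
Definition pseudo_orthonormal (V : lmodType R) (h : V -> V -> R)
    (b : 'I_rk -> V) : Prop :=
  is_basis b /\ forall i j, h (b i) (b j) = J_mx R n i j.

Record neutral_metric := NeutralMetric {
  metric : forall x, fiber E x -> fiber E x -> R;
  metric_sym : forall x (u v : fiber E x), metric u v = metric v u;
  metric_linear : forall x (a : R) (u v w : fiber E x),
    metric (a *: u + v) w = a * metric u w + metric v w;
  metric_smooth : forall (U : set M) (s t : section E), open U ->
    smooth_section U s -> smooth_section U t ->
    smooth_on U (fun x => metric (s x) (t x));
  metric_signature : forall x, exists b : 'I_rk -> fiber E x,
    pseudo_orthonormal (@metric x) b
}.

Definition metric_connection (h : neutral_metric) (D : connection E) : Prop :=
  forall (U : set M) (x : M) (v : 'rV[R]_m) (s t : section E),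
    open U -> U x -> smooth_section U s -> smooth_section U t ->
    tderiv x v (fun y => metric h (s y) (t y))
    = metric h (nabla D x v s) (t x) + metric h (s x) (nabla D x v t).

Variables (o : orientation E) (h : neutral_metric).

Definition admissible (eps : bool)
    (N : forall x, {linear fiber E x -> fiber E x})
    (U : set M) (e : 'I_rk -> section E) : Prop :=
  [/\ smooth_frame U e,
      forall x, U x -> pseudo_orthonormal (@metric h x) (frame_at e x),
      forall x, U x -> positive o (frame_at e x)
    & forall x, U x -> forall j,
        N x (frame_mul e (I'_eps R n eps) j x)
        = frame_mul (frame_mul e (I'_eps R n eps)) (Lambda R n) j x].

Definition nilpotent_structure (eps : bool)
    (N : forall x, {linear fiber E x -> fiber E x}) : Prop :=
  smooth_endomorphism N /\
  forall x, exists (U : set M) (e : 'I_rk -> section E),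
    [/\ open U, U x & admissible eps N U e].

(* On U, e I' = e' I' A for a smooth function A valued in K. *)
Definition K_related (K : lie_subgroup (@SO R n)) (eps : bool) (U : set M)
    (e e' : 'I_rk -> section E) : Prop :=
  exists A : M -> K, smooth_map U A /\
    forall x, U x -> forall j,
      frame_mul e (I'_eps R n eps) j x
      = basis_mul (frame_at (frame_mul e' (I'_eps R n eps)) x)
                  (ls_incl (A x)) j.

(* An eps-nilpotent structure together with a family of admissible frame
   fields determining the principal K-bundle. *)
Record K_nilpotent_structure (D : connection E)
    (K : lie_subgroup (@SO R n)) (eps : bool) := KNilpotentStructure {
  kn_N : forall x, {linear fiber E x -> fiber E x};
  kn_nilpotent : nilpotent_structure eps kn_N;
  kn_idx : Type;
  kn_dom : kn_idx -> set M;
  kn_frame : kn_idx -> 'I_rk -> section E;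
  kn_dom_open : forall l, open (kn_dom l);
  kn_cover : forall x, exists l, kn_dom l x;
  kn_admissible : forall l, admissible eps kn_N (kn_dom l) (kn_frame l);
  kn_transition : forall l k, kn_dom l `&` kn_dom k !=set0 ->
    K_related K eps (kn_dom l `&` kn_dom k) (kn_frame k) (kn_frame l);
  kn_connection : forall l x (v : 'rV[R]_m), kn_dom l x ->
    exists2 W, lie_algebra K W
      & connection_form_at D (frame_mul (kn_frame l) (I'_eps R n eps)) x v W
}.

Definition K_admissible (D : connection E) (K : lie_subgroup (@SO R n))
    (eps : bool) (N : K_nilpotent_structure D K eps)
    (U : set M) (e : 'I_rk -> section E) : Prop :=
  admissible eps (kn_N N) U e /\
  forall l : kn_idx N, U `&` kn_dom l !=set0 ->
    K_related K eps (U `&` kn_dom l) e (kn_frame l).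

End Nilpotent.

(* Main.v *)
Require Import Defs.
From HB Require Import structures.
From mathcomp Require Import all_boot all_order all_algebra.
From mathcomp Require Import all_classical all_reals all_analysis.
From mathcomp Require Import ring lra.
Import numFieldNormedType.Exports.
Import Order.TTheory GRing.Theory Num.Theory.
Set Implicit Arguments.
Unset Strict Implicit.
Unset Printing Implicit Defensive.
Local Open Scope classical_set_scope.
Local Open Scope ring_scope.

(* Let e' := e_l I' for a member e_l of the given family of frames, and let w be
   the matrix of 1-forms defined by nabla e' = e' w; it is valued in the Lie
   algebra of K.  In a chart the vanishing of the curvature is the Maurer-Cartan
   equation dw + w /\ w = 0, so that the system dB = - w B, B(p0) = 1, has a
   smooth solution near p0, obtained by integrating along the rays issued from
   p0; flatness makes the solution along rays satisfy the whole system.  Since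
   w B is the right translate by B of an element of the Lie algebra of K, the map
   B is tangent to the immersed subgroup K; hence B lifts to a smooth map b into
   the Lie group K, even when K is not closed.  Then e' B consists of parallel
   sections, and so does e := e' B I', while e I' = e' b differs from the given
   local sections of P by K-valued functions; B commutes with Lambda and lies in
   SO(2n,2n), so e is an admissible frame field of N. *)

(** The structure supplies the connection form only point by point, as some matrix in the Lie
    algebra of K. Smoothness is recovered by computing the entries from [h] and [nabla] in the
    pseudo-orthonormal frame e', and uniqueness of coefficients carries the Lie algebra membership
    over. The differential of the ray solution is found without differentiating an ODE in its
    parameters: flatness makes the first order guess along a neighbouring ray fail only by an error
    quadratic in the displacement, and a Gronwall estimate carries this error to the end of the ray.
    On the side of K the obstacle is that its inclusion need not be an embedding, so smoothness of B
    as a matrix-valued map does not pass formally to a lift. The lift is therefore produced in the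
    chart of K at the identity as a candidate that is smooth by construction, and uniqueness for a
    linear system shows that it reproduces B. *)

HB.instance Definition _ (R : realType) (m n : nat) :=
  Uniform_isComplete.Build 'M[R]_(m, n) (@cauchy_cvg 'M[R]_(m, n)).

(** * Calculus on row vectors *)

Section MatrixNorm.
Variable R : realType.

Lemma mx_coord_le m n (A : 'M[R]_(m, n)) i j : `|A i j| <= `|A|.
Proof.
rewrite [leRHS]/Num.Def.normr/= mx_normrE.
exact: (le_bigmax _ (fun ij : 'I_m * 'I_n => `|A ij.1 ij.2|) (i, j)).
Qed.

Lemma mx_norm_le m n (A : 'M[R]_(m, n)) c :
  0 <= c -> (forall i j, `|A i j| <= c) -> `|A| <= c.
Proof.
move=> c0 Ac; rewrite [leLHS]/Num.Def.normr/= mx_normrE.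
by apply: bigmax_le => // -[i j] _ /=; exact: Ac.
Qed.

Lemma mx_norm_mul m n p (A : 'M[R]_(m, n)) (B : 'M[R]_(n, p)) :
  `|A *m B| <= n%:R * (`|A| * `|B|).
Proof.
apply: mx_norm_le => [|i j]; first by rewrite !mulr_ge0.
rewrite mxE (le_trans (ler_norm_sum _ _ _))//.
rewrite (le_trans (ler_sum _ (G := fun=> `|A| * `|B|) _))//.
  move=> k _; rewrite normrM ler_pM ?normr_ge0//; exact: mx_coord_le.
by rewrite sumr_const card_ord -[leLHS]mulr_natl.
Qed.

Lemma row_sum_coord m (v : 'rV[R]_m) : v = \sum_i v 0 i *: delta_mx 0 i.
Proof. exact: row_sum_delta. Qed.

Lemma differentiable_row m d (F : 'rV[R]_m -> 'rV[R]_d) p :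
  (forall j, differentiable (fun x => F x 0 j) p) -> differentiable F p.
Proof.
move=> dF.
have -> : F = \sum_j (fun x => F x 0 j *: delta_mx 0 j).
  apply/funext => x; rewrite {1}(row_sum_coord (F x)).
  by rewrite fct_sumE.
by apply: differentiable_sum => j; exact: differentiableZl.
Qed.

Lemma derive_coord m (v p : 'rV[R]_m) i : 'D_v (fun x : 'rV[R]_m => x 0 i) p = v 0 i.
Proof.
have h := differentiable_coord p 0 i.
by have := @derive_mx _ _ _ _ id p v; rewrite derive_id => /(_ (@derivable_id _ _ _ _))/rowP/(_ i); rewrite mxE.
Qed.

Lemma derive_linear m (f : 'rV[R]_m -> R) p v : differentiable f p ->
  'D_v f p = \sum_i v 0 i * 'D_(delta_mx 0 i) f p.
Proof.
move=> df; rewrite deriveE// {1}(row_sum_coord v) linear_sum/=.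
by apply: eq_bigr => i _; rewrite linearZ/= deriveE.
Qed.

Lemma derivable_row_val m d (F : 'rV[R]_m -> 'rV[R]_d) p v :
  differentiable F p -> 'D_v F p = \row_j 'D_v (fun x => F x 0 j) p.
Proof.
move=> dF; rewrite derive_mx; last exact: diff_derivable.
by apply/rowP => j; rewrite !mxE.
Qed.

Lemma chain_differentiable m d (F : 'rV[R]_m -> 'rV[R]_d) (g : 'rV[R]_d -> R) p :
  (forall j, differentiable (fun x => F x 0 j) p) -> differentiable g (F p) ->
  differentiable (g \o F) p.
Proof.
by move=> /differentiable_row dF dg; exact: differentiable_comp.
Qed.

Lemma chain_derive m d (F : 'rV[R]_m -> 'rV[R]_d) (g : 'rV[R]_d -> R) p v :
  (forall j, differentiable (fun x => F x 0 j) p) -> differentiable g (F p) ->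
  'D_v (g \o F) p = 'D_(\row_j 'D_v (fun x => F x 0 j) p) g (F p).
Proof.
move=> dFj dg; have dF := differentiable_row dFj.
rewrite deriveE; last exact: chain_differentiable.
rewrite diff_comp//= -(deriveE v dF) (derivable_row_val v dF).
by rewrite deriveE.
Qed.

Lemma chain_derive_sum m d (F : 'rV[R]_m -> 'rV[R]_d) (g : 'rV[R]_d -> R) p v :
  (forall j, differentiable (fun x => F x 0 j) p) -> differentiable g (F p) ->
  'D_v (g \o F) p =
  \sum_j 'D_v (fun x => F x 0 j) p * 'D_(delta_mx 0 j) g (F p).
Proof.
move=> dFj dg; rewrite chain_derive// derive_linear//.
by apply: eq_bigr => j _; rewrite mxE.
Qed.

Lemma is_derive_line m (g : 'rV[R]_m -> R) (p v : 'rV[R]_m) (t : R) :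
  differentiable g (p + t *: v) ->
  is_derive t 1 (fun s => g (p + s *: v)) ('D_v g (p + t *: v)).
Proof.
move=> dg.
have dl : is_derive t 1 (fun s : R => p + s *: v) v.
  have -> : (fun s : R => p + s *: v) = cst p + (fun s : R => s *: v) by [].
  have h : is_diff t (cst p + (fun s : R => s *: v)) (0 + (fun s => s *: v)).
    exact: is_diffD.
  have ds : differentiable (cst p + (fun s : R => s *: v)) t by case: h.
  apply: DeriveDef; first exact: diff_derivable.
  rewrite deriveE// (@diff_val _ _ _ _ _ _ _ h).
  by rewrite -[LHS]/(0 + 1 *: v) add0r scale1r.
have dlt : differentiable (fun s : R => p + s *: v) t.
  by apply/derivable1_diffP; case: dl.
apply: DeriveDef.
  apply/derivable1_diffP.
  exact: (@differentiable_comp _ _ _ _ (fun s : R => p + s *: v) g).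
rewrite deriveE; last exact: (@differentiable_comp _ _ _ _ (fun s : R => p + s *: v) g).
rewrite (@diff_comp _ _ _ _ (fun s : R => p + s *: v) g)//=.
by rewrite -(deriveE (1 : R) dlt) (@derive_val _ _ _ _ _ _ _ dl) deriveE.
Qed.

Lemma differentiable_expansion m (f : 'rV[R]_m -> R) p (e : R) :
  differentiable f p -> 0 < e ->
  \forall h \near (0 : 'rV[R]_m), `|f (p + h) - f p - 'D_h f p| <= e * `|h|.
Proof.
move=> df e0.
have := diff_locallyxC df.
set o := 'o _ => E; near=> h.
rewrite E deriveE// [f p + _ + _]addrC addrAC !addrA addrK addrK.
near: h.
by have := littleoP [littleo of o]; apply.
Unshelve. all: by end_near. Qed.

(** Converse of [differentiable_expansion], for a candidate differential given by its coefficients.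
    Partial derivatives alone do not give differentiability; inverse functions and radial solutions
    obtain it from this first order estimate. *)
Lemma expansion_differentiable m (f : 'rV[R]_m -> R) p (l : 'I_m -> R) :
  (forall e : R, 0 < e -> \forall h \near (0 : 'rV[R]_m),
    `|f (p + h) - f p - \sum_i h 0 i * l i| <= e * `|h|) ->
  differentiable f p /\ forall v, 'D_v f p = \sum_i v 0 i * l i.
Proof.
move=> E.
pose L0 (h : 'rV[R]_m) : R := \sum_i h 0 i * l i.
have L0l : linear_for *%R L0.
  move=> a u v; rewrite /L0 mulr_sumr -big_split; apply: eq_bigr => i _ /=.
  by rewrite !mxE mulrDl mulrA.
pose L : {linear 'rV[R]_m -> R} := HB.pack L0 (GRing.isLinear.Build _ _ _ _ L0 L0l).
have Lc : continuous L.
  move=> v; apply: differentiable_continuous.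
  have -> : (L : 'rV[R]_m -> R) = \sum_i (fun h : 'rV[R]_m => h 0 i * l i).
    by apply/funext => h; rewrite fct_sumE.
  apply: differentiable_sum => i; apply: differentiableM => //.
  exact: differentiable_coord.
have fE : f \o shift p = cst (f p) + L +o_ (0 : 'rV[R]_m) id.
  apply/eqaddoP => e e0; near=> h.
  rewrite [X in `|X|](_ : _ = f (p + h) - f p - \sum_i h 0 i * l i).
    by near: h; exact: E.
  by rewrite [p + h]addrC -addrA -opprD.
have df : differentiable f p.
  by apply/diff_locallyP; rewrite (diff_unique Lc fE).
split=> // v; rewrite deriveE//.
by rewrite (diff_unique Lc fE).
Unshelve. all: by end_near. Qed.

(* Smoothness up to order k, which makes regularity bootstrapping an induction. *)
Fixpoint Ck m (k : nat) (D : set 'rV[R]_m) (f : 'rV[R]_m -> R) : Prop :=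
  (forall p, D p -> differentiable f p) /\
  if k is k'.+1 then forall v, Ck k' D ('D_v f) else True.

Lemma Ck_differentiable m k (D : set 'rV[R]_m) f p :
  Ck k D f -> D p -> differentiable f p.
Proof. by case: k => [|k] [df _]; exact: df. Qed.

Lemma CkS m k (D : set 'rV[R]_m) f : Ck k.+1 D f -> Ck k D f.
Proof.
elim: k f => [|k IH] f [df Df]; split=> // v.
by apply: IH; exact: Df.
Qed.

Lemma euclid_smooth_Ck m (D : set 'rV[R]_m) f :
  euclid_smooth D f <-> forall k, Ck k D f.
Proof.
split=> [fs k|fs].
  elim: k f fs => [|k IH] f fs; split=> //; try by move=> p; exact: (fs [::]).
  move=> v; apply: IH => vs p Dp.
  have := fs (rcons vs v) p Dp; rewrite foldr_rcons; exact.
move=> vs; elim/last_ind: vs f fs => [|vs v IH] f fs.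
  by move=> p; exact: (Ck_differentiable (fs 0%N)).
move=> p Dp; rewrite foldr_rcons; apply: IH => // k.
by have [_] := fs k.+1; exact.
Qed.

Lemma euclid_smooth_differentiable m (D : set 'rV[R]_m) f p :
  euclid_smooth D f -> D p -> differentiable f p.
Proof. by move=> fs; exact: (fs [::]). Qed.

Lemma euclid_smooth_derive m (D : set 'rV[R]_m) f v :
  euclid_smooth D f -> euclid_smooth D ('D_v f).
Proof.
move=> /euclid_smooth_Ck fs; apply/euclid_smooth_Ck => k.
by have [_] := fs k.+1; exact.
Qed.

Lemma sub_Ck m k (D D' : set 'rV[R]_m) f : D' `<=` D -> Ck k D f -> Ck k D' f.
Proof.
move=> DD; elim: k f => [|k IH] f [df Df]; split=> //; try by move=> p /DD; exact: df.
by move=> v; apply: IH; exact: Df.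
Qed.

Lemma sub_euclid_smooth m (D D' : set 'rV[R]_m) f : D' `<=` D ->
  euclid_smooth D f -> euclid_smooth D' f.
Proof. by move=> DD fs vs p /DD; exact: fs. Qed.

Lemma open_ball_sub m (D : set 'rV[R]_m) p : open D -> D p ->
  exists2 r : R, 0 < r & forall q, `|q - p| < r -> D q.
Proof.
move=> oD Dp; have [r/= r0 rD] : nbhs_ball p D.
  by apply/nbhs_ballP; exact: open_nbhs_nbhs.
by exists r => // q qr; apply: rD; rewrite -ball_normE/= distrC.
Qed.

Lemma open_near0 m (D : set 'rV[R]_m) p : open D -> D p ->
  \forall h \near (0 : 'rV[R]_m), D (p + h).
Proof.
move=> oD Dp; have [r r0 rD] := open_ball_sub oD Dp.
apply/nbhs_ballP; exists r => // h; rewrite -ball_normE/= sub0r normrN => hr.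
by apply: rD; rewrite addrC addKr.
Qed.

Lemma eq_on_near m (D : set 'rV[R]_m) (f g : 'rV[R]_m -> R) p : open D ->
  (forall q, D q -> f q = g q) -> D p -> \near p, f p = g p.
Proof.
move=> oD fg Dp; have : nbhs p D by exact: open_nbhs_nbhs.
by apply: filterS.
Qed.

Lemma near_differentiable m (f g : 'rV[R]_m -> R) p :
  (\near p, f p = g p) -> differentiable f p -> differentiable g p.
Proof.
move=> fg df.
have fgp : f p = g p by exact: nbhs_singleton fg.
have [] // := @expansion_differentiable m g p (fun i => 'D_(delta_mx 0 i) f p) _.
move=> e e0; have := differentiable_expansion df e0.
have : \forall h \near (0 : 'rV[R]_m), f (p + h) = g (p + h).
  have := fg; rewrite (near_shift 0 p) /= subr0 => H.
  by apply: filterS H => h /=; rewrite addrC.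
apply: filterS2 => h E; rewrite E fgp derive_linear//.
Qed.

Lemma eq_derive m (D : set 'rV[R]_m) (f g : 'rV[R]_m -> R) p v : open D ->
  (forall q, D q -> f q = g q) -> D p -> 'D_v f p = 'D_v g p.
Proof. by move=> oD fg Dp; exact/near_eq_derive/(eq_on_near oD). Qed.

Lemma eq_Ck m k (D : set 'rV[R]_m) f g : open D ->
  (forall q, D q -> f q = g q) -> Ck k D f -> Ck k D g.
Proof.
move=> oD; elim: k f g => [|k IH] f g fg [df Df]; split=> //;
  try by move=> p Dp; apply: near_differentiable (eq_on_near oD fg Dp) (df _ Dp).
by move=> v; apply: IH (Df v) => q Dq; exact: eq_derive fg Dq.
Qed.

Lemma Ck_cst m k (D : set 'rV[R]_m) (a : R) : Ck k D (fun=> a).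
Proof.
elim: k a => [|k IH] a; split=> //; try by move=> p _; exact: differentiable_cst.
move=> v; rewrite (_ : 'D_v _ = fun=> 0)//.
by apply/funext => p; exact: derive_cst.
Qed.

(** * Closure properties of functions of class C^k on an open set *)

Section OpenSet.
Variables (m : nat) (D : set 'rV[R]_m).
Hypothesis oD : open D.

Lemma CkD k f g : Ck k D f -> Ck k D g -> Ck k D (fun x => f x + g x).
Proof.
elim: k f g => [|k IH] f g [df Df] [dg Dg]; split=> //;
  try by move=> p Dp; apply: differentiableD; [exact: df|exact: dg].
move=> v; apply: (eq_Ck oD _ (IH _ _ (Df v) (Dg v))) => q Dq.
by rewrite -deriveD//; apply: diff_derivable; [exact: df|exact: dg].
Qed.

Lemma CkM k f g : Ck k D f -> Ck k D g -> Ck k D (fun x => f x * g x).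
Proof.
elim: k f g => [|k IH] f g Cf Cg; have [df Df] := Cf; have [dg Dg] := Cg; split=> //;
  try by move=> p Dp; apply: differentiableM; [exact: df|exact: dg].
move=> v; apply: (eq_Ck oD _ (CkD (IH _ _ (CkS Cf) (Dg v)) (IH _ _ (CkS Cg) (Df v)))).
move=> q Dq; rewrite -[RHS]/('D_v (f * g) q) deriveM//.
- by apply: diff_derivable; exact: df.
- by apply: diff_derivable; exact: dg.
Qed.

Lemma CkN k f : Ck k D f -> Ck k D (fun x => - f x).
Proof.
move=> Cf; apply: (eq_Ck oD _ (CkM (Ck_cst k D (-1)) Cf)) => q _.
by rewrite mulN1r.
Qed.

Lemma CkB k f g : Ck k D f -> Ck k D g -> Ck k D (fun x => f x - g x).
Proof. by move=> Cf Cg; apply: CkD => //; exact: CkN. Qed.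

Lemma Ck_sum k (I : Type) (s : seq I) (P : pred I) (f : I -> 'rV[R]_m -> R) :
  (forall i, Ck k D (f i)) -> Ck k D (fun x => \sum_(i <- s | P i) f i x).
Proof.
move=> Cf; elim: s => [|i s IH].
  by under eq_fun do rewrite big_nil; exact: Ck_cst.
under eq_fun do rewrite big_cons.
by case: (P i) => //; exact: CkD.
Qed.

Lemma Ck_prod k (I : Type) (s : seq I) (P : pred I) (f : I -> 'rV[R]_m -> R) :
  (forall i, Ck k D (f i)) -> Ck k D (fun x => \prod_(i <- s | P i) f i x).
Proof.
move=> Cf; elim: s => [|i s IH].
  by under eq_fun do rewrite big_nil; exact: Ck_cst.
under eq_fun do rewrite big_cons.
by case: (P i) => //; exact: CkM.
Qed.

(** Induction on the order: the derivative is - f^-2 f', where f^-1 is already known one order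
    lower. *)
Lemma CkV k f : (forall p, D p -> f p != 0) -> Ck k D f -> Ck k D (fun x => (f x)^-1).
Proof.
move=> f0; elim: k => [|k IH] Cf; have [df Df] := Cf; split=> //;
  try by move=> p Dp; apply: differentiableV; [exact: df|exact: f0].
move=> v; have Ci := IH (CkS Cf).
apply: (eq_Ck oD _ (CkM (CkN (CkM Ci Ci)) (Df v))) => q Dq.
rewrite [RHS]deriveV//; [|exact: f0|by apply: diff_derivable; exact: df].
by rewrite -invfM -expr2.
Qed.

Lemma Ck_det k n (A : 'rV[R]_m -> 'M[R]_n) :
  (forall i j, Ck k D (fun x => A x i j)) -> Ck k D (fun x => \det (A x)).
Proof.
move=> CA; apply: Ck_sum => s; apply: CkM; first exact: Ck_cst.
by apply: Ck_prod => i; exact: CA.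
Qed.

(** Cramer's formula: the entries of the inverse are polynomials in the entries of A divided by the
    determinant. *)
Lemma Ck_invmx k n (A : 'rV[R]_m -> 'M[R]_n) :
  (forall p, D p -> A p \in unitmx) ->
  (forall i j, Ck k D (fun x => A x i j)) ->
  forall i j, Ck k D (fun x => (invmx (A x)) i j).
Proof.
move=> uA CA i j.
have := CkM (CkV _ (Ck_det CA)) (CkM (Ck_cst k D ((-1) ^+ (j + i))) (@Ck_det k n.-1 (fun x => row' j (col' i (A x))) _)).
move=> H; apply: (eq_Ck oD _ (H _ _)).
- by move=> q Dq; rewrite /invmx uA// !mxE.
- by move=> p Dp; have := uA p Dp; rewrite unitmxE unitfE.
- by move=> a b; under eq_fun do rewrite !mxE; exact: CA.
Qed.

Lemma Ck_mulmx k a b c (A : 'rV[R]_m -> 'M[R]_(a, b)) (B : 'rV[R]_m -> 'M[R]_(b, c)) :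
  (forall i j, Ck k D (fun x => A x i j)) ->
  (forall i j, Ck k D (fun x => B x i j)) ->
  forall i j, Ck k D (fun x => (A x *m B x) i j).
Proof.
move=> CA CB i j; under eq_fun do rewrite mxE.
by apply: Ck_sum => l; exact: CkM.
Qed.

Lemma Ck_comp k d (D' : set 'rV[R]_d) (F : 'rV[R]_m -> 'rV[R]_d) g :
  (forall p, D p -> D' (F p)) -> (forall j, Ck k D (fun x => F x 0 j)) ->
  Ck k D' g -> Ck k D (g \o F).
Proof.
move=> FD; elim: k g => [|k IH] g CF Cg; have [dg Dg] := Cg; split=> //;
  try by move=> p Dp; apply: chain_differentiable => [j|];
    [exact: (Ck_differentiable (CF j))|exact/dg/FD].
move=> v; have CF' := fun j => CkS (CF j).
have := @Ck_sum k _ (index_enum 'I_d) predT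
  (fun j x => 'D_v (fun y => F y 0 j) x * 'D_(delta_mx 0 j) g (F x)).
move=> H; apply: (eq_Ck oD _ (H _)) => [q Dq|j].
  rewrite chain_derive_sum//; last exact/dg/FD.
  by move=> j; exact: (Ck_differentiable (CF j)).
apply: CkM; first by have [_] := CF j; exact.
by apply: (IH ('D_(delta_mx 0 j) g)) => //; exact: Dg.
Qed.

(** Differentiability is a separate premise because partial derivatives do not imply it; granted it,
    every directional derivative is a constant combination of partial ones. This is the inductive
    step of both regularity bootstraps. *)
Lemma Ck_partials k f :
  (forall p, D p -> differentiable f p) ->
  (forall i, Ck k D ('D_(delta_mx 0 i) f)) -> Ck k.+1 D f.
Proof.
move=> df Cf; split=> // v.
have := @Ck_sum k _ (index_enum 'I_m) predT
  (fun j x => v 0 j * 'D_(delta_mx 0 j) f x).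
move=> H; apply: (eq_Ck oD _ (H _)) => [q Dq|j].
  by rewrite [RHS]derive_linear//; exact: df.
by apply: CkM => //; exact: Ck_cst.
Qed.

End OpenSet.

(** * Mean values and symmetry of second derivatives *)

Lemma MVT_line m (g : 'rV[R]_m -> R) (p v : 'rV[R]_m) :
  (forall t : R, 0 <= t <= 1 -> differentiable g (p + t *: v)) ->
  exists2 c : R, 0 <= c <= 1 & g (p + v) - g p = 'D_v g (p + c *: v).
Proof.
move=> dg.
have dl (t : R) : 0 <= t <= 1 ->
  is_derive t 1 (fun s => g (p + s *: v)) ('D_v g (p + t *: v)).
  by move=> /dg; exact: is_derive_line.
have [||c c01 E] := @MVT R (fun s => g (p + s *: v)) (fun t => 'D_v g (p + t *: v)) 0 1 ltr01.
- by move=> t t01; apply: dl; move: t01; rewrite in_itv/= => /andP[/ltW -> /ltW ->].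
- apply: derivable_within_continuous => t; rewrite in_itv/= => /dl[].
  by [].
exists c; first by move: c01; rewrite in_itv/= => /andP[/ltW -> /ltW ->].
by move: E; rewrite scale1r scale0r addr0 subr0 mulr1.
Qed.

(** The mean value theorem in the direction u reduces the second difference to an increment of
    ['D_u f], which is expanded by differentiability at p. Only one order of differentiation enters;
    exchanging u and v gives the other. *)
Lemma second_difference m (D : set 'rV[R]_m) (f : 'rV[R]_m -> R) (p u v : 'rV[R]_m) (e : R) :
  open D -> D p -> (forall q, D q -> differentiable f q) ->
  differentiable ('D_u f) p -> 0 < e ->
  \forall t \near (0 : R)^'+,
    `|f (p + t *: v + t *: u) - f (p + t *: v) - (f (p + t *: u) - f p)
      - t ^+ 2 * 'D_v ('D_u f) p| <= e * t ^+ 2.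
Proof.
move=> oD Dp df dG e0.
set G := 'D_u f in dG *.
(* For 0 <= c <= 1 the norms of v + c u and c u add up to at most |v| + 2|u|. The tolerance e / c0
   absorbs them, and the 1 keeps c0 positive. *)
pose c0 := `|v| + 2 * `|u| + 1.
have c0_gt0 : 0 < c0 by rewrite ltr_wpDl// addr_ge0// mulr_ge0.
have [r/= r0 rD] : nbhs_ball p D.
  by apply/nbhs_ballP; exact: open_nbhs_nbhs.
have [d/= d0 dE] : nbhs_ball (0 : 'rV[R]_m)
    [set h | `|G (p + h) - G p - 'D_h G p| <= e / c0 * `|h|].
  apply/nbhs_ballP; apply: differentiable_expansion => //.
  by rewrite divr_gt0.
near=> t.
have t0 : 0 < t by near: t; exact: nbhs_right_gt.
have tc (w : 'rV[R]_m) : `|w| <= `|v| + `|u| -> `|t *: w| < r /\ `|t *: w| < d.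
  move=> wc; have : `|t *: w| <= t * c0.
    rewrite normrZ gtr0_norm// ler_pM2l//; apply: (le_trans wc).
    by rewrite /c0 mulrDl mul1r -addrA lerD2l -addrA lerDl addr_ge0.
  move=> twc; split; apply: (le_lt_trans twc); rewrite -ltr_pdivlMr//;
  near: t; apply: nbhs_right_lt; exact: divr_gt0.
have inD w : `|w| <= `|v| + `|u| -> D (p + t *: w).
  move=> /tc[wr _]; apply: rD; rewrite -ball_normE/= opprD addrA subrr sub0r.
  by rewrite normrN.
have sub (s : R) : 0 <= s <= 1 -> `|s *: u| <= `|u|.
  move=> /andP[s0 s1]; rewrite normrZ ger0_norm//.
  by rewrite ler_piMl.
have [||c c01 E] := @MVT R (fun s : R => f (p + t *: v + s *: (t *: u)) - f (p + s *: (t *: u)))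
  (fun s => 'D_(t *: u) f (p + t *: v + s *: (t *: u)) - 'D_(t *: u) f (p + s *: (t *: u))) 0 1 ltr01.
- move=> s; rewrite in_itv/= => /andP[/ltW s0 /ltW s1].
  apply: is_deriveB; apply: is_derive_line; apply: df.
  + rewrite scalerA [s * t]mulrC -scalerA -addrA -scalerDr; apply: inD.
    by rewrite (le_trans (ler_normD _ _))// lerD2l sub// s0.
  + rewrite scalerA [s * t]mulrC -scalerA; apply: inD.
    by rewrite (le_trans (sub _ _)) ?s0 ?lerDr.
- apply: derivable_within_continuous => s; rewrite in_itv/= => /andP[s0 s1].
  apply: derivableB; apply: ex_derive; apply: is_derive_line; apply: df.
  + rewrite scalerA [s * t]mulrC -scalerA -addrA -scalerDr; apply: inD.
    by rewrite (le_trans (ler_normD _ _))// lerD2l sub// s0.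
  + rewrite scalerA [s * t]mulrC -scalerA; apply: inD.
    by rewrite (le_trans (sub _ _)) ?s0 ?lerDr.
have {c01} c01 : 0 <= c <= 1.
  by move: c01; rewrite in_itv/= => /andP[/ltW -> /ltW ->].
have Nvc : `|v + c *: u| <= `|v| + `|u|.
  by rewrite (le_trans (ler_normD _ _))// lerD2l sub.
have Nc : `|c *: u| <= `|v| + `|u| by rewrite (le_trans (sub _ _)) ?lerDr.
have dZ (q : 'rV[R]_m) : D q -> 'D_(t *: u) f q = t * G q.
  by move=> Dq; rewrite deriveE ?linearZ/= -?deriveE//; exact: df.
move: E; rewrite !scale1r !scale0r !addr0 subr0 mulr1.
rewrite !scalerA ![c * t]mulrC -!scalerA -[p + t *: v + t *: (c *: u)]addrA -scalerDr.
rewrite !dZ; [|exact: inD|exact: inD].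
rewrite opprB => E.
have -> : f (p + t *: v + t *: u) - f (p + t *: v) - (f (p + t *: u) - f p)
   = t * G (p + t *: (v + c *: u)) - t * G (p + t *: (c *: u)).
  rewrite -E; ring.
have [_ /= d1] := tc _ Nvc; have [_ /= d2] := tc _ Nc.
have := dE (t *: (v + c *: u)); have := dE (t *: (c *: u)).
rewrite -!ball_normE/= !sub0r !normrN => /(_ d2) H2 /(_ d1) H1.
have Lin : 'D_(t *: (v + c *: u)) G p = t * 'D_v G p + 'D_(t *: (c *: u)) G p.
  by rewrite !deriveE// scalerDr linearD linearZ.
set A := G (p + t *: (v + c *: u)) in H1 *.
set B := G (p + t *: (c *: u)) in H2 *.
rewrite [X in `|X|](_ : _ = t * ((A - G p - 'D_(t *: (v + c *: u)) G p)
   - (B - G p - 'D_(t *: (c *: u)) G p))); last first.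
  rewrite Lin; clearbody A B; clear -t.
  by move: ('D_v G p) ('D_(t *: (c *: u)) G p) (G p) => x y z; ring.
rewrite normrM gtr0_norm// expr2 mulrCA ler_pM2l//.
rewrite (le_trans (ler_normB _ _))// (le_trans (lerD H1 H2))//.
rewrite -mulrDr !normrZ gtr0_norm// -mulrDr mulrAC -mulrA.
rewrite ler_pM2l// -mulrA -[leRHS]mulr1 ler_pM2l// ler_pdivrMr// mul1r.
have := lerD Nvc (sub _ c01); rewrite /c0 normrZ => /le_trans -> //.
by rewrite mulr_natl mulr2n addrA lerDl.
Unshelve. all: by end_near. Qed.

(** The second difference is symmetric in u and v; divided by t^2 it is within e/2 of either mixed
    derivative for small t > 0. *)
Lemma derive_commute m (D : set 'rV[R]_m) (f : 'rV[R]_m -> R) (p u v : 'rV[R]_m) :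
  open D -> D p -> euclid_smooth D f ->
  'D_v ('D_u f) p = 'D_u ('D_v f) p.
Proof.
move=> oD Dp fs; apply/eqP; rewrite -subr_eq0 -normr_le0; apply/ler_addgt0Pr => e e0.
rewrite add0r.
have df q : D q -> differentiable f q by exact: euclid_smooth_differentiable.
have dD w : differentiable ('D_w f) p.
  exact: (euclid_smooth_differentiable (euclid_smooth_derive w fs)).
have e2 : 0 < e / 2 by rewrite divr_gt0.
have S1 := second_difference v oD Dp df (dD u) e2.
have S2 := second_difference u oD Dp df (dD v) e2.
have [t [[/= t0 H1] /= H2]] := filter_ex (filterI (filterI (nbhs_right_gt (0 : R)) S1) S2).
have t2 : 0 < t ^+ 2 by rewrite exprn_gt0.
rewrite -(ler_pM2l t2) -[X in X * `|_|]gtr0_norm// -normrM mulrBr.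
rewrite [p + _ + t *: v]addrAC in H2.
have alg (a b c d x y : R) :
  x - y = (a - b - (c - d) - y) - (a - c - (b - d) - x) by ring.
rewrite (alg (f (p + t *: v + t *: u)) (f (p + t *: u)) (f (p + t *: v)) (f p)).
rewrite (le_trans (ler_normB _ _))// (le_trans (lerD H2 H1))//.
by rewrite -mulrDl -splitr mulrC.
Qed.

(** Rows are indexed by the source: the differential acts on row vectors as v *m Jac F u, and the
    chain rule multiplies in the order of application. *)
Definition Jac d e (F : 'rV[R]_d -> 'rV[R]_e) (u : 'rV[R]_d) : 'M[R]_(d, e) :=
  \matrix_(i, j) 'D_(delta_mx 0 i) (fun x => F x 0 j) u.

Lemma derive_Jac d e (F : 'rV[R]_d -> 'rV[R]_e) u v j :
  differentiable (fun x => F x 0 j) u ->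
  'D_v (fun x => F x 0 j) u = (v *m Jac F u) 0 j.
Proof.
by move=> dF; rewrite derive_linear// mxE; apply: eq_bigr => i _; rewrite mxE.
Qed.

Lemma Jac_comp a b c (F : 'rV[R]_a -> 'rV[R]_b) (G : 'rV[R]_b -> 'rV[R]_c) u :
  (forall j, differentiable (fun x => F x 0 j) u) ->
  (forall j, differentiable (fun x => G x 0 j) (F u)) ->
  Jac (G \o F) u = Jac F u *m Jac G (F u).
Proof.
move=> dF dG; apply/matrixP => i j; rewrite !mxE.
rewrite -[LHS]/('D_(delta_mx 0 i) ((fun x => G x 0 j) \o F) u).
by rewrite chain_derive_sum//; apply: eq_bigr => k _; rewrite !mxE.
Qed.

Lemma eq_Jac a b (D : set 'rV[R]_a) (F G : 'rV[R]_a -> 'rV[R]_b) u : open D ->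
  (forall q, D q -> F q = G q) -> D u -> Jac F u = Jac G u.
Proof.
move=> oD FG Du; apply/matrixP => i j; rewrite !mxE.
by apply: (eq_derive _ oD) => // q /FG ->.
Qed.

Lemma Jac_id a (u : 'rV[R]_a) : Jac id u = 1%:M.
Proof. by apply/matrixP => i j; rewrite !mxE derive_coord mxE eqxx andTb eq_sym. Qed.

Lemma Ck_Jac a b k (D : set 'rV[R]_a) (F : 'rV[R]_a -> 'rV[R]_b) :
  (forall j, euclid_smooth D (fun x => F x 0 j)) ->
  forall i j, Ck k D (fun x => Jac F x i j).
Proof.
move=> Fs i j; under eq_fun do rewrite mxE.
by move: k; apply/euclid_smooth_Ck/euclid_smooth_derive.
Qed.

Lemma euclid_smooth_linear a b (D : set 'rV[R]_a) (F : 'rV[R]_a -> 'rV[R]_b) c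
    (P : 'M[R]_(b, c)) j : open D -> (forall j, euclid_smooth D (fun x => F x 0 j)) ->
  euclid_smooth D (fun x => (F x *m P) 0 j).
Proof.
move=> oD Fs; apply/euclid_smooth_Ck => k; apply: Ck_mulmx => // i' j'.
  by move: k; apply/euclid_smooth_Ck; rewrite (ord1 i').
exact: Ck_cst.
Qed.

Lemma Jac_linear a b (F : 'rV[R]_a -> 'rV[R]_b) c (P : 'M[R]_(b, c)) u :
  (forall j, differentiable (fun x => F x 0 j) u) ->
  Jac (fun x => F x *m P) u = Jac F u *m P.
Proof.
move=> dF; apply/matrixP => i j; rewrite !mxE.
have -> : (fun x => (F x *m P) 0 j) = \sum_k (fun x => F x 0 k * P k j).
  by apply/funext => x; rewrite fct_sumE mxE.
rewrite derive_sum => [|k].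
  apply: eq_bigr => k _; rewrite mxE.
  have -> : (fun x => F x 0 k * P k j) = P k j *: (fun x => F x 0 k).
    by apply/funext => x; rewrite -[RHS]/(P k j * F x 0 k) mulrC.
  rewrite deriveZ; first exact: mulrC.
  exact: diff_derivable.
by apply: diff_derivable; exact: differentiableM.
Qed.

Lemma ball_segment m (c p v : 'rV[R]_m) (r t : R) :
  `|p - c| <= r -> `|p + v - c| <= r -> 0 <= t <= 1 -> `|p + t *: v - c| <= r.
Proof.
move=> pr pvr /andP[t0 t1].
have -> : p + t *: v - c = (1 - t) *: (p - c) + t *: (p + v - c).
  by apply/rowP => i; rewrite !mxE; ring.
rewrite (le_trans (ler_normD _ _))// !normrZ !ger0_norm ?subr_ge0//.
have -> : r = (1 - t) * r + t * r by ring.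
by apply: lerD; apply: ler_wpM2l; rewrite ?subr_ge0.
Qed.

Lemma near_Jac1 d (F : 'rV[R]_d -> 'rV[R]_d) (D : set 'rV[R]_d) u0 (e : R) :
  D u0 -> (forall j, euclid_smooth D (fun u => F u 0 j)) ->
  Jac F u0 = 1%:M -> 0 < e ->
  \forall u \near u0, `|Jac F u - 1%:M| <= e.
Proof.
move=> Du0 Fs J1 e0.
pose P (ij : 'I_d * 'I_d) u : Prop := `|Jac F u ij.1 ij.2 - (1%:M : 'M[R]_d) ij.1 ij.2| <= e.
have : \forall u \near u0, forall ij, P ij u.
  apply: (@filter_forall _ _ P (nbhs u0)) => -[i j]; rewrite /P /=.
  have : {for u0, continuous ('D_(delta_mx 0 i) (fun x => F x 0 j))}.
    apply: differentiable_continuous.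
    exact: (euclid_smooth_differentiable (euclid_smooth_derive _ (Fs j))).
  move=> /cvgrPdist_le /(_ e e0); apply: filterS => u.
  have -> : 'D_(delta_mx 0 i) (fun x => F x 0 j) u0 = (1%:M : 'M[R]_d) i j.
    by rewrite -J1 mxE.
  rewrite distrC [X in _ -> `|X - _| <= _](_ : _ = 'D_(delta_mx 0 i) (fun x => F x 0 j) u)//.
  by rewrite mxE.
apply: filterS => u H; apply: mx_norm_le => [|i j]; first exact: ltW.
by have := H (i, j); rewrite /P /= !mxE.
Qed.

(** * Maps close to the identity and the inverse function theorem *)

Section InverseFunction.
Variables (d : nat) (D : set 'rV[R]_d) (F : 'rV[R]_d -> 'rV[R]_d) (u0 : 'rV[R]_d) (r : R).
Hypothesis r0 : 0 < r.
Hypothesis Fs : forall j, euclid_smooth D (fun u => F u 0 j).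
Hypothesis BD : forall u, `|u - u0| <= r -> D u.
Hypothesis BJ : forall u, `|u - u0| <= r -> d%:R * `|Jac F u - 1%:M| <= 2^-1.

Let B : set 'rV[R]_d := [set u | `|u - u0| <= r].

(** On the convex ball the derivative of F - id has operator norm at most 1/2. The factor d in the
    bound on the Jacobian matrix is the price of the entrywise norm in a product. *)
Lemma near_id_lipschitz u u' : B u -> B u' ->
  `|(F u' - u') - (F u - u)| <= 2^-1 * `|u' - u|.
Proof.
move=> Bu Bu'; pose v := u' - u.
have u'E : u' = u + v by rewrite /v addrC subrK.
have seg (t : R) : 0 <= t <= 1 -> B (u + t *: v).
  by move=> t01; apply: ball_segment => //; rewrite -u'E.
apply: mx_norm_le => [|i j]; first by rewrite mulr_ge0// invr_ge0.
rewrite (ord1 i).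
have dF x : D x -> differentiable (fun x => F x 0 j) x.
  exact: euclid_smooth_differentiable.
have [|c c01 E] := @MVT_line _ (fun x => F x 0 j) u v.
  by move=> t /seg /BD; exact: dF.
rewrite !mxE.
have -> : F u' 0 j - u' 0 j - (F u 0 j - u 0 j) = (F u' 0 j - F u 0 j) - v 0 j.
  by rewrite /v !mxE; ring.
rewrite u'E E derive_Jac; last exact/dF/BD/seg.
have -> : (v *m Jac F (u + c *: v)) 0 j - v 0 j =
  (v *m (Jac F (u + c *: v) - 1%:M)) 0 j by rewrite mulmxBr mulmx1 !mxE.
rewrite (le_trans (mx_coord_le _ _ _))// (le_trans (mx_norm_mul _ _))//.
rewrite mulrCA mulrC [u + v - u]addrC addKr ler_wpM2r//.
exact/BJ/seg.
Qed.

Lemma near_id_expansive u u' : B u -> B u' -> `|u' - u| <= 2 * `|F u' - F u|.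
Proof.
move=> Bu Bu'; have := near_id_lipschitz Bu Bu'.
have := ler_normB (F u' - F u) ((F u' - u') - (F u - u)).
have -> : F u' - F u - (F u' - u' - (F u - u)) = u' - u.
  by apply/rowP => i; rewrite !mxE; ring.
move: `|u' - u| `|F u' - F u| `|_ - (F u - u)| => a b c H1 H2; lra.
Qed.

(** Preimages of y are the fixed points of u |-> y - F u + u, a contraction of ratio 1/2; the
    condition on y leaves exactly the room for it to preserve the ball. *)
Lemma near_id_surjective y : `|y - F u0| <= r / 2 -> exists2 u, B u & F u = y.
Proof.
move=> yr.
pose T u := y - F u + u.
have TB u : B u -> B (T u).
  move=> Bu; have Bu0 : B u0 by rewrite /B/= subrr normr0 ltW.
  have := near_id_lipschitz Bu Bu0; rewrite /B/=.
  have -> : T u - u0 = (y - F u0) + (F u0 - u0 - (F u - u)).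
    by apply/rowP => i; rewrite !mxE; ring.
  move=> H; rewrite (le_trans (ler_normD _ _))//.
  move: Bu; rewrite /B/= distrC => Bu.
  move: H Bu yr; move: `|u0 - u| `|y - F u0| `|_ - (F u - u)| => a b c; lra.
pose Tm := @isFun.Build _ _ B B T TB.
pose Tf : {fun B >-> B} := HB.pack T Tm.
have [|||u Bu E] := @banach_fixed_point R ('rV[R]_d : completeNormedModType R) B Tf.
- have h : 0 <= (2^-1 : R) by rewrite invr_ge0.
  exists (NngNum h); split=> /=; first by rewrite invf_lt1// ltr1n.
  move=> [u u'] /= [Bu Bu']; have := near_id_lipschitz Bu' Bu.
  rewrite -normrN; congr (`|_| <= _).
  by apply/rowP => i; rewrite /= /T !mxE; ring.
- have -> : B = closed_ball u0 r.
    rewrite closed_ballE//; apply/seteqP.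
    by split => u; rewrite /B/closed_ball_/= distrC.
  exact: closed_ball_closed.
- by exists u0; rewrite /B/= subrr normr0 ltW.
exists u => //; move: E; rewrite -[Tf u]/(y - F u + u) => E.
apply/eqP; rewrite eq_sym -subr_eq0; apply/eqP.
by apply: (@addIr _ u); rewrite add0r -E.
Qed.

(** A row vector v killed by the Jacobian matrix J equals - v (J - 1), whose norm is at most |v| /
    2. *)
Lemma Jac_unit u : B u -> Jac F u \in unitmx.
Proof.
move=> Bu; rewrite -row_free_unit; apply/row_freeP.
have ker0 (v : 'rV[R]_d) : v *m Jac F u = 0 -> v = 0.
  move=> vJ; have := mx_norm_mul v (Jac F u - 1%:M).
  rewrite mulmxBr vJ mulmx1 sub0r normrN mulrCA => H.
  have := BJ Bu; move: H; rewrite (mulrC `|v|).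
  have := normr_ge0 v; rewrite -[v = 0]/(v = 0) => v0 H1 H2.
  apply/eqP; rewrite -normr_eq0 eq_le v0 andbT.
  have := ler_wpM2r v0 H2; move: H1 v0.
  by move: `|v| (_ * _) => a b; lra.
have : row_free (Jac F u).
  rewrite -kermx_eq0; apply/eqP/row_matrixP => i; rewrite row0; apply: ker0.
  by rewrite -row_mul mulmx_ker row0.
by move=> /row_freeP.
Qed.

End InverseFunction.

(** The normalisation of the Jacobian matrix fits its use in [integral_lift], where an immersion is
    first composed with a left inverse of its differential. Expansiveness makes the inverse
    2-Lipschitz, which turns the expansion of F into one of the inverse. *)
Theorem inverse_function d (D : set 'rV[R]_d) (F : 'rV[R]_d -> 'rV[R]_d) u0 :
  open D -> D u0 -> (forall j, euclid_smooth D (fun u => F u 0 j)) ->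
  Jac F u0 = 1%:M ->
  exists (V : set 'rV[R]_d) (phi : 'rV[R]_d -> 'rV[R]_d),
    [/\ open V, V (F u0), phi (F u0) = u0,
        forall y, V y -> D (phi y) /\ F (phi y) = y &
        forall j, euclid_smooth V (fun y => phi y 0 j)].
Proof.
move=> oD Du0 Fs J1.
(* This bound gives d |Jac F u - 1| <= 1/2, with d.+1 to cover d = 0; the radius is then halved to
   pass from an open to a closed ball. *)
have [r/= r0 rP] : nbhs_ball u0 [set u | D u /\ `|Jac F u - 1%:M| <= (2 * d.+1%:R)^-1].
  apply/nbhs_ballP; apply: filterI; first exact: open_nbhs_nbhs.
  by apply: (near_Jac1 Du0 Fs J1); rewrite invr_gt0 mulr_gt0.
have {rP} rP u : `|u - u0| <= r / 2 -> D u /\ `|Jac F u - 1%:M| <= (2 * d.+1%:R)^-1.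
  move=> ur; apply: rP; rewrite -ball_normE/= distrC (le_lt_trans ur)//.
  by rewrite ltr_pdivrMr// ltr_pMr// ltr1n.
set s := r / 2 in rP; have s0 : 0 < s by rewrite divr_gt0.
have BD u : `|u - u0| <= s -> D u by move=> /rP[].
have BJ u : `|u - u0| <= s -> d%:R * `|Jac F u - 1%:M| <= 2^-1.
  move=> /rP[_ H]; rewrite (le_trans (ler_wpM2l _ H))//.
  by rewrite invfM mulrCA ler_piMr// ?invr_ge0// ler_pdivrMr// mul1r ler_nat.
(* [get] selects a preimage in the closed ball; where there is none its value is arbitrary. *)
pose phi y := get [set u | `|u - u0| <= s /\ F u = y].
pose V : set 'rV[R]_d := ball (F u0) (s / 2).
have phiP y : V y -> `|phi y - u0| <= s /\ F (phi y) = y.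
  move=> Vy; have [|u Bu Fu] := near_id_surjective s0 Fs BD BJ (y := y).
    by apply: ltW; move: Vy; rewrite /V -ball_normE/= distrC.
  exact: (@getI _ [set u | `|u - u0| <= s /\ F u = y] u).
have V0 : V (F u0) by apply: ballxx; rewrite divr_gt0.
have Lip y y' : V y -> V y' -> `|phi y' - phi y| <= 2 * `|y' - y|.
  move=> /phiP[By Ey] /phiP[By' Ey'].
  by have := near_id_expansive Fs BD BJ By By'; rewrite Ey Ey'.
have oV : open V by exact: ball_open.
have UJ y : V y -> Jac F (phi y) \in unitmx.
  by move=> /phiP[By _]; exact: (Jac_unit BJ By).
have dphi y j : V y -> differentiable (fun y => phi y 0 j) y /\
   forall v, 'D_v (fun y => phi y 0 j) y = \sum_i v 0 i * (invmx (Jac F (phi y))) i j.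
  move=> Vy; apply: expansion_differentiable => e e0.
  have [By Ey] := phiP _ Vy.
  set u := phi y in By Ey *; set A := Jac F u.
  (* The final error is at most d * (e / c) * 2|h| * |A^-1|; c is chosen to make this at most e |h|,
     the added units keeping c positive. *)
  pose c := 2 * d.+1%:R * (`|invmx A| + 1).
  have c0 : 0 < c by rewrite mulr_gt0 ?mulr_gt0// ltr_wpDl.
  pose P k w : Prop := `|F (u + w) 0 k - F u 0 k - (w *m A) 0 k| <= e / c * `|w|.
  have [q/= q0 qP] : nbhs_ball (0 : 'rV[R]_d) [set w | forall k, P k w].
    apply/nbhs_ballP; apply: (@filter_forall _ _ P (nbhs 0)) => k; rewrite /P.
    have dF : differentiable (fun x => F x 0 k) u.
      by apply: euclid_smooth_differentiable (Fs k) _; exact: BD.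
    have := differentiable_expansion dF (divr_gt0 e0 c0).
    by apply: filterS => w; rewrite derive_Jac.
  have Vh : \forall h \near (0 : 'rV[R]_d), V (y + h).
    exact: open_near0.
  have qh : \forall h \near (0 : 'rV[R]_d), `|h| < q / 2.
    apply/nbhs_ballP; exists (q / 2) => /=; first by rewrite divr_gt0.
    by move=> h; rewrite -ball_normE/= sub0r normrN.
  apply: filterS2 Vh qh => h Vyh hq.
  pose w := phi (y + h) - u.
  have wh : `|w| <= 2 * `|h|.
    by have := Lip _ _ Vy Vyh; rewrite [y + h - y]addrC addKr.
  have uw : u + w = phi (y + h) by rewrite /w addrC subrK.
  have [_ Eyh] := phiP _ Vyh.
  (* Since F (u + w) = y + h, the vector h - w A is the first order remainder of F at u. *)
  have rk k : `|(h - w *m A) 0 k| <= e / c * `|w|.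
    have := qP w; rewrite /P -ball_normE/= sub0r normrN => /(_ _ k).
    rewrite uw Eyh Ey => H; rewrite !mxE.
    have -> : h 0 k = (y + h) 0 k - y 0 k by rewrite mxE addrC addKr.
    rewrite -[X in _ - X](_ : (w *m A) 0 k = _); last by rewrite mxE.
    by apply: H; rewrite (le_lt_trans wh)// -ltr_pdivlMl// mulrC.
  have rN : `|h - w *m A| <= e / c * `|w|.
    apply: mx_norm_le => [|i k]; last by rewrite (ord1 i).
    by rewrite mulr_ge0// ltW// divr_gt0.
  have -> : phi (y + h) 0 j - u 0 j - \sum_i h 0 i * (invmx A) i j
     = - (((h - w *m A) *m invmx A) 0 j).
    by rewrite mulmxBl mulmxK ?UJ// !mxE opprB.
  rewrite normrN (le_trans (mx_coord_le _ _ _))// (le_trans (mx_norm_mul _ _))//.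
  have H : `|h - w *m A| <= e / c * (2 * `|h|).
    by rewrite (le_trans rN)// ler_wpM2l// ltW// divr_gt0.
  rewrite (le_trans (ler_wpM2l _ (ler_wpM2r _ H)))//.
  have alg (a b z x t : R) : x * (t * a * (2 * b) * z) = t * b * (2 * x * z * a) by ring.
  rewrite alg ler_piMr ?mulr_ge0 ?(ltW e0)//.
  rewrite ler_pdivrMr// mul1r /c ler_pM ?mulr_ge0//; last by rewrite lerDl.
  by rewrite ler_pM2l// ler_nat.
exists V, phi; split=> //.
- have [B0 E0] := phiP _ V0.
  have Bu0 : `|u0 - u0| <= s by rewrite subrr normr0 ltW.
  have := near_id_expansive Fs BD BJ Bu0 B0.
  by rewrite E0 subrr normr0 mulr0 normr_le0 subr_eq0 => /eqP.
- by move=> y /phiP[/BD ? ?].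
- suff H k : forall j, Ck k V (fun y => phi y 0 j).
    by move=> j; apply/euclid_smooth_Ck => k; exact: H.
  elim: k => [|k IH] j; first by split=> // y /dphi -/(_ j)[].
  (* The partial derivatives of [phi] are entries of the inverse of Jac F taken at [phi], so they
     inherit the order already known for [phi]. *)
  apply: Ck_partials => // [y Vy|i]; first by case: (dphi y j Vy).
  have := @Ck_invmx _ V oV k d (fun y => Jac F (phi y)) UJ.
  move=> H; apply: (eq_Ck oV _ (H _ i j)).
    move=> y Vy; have [_ ->] := dphi y j Vy.
    rewrite (bigD1 i)//= mxE !eqxx mul1r big1 ?addr0// => l li.
    by rewrite mxE (negPf li) andbF mul0r.
  move=> a b; under eq_fun do rewrite mxE.
  apply: (@Ck_comp _ V oV k d D phi ('D_(delta_mx 0 a) (fun x => F x 0 b))) => //.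
    by move=> y /phiP[/BD].
  by move: k {IH H}; apply/euclid_smooth_Ck/euclid_smooth_derive.
Qed.

End MatrixNorm.

(** * Linear ordinary differential equations *)

Section LinearODE.
Variable R : realType.

(* The projection of the line onto [0, 1]: composing with it turns estimates on
   [0, 1] into global ones. *)
Definition clamp (t : R) : R := if t < 0 then 0 else if 1 < t then 1 else t.

Lemma clamp01 t : 0 <= clamp t <= 1.
Proof.
by rewrite /clamp; case: ltP => t0; [lra|case: ltP => t1; lra].
Qed.

Lemma clamp_id t : 0 <= t <= 1 -> clamp t = t.
Proof. by move=> /andP[t0 t1]; rewrite /clamp !ltNge t0 t1. Qed.

Lemma clamp_dist s t : `|clamp s - clamp t| <= `|s - t|.
Proof.
rewrite /clamp; have := ler_norm (s - t); have := ler_norm (t - s).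
rewrite (distrC t s); move: (`|s - t|) => a H1 H2.
by rewrite ler_norml; do ![case: ltP => ?]; lra.
Qed.

Lemma continuous_clamp : continuous clamp.
Proof.
move=> t; apply/cvgrPdist_lt => e e0; apply/nbhs_ballP; exists e => //= s.
by rewrite /ball_/=; exact/le_lt_trans/clamp_dist.
Qed.

(** Integrating from -1 makes the primitive differentiable from both sides at 0; the subtracted
    constant makes it vanish there. *)
Definition primitive (f : R -> R) (t : R) : R :=
  \int[lebesgue_measure]_(s in `[(-1)%R, t]) f s -
  \int[lebesgue_measure]_(s in `[(-1)%R, 0]) f s.

Lemma primitive0 f : primitive f 0 = 0.
Proof. by rewrite /primitive subrr. Qed.

Lemma is_derive_primitive (f : R -> R) (t : R) : continuous f -> -1 < t ->
  is_derive t 1 (primitive f) (f t).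
Proof.
move=> cf t1.
have [||dF F'] := @continuous_FTC1_closed R f (-1) t (t + 1) _ _ t1 (cf t).
- by rewrite ltrDl.
- apply: continuous_compact_integrable; first exact: segment_compact.
  exact: continuous_subspaceT.
rewrite /primitive -[f t]subr0; apply: is_deriveB.
apply: DeriveDef; first exact: dF.
by rewrite -derive1E; exact: F'.
Qed.

Lemma is_derive_continuous (f : R -> R) (t l : R) :
  is_derive t 1 f l -> {for t, continuous f}.
Proof.
by case=> df _; apply: differentiable_continuous; exact/derivable1_diffP.
Qed.

Lemma increment_le (F f : R -> R) c : 0 <= c ->
  (forall t : R, 0 <= t <= 1 -> is_derive t 1 F (f t)) ->
  (forall t : R, 0 <= t <= 1 -> `|f t| <= c) ->
  forall t : R, 0 <= t <= 1 -> `|F t - F 0| <= c.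
Proof.
move=> c0 dF fc t /andP[t0 t1].
have [||s] := @MVT_segment R F f 0 t t0.
- move=> s; rewrite in_itv/= => /andP[/ltW s0 /ltW st]; apply: dF.
  by rewrite s0 (le_trans st).
- apply: derivable_within_continuous => s; rewrite in_itv/= => /andP[s0 st].
  by apply: ex_derive; apply: dF; rewrite s0 (le_trans st).
rewrite in_itv/= => /andP[s0 st] ->; rewrite subr0 normrM (ger0_norm t0).
have := fc s; rewrite s0 (le_trans st) // => /(_ isT) fs.
by rewrite (le_trans (ler_pM _ _ fs t1))// mulr1.
Qed.

Lemma unif_geometric_limit (T : Type) (V : completeNormedModType R)
    (f : nat -> T -> V) (c : R) :
  (forall k t, `|f k.+1 t - f k t| <= c * 2^-1 ^+ k) ->
  exists g, forall k t, `|f k t - g t| <= 2 * c * 2^-1 ^+ k.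
Proof.
move=> H.
(* The subtracted term 2^-(k+n) is what makes the induction on n close. *)
have tail k n t : `|f k t - f (k + n)%N t| <= 2 * c * (2^-1 ^+ k - 2^-1 ^+ (k + n)).
  elim: n => [|n IH]; first by rewrite addn0 !subrr mulr0 normr0.
  rewrite addnS -[X in `|X|](subrKA (f (k + n)%N t)).
  rewrite (le_trans (ler_normD _ _))//; have := lerD IH (H (k + n)%N t).
  rewrite [X in _ + X]distrC => /le_trans -> //.
  rewrite exprS; set x := 2^-1 ^+ (k + n); set y := 2^-1 ^+ k.
  by rewrite le_eqVlt; apply/orP; left; apply/eqP; field.
have c0 (t : T) : 0 <= c by have := H 0%N t; rewrite expr0 mulr1; exact: le_trans.
have tail' k n t : `|f k t - f (k + n)%N t| <= 2 * c * 2^-1 ^+ k.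
  rewrite (le_trans (tail _ _ _))// ler_wpM2l//; first by rewrite mulr_ge0// (c0 t).
  by rewrite gerBl exprn_ge0// invr_ge0.
have small (t : T) (e : R) : 0 < e -> exists k, 2 * c * 2^-1 ^+ k < e.
  move=> e0; have := @cvg_geometric R (2 * c) (2^-1).
  rewrite ger0_norm ?invr_ge0// invf_lt1// ltr1n => /(_ isT) /cvgrPdist_lt /(_ e e0).
  move=> /filter_ex[k]; rewrite /= sub0r normrN ger0_norm; first by exists k.
  by rewrite mulr_ge0 ?exprn_ge0 ?invr_ge0 ?mulr_ge0// (c0 t).
have cvgf t : cvg (f n t @[n --> \oo]).
  apply/cauchy_cvgP; apply: cauchy_exP => e e0.
  have [k ke] := small t e e0; exists (f k t); exists k => // n /= kn.
  by rewrite -ball_normE/= -(subnKC kn) (le_lt_trans (tail' _ _ _)).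
exists (fun t => lim (f n t @[n --> \oo])) => k t.
apply/ler_addgt0Pr => e e0.
have := cvgf t; move=> /cvgrPdist_le /(_ e e0).
move=> [n _ /(_ (n + k)%N (leq_addr _ _))] /= He.
rewrite -[X in `|X|](subrKA (f (n + k)%N t)) (le_trans (ler_normD _ _))// lerD//.
  by rewrite addnC tail'.
by rewrite distrC.
Qed.

Lemma continuous_mx m n (M : R -> 'M[R]_(m, n)) :
  (forall i j, continuous (fun t => M t i j)) -> continuous M.
Proof.
move=> cM t; apply/cvgrPdist_le => e e0.
pose P (ij : 'I_m * 'I_n) s : Prop := `|M t ij.1 ij.2 - M s ij.1 ij.2| <= e.
have : \forall s \near t, forall ij, P ij s.
  apply: (@filter_forall _ _ P (nbhs t)) => -[i j]; rewrite /P /=.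
  by have := cM i j t => /cvgrPdist_le /(_ e e0).
apply: filterS => s H; apply: mx_norm_le => [|i j]; first exact: ltW.
by have := H (i, j); rewrite /P !mxE.
Qed.

Lemma continuous_mx_coord m n (M : R -> 'M[R]_(m, n)) i j :
  continuous M -> continuous (fun t => M t i j).
Proof.
move=> cM t; apply: (@continuous_comp _ _ _ M (fun A : 'M[R]_(m, n) => A i j)).
  exact: cM.
exact: coord_continuous.
Qed.

Lemma continuous_sum (I : Type) (s : seq I) (F : I -> R -> R) :
  (forall i, continuous (F i)) -> continuous (fun t => \sum_(i <- s) F i t).
Proof.
move=> cF; elim: s => [|i s IH].
  by under eq_fun do rewrite big_nil; move=> t; exact: cvg_cst.
under eq_fun do rewrite big_cons.
by move=> t; apply: cvgD; [exact: cF|exact: IH].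
Qed.

Lemma continuous_mulmx m n p (A : R -> 'M[R]_(m, n)) (B : R -> 'M[R]_(n, p)) :
  continuous A -> continuous B -> continuous (fun t => A t *m B t).
Proof.
move=> cA cB; apply: continuous_mx => i j.
have -> : (fun t => (A t *m B t) i j) = (fun t => \sum_k A t i k * B t k j).
  by apply/funext => t; rewrite mxE.
apply: continuous_sum => k t.
by apply: cvgM; exact: continuous_mx_coord.
Qed.

(** Picard iteration. The smallness of A makes the integral operator contract by 1/2 over all of
    [0, 1], so the interval is not subdivided. Beyond [0, 1] the solution is extended by constants,
    hence the derivative is claimed on the open interval only. *)
Lemma linear_ode r s (A : R -> 'M[R]_r) (y0 : 'M[R]_(r, s)) :
  continuous A -> (forall t, r%:R * `|A t| <= 2^-1) ->
  exists Y : R -> 'M[R]_(r, s), [/\ continuous Y, Y 0 = y0, forall t, `|Y t - y0| <= `|y0| &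
    forall t : R, 0 < t < 1 ->
      forall i j, is_derive t 1 (fun t => Y t i j) ((A t *m Y t) i j)].
Proof.
move=> cA A1.
pose T (Y : R -> 'M[R]_(r, s)) t := \matrix_(i, j)
  (y0 i j + primitive (fun u => (A u *m Y u) i j) (clamp t)).
have cAY (Y : R -> 'M[R]_(r, s)) i j : continuous Y -> continuous (fun u => (A u *m Y u) i j).
  by move=> cY; apply: continuous_mx_coord; exact: continuous_mulmx.
have dP (Y : R -> 'M[R]_(r, s)) i j (t : R) : continuous Y -> 0 <= t <= 1 ->
    is_derive t 1 (primitive (fun u => (A u *m Y u) i j)) ((A t *m Y t) i j).
  move=> cY /andP[t0 _].
  apply: (@is_derive_primitive (fun u => (A u *m Y u) i j)); first exact: cAY.
  by rewrite (lt_le_trans _ t0)// ltrN10.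
have cT (Y : R -> 'M[R]_(r, s)) : continuous Y -> continuous (T Y).
  move=> cY; apply: continuous_mx => i j.
  have -> : (fun t => T Y t i j) = (fun t => y0 i j +
    (primitive (fun u => (A u *m Y u) i j) \o clamp) t).
    by apply/funext => t; rewrite mxE.
  move=> t; apply: cvgD; first exact: cvg_cst.
  apply: continuous_comp; first exact: continuous_clamp.
  by apply: is_derive_continuous; apply: dP => //; exact: clamp01.
have T_contr (Y Y' : R -> 'M[R]_(r, s)) c : continuous Y -> continuous Y' -> (forall t, `|Y t - Y' t| <= c) ->
    forall t, `|T Y t - T Y' t| <= 2^-1 * c.
  move=> cY cY' Yc t.
  have c0 : 0 <= c by exact: le_trans (Yc 0).
  apply: mx_norm_le => [|i j]; first by rewrite mulr_ge0 ?invr_ge0.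
  have -> : (T Y t - T Y' t) i j =
    (primitive (fun u => (A u *m Y u) i j) - primitive (fun u => (A u *m Y' u) i j)) (clamp t)
    - (primitive (fun u => (A u *m Y u) i j) - primitive (fun u => (A u *m Y' u) i j)) 0.
    rewrite !mxE -![(_ - _ : R -> R) _]/(_ - _) !primitive0 subrr subr0.
    by rewrite opprD addrACA subrr add0r.
  apply: (@increment_le _ (fun t => (A t *m Y t) i j - (A t *m Y' t) i j)) => //.
  - by rewrite mulr_ge0 ?invr_ge0.
  - by move=> u u01; apply: is_deriveB; exact: dP.
  - move=> u u01.
    have -> : (A u *m Y u) i j - (A u *m Y' u) i j = (A u *m (Y u - Y' u)) i j.
      by rewrite mulmxBr [RHS]mxE [X in _ = _ + X]mxE.
    rewrite (le_trans (mx_coord_le _ _ _))// (le_trans (mx_norm_mul _ _))// mulrA.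
    by apply: ler_pM => //; rewrite ?mulr_ge0.
  exact: clamp01.
pose Yn k := iter k T (fun=> y0).
have cYn k : continuous (Yn k).
  by elim: k => [|k IH]; [move=> t; exact: cvg_cst|exact: cT].
(* The constant start y0 is [T] applied to 0, so the first step is a contraction estimate for y0 -
   0; then 2 * c = |y0| is the announced bound on Y - y0. *)
pose c := 2^-1 * `|y0|.
have Hc t : `|Yn 1%N t - Yn 0%N t| <= c.
  have -> : Yn 0%N t = T (fun=> 0) t.
    apply/matrixP => i j; rewrite mxE /=.
    have -> : (fun u => (A u *m 0) i j) = fun=> (0 : R).
      by apply/funext => u; rewrite mulmx0 mxE.
    rewrite [primitive _ _](_ : _ = 0) ?addr0//.
    by rewrite /primitive /Rintegral !integral0/= subrr.
  apply: T_contr; [exact: (cYn 0%N)|by move=> u; exact: cvg_cst|].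
  by move=> u; rewrite subr0.
have step k t : `|Yn k.+1 t - Yn k t| <= c * 2^-1 ^+ k.
  elim: k t => [|k IH] t; first by rewrite expr0 mulr1.
  rewrite exprS mulrCA; apply: T_contr => //; exact: (cYn k.+1).
have [Y HY] := @unif_geometric_limit R ('M[R]_(r, s) : completeNormedModType R) Yn c step.
have small (e : R) : 0 < e -> exists k, 2 * c * 2^-1 ^+ k < e.
  move=> e0; have := @cvg_geometric R (2 * c) (2^-1).
  rewrite ger0_norm ?invr_ge0// invf_lt1// ltr1n => /(_ isT) /cvgrPdist_lt /(_ e e0).
  move=> /filter_ex[k]; rewrite /= sub0r normrN => H; exists k.
  by rewrite (le_lt_trans _ H)// ler_norm.
have cY : continuous Y.
  move=> t; apply/cvgrPdist_le => e e0.
  have e3 : 0 < e / 3 by rewrite divr_gt0.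
  have [k ke] := small _ e3.
  have := cYn k t => /cvgrPdist_le /(_ _ e3); apply: filterS => u Hu.
  rewrite -[X in `|X|](subrKA (Yn k t)) (le_trans (ler_normD _ _))//.
  rewrite -[X in _ + `|X|](subrKA (Yn k u)).
  have H1 := HY k t; have H2 := HY k u; rewrite distrC in H1.
  have -> : e = e / 3 + (e / 3 + e / 3) by field.
  apply: lerD; first exact: (le_trans H1 (ltW ke)).
  rewrite (le_trans (ler_normD _ _))// lerD//.
  exact: (le_trans H2 (ltW ke)).
have YT t : Y t = T Y t.
  apply/eqP; rewrite -subr_eq0 -normr_le0; apply/ler_addgt0Pr => e e0.
  have e2 : 0 < e / 2 by rewrite divr_gt0.
  have [k ke] := small _ e2.
  have H1 : `|T (Yn k) t - T Y t| <= 2^-1 * (2 * c * 2^-1 ^+ k).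
    by apply: T_contr => //; exact: cYn.
  have H2 := HY k.+1 t.
  have E : Yn k.+1 t = T (Yn k) t by [].
  rewrite add0r -[X in `|X|](subrKA (Yn k.+1 t)) (le_trans (ler_normD _ _))//.
  rewrite {2}E [e]splitr distrC.
  have h : 2 * c * 2^-1 ^+ k.+1 <= e / 2.
    rewrite (le_trans _ (ltW ke))// exprS mulrCA ler_piMl//.
      by rewrite (le_trans _ (HY k 0)).
    by rewrite invf_le1// ler1n.
  apply: lerD; first exact: le_trans H2 h.
  by apply: (le_trans H1); rewrite mulrCA -exprS.
exists Y; split => //.
- rewrite YT; apply/matrixP => i j; rewrite mxE clamp_id ?lexx ?ler01//.
  by rewrite primitive0 addr0.
- by move=> t; have := HY 0%N t; rewrite expr0 mulr1 /c mulrA mulfV// mul1r distrC.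
move=> t /andP[t0 t1] i j.
have -> : (fun t => Y t i j) = (fun t => T Y t i j) by apply/funext => u; rewrite -YT.
have t01 : 0 <= t <= 1 by rewrite !ltW.
have D : is_derive t 1 (fun t => y0 i j + primitive (fun u => (A u *m Y u) i j) t)
    ((A t *m Y t) i j).
  rewrite -[(A t *m Y t) i j]add0r; apply: is_deriveD; exact: dP.
apply: near_eq_is_derive D.
have : nbhs t `]0, 1[%classic.
  by apply: open_nbhs_nbhs; split; [exact: interval_open|rewrite /= in_itv/= t0].
apply: filterS => u; rewrite /= in_itv/= => /andP[u0 u1].
by rewrite mxE clamp_id// !ltW.
Qed.

(** The function (q + d) exp(- c t) does not increase: with 1 <= c and 0 <= d, dq <= c q + d <= c (q
    + d). *)
Lemma gronwall (q dq : R -> R) (c d : R) :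
  1 <= c -> 0 <= d -> continuous q -> q 0 = 0 ->
  (forall t : R, 0 < t < 1 -> is_derive t 1 q (dq t)) ->
  (forall t : R, 0 < t < 1 -> dq t <= c * q t + d) ->
  q 1 <= d * expR c.
Proof.
move=> c1 d0 cq q0 Dq H.
pose g t := (q t + d) * expR (- c * t).
have De (t : R) : is_derive t 1 (fun t => expR (- c * t)) (expR (- c * t) * - c).
  apply: (@is_derive1_comp R expR (fun t => - c * t)).
  have : is_derive t 1 ( *%R (- c) ) (- c * 1) by exact: is_deriveZ.
  by rewrite mulr1.
have Dg (t : R) : 0 < t < 1 -> is_derive t 1 g
   ((q t + d) * (expR (- c * t) * - c) + expR (- c * t) * (dq t)).
  move=> t01; have h1 := Dq t t01.
  have h2 : is_derive t 1 (fun t => q t + d) (dq t + 0) by apply: is_deriveD.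
  rewrite addr0 in h2.
  exact: (@is_deriveM _ _ (fun t => q t + d) (fun t => expR (- c * t))).
have cg : continuous g.
  move=> t; apply: cvgM; first by apply: cvgD; [exact: cq|exact: cvg_cst].
  exact: is_derive_continuous (De t).
have [|s s01 E] := @MVT R g
  (fun t => (q t + d) * (expR (- c * t) * - c) + expR (- c * t) * dq t) 0 1 ltr01 (fun t h => Dg t h).
  exact: continuous_subspaceT.
have {}s01 : 0 < s < 1 by move: s01; rewrite in_itv.
have : g 1 <= g 0.
  rewrite -subr_le0 E subr0 mulr1.
  have -> : (q s + d) * (expR (- c * s) * - c) + expR (- c * s) * dq s =
    expR (- c * s) * (dq s - c * (q s + d)) by ring.
  rewrite pmulr_rle0 ?expR_gt0// subr_le0 (le_trans (H s s01))// mulrDr lerD2l.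
  by rewrite ler_peMl.
rewrite /g q0 mulr0 expR0 mulr1 mulr1 add0r expRN.
rewrite ler_pdivrMr ?expR_gt0//; apply: le_trans.
by rewrite lerDl.
Qed.

(** The constant depends on the sizes and on a only, so it serves all rays and all displacements at
    once. Gronwall is applied to the sum of squares of the entries, which is differentiable, unlike
    the maximum norm. *)
Lemma ode_estimate (r s : nat) (a : R) : 0 <= a -> exists2 k : R, 0 < k &
  forall (X A : R -> 'M[R]_(r, s)) (B : R -> 'M[R]_r) (e : R),
  0 <= e -> continuous X -> X 0 = 0 ->
  (forall t : R, 0 < t < 1 -> `|B t| <= a) -> (forall t : R, 0 < t < 1 -> `|A t| <= e) ->
  (forall t : R, 0 < t < 1 -> forall i j,
     is_derive t 1 (fun t => X t i j) ((B t *m X t + A t) i j)) ->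
  `|X 1| <= k * e.
Proof.
move=> a0.
pose N : R := #|{: 'I_r * 'I_s}|%:R.
(* Each of the N entries contributes at most 2 r a |X|^2 through B X, with |X|^2 <= q; the 1 comes
   from 2 x y <= x^2 + e^2 for the entries of A. *)
pose c := 2 * N * r%:R * a + 1.
have N0 : 0 <= N by rewrite ler0n.
have c1 : 1 <= c by rewrite lerDr !mulr_ge0.
(* Gronwall gives |X 1|^2 <= z e^2 with z := N exp c, and z <= (z + 1)^2 replaces a square root; the
   1 also makes the constant positive. *)
exists (N * expR c + 1) => [|X A B e e0 cX X0 Ba Ae dX].
  by rewrite ltr_wpDl// mulr_ge0// expR_ge0.
pose q t := \sum_(ij : 'I_r * 'I_s) X t ij.1 ij.2 ^+ 2.
pose dq t := \sum_(ij : 'I_r * 'I_s) 2 * X t ij.1 ij.2 * (B t *m X t + A t) ij.1 ij.2.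
have Xq t : `|X t| ^+ 2 <= q t.
  have [->|X1] := eqVneq (X t) 0.
    by rewrite normr0 expr0n/= /q sumr_ge0// => ij _; rewrite exprn_even_ge0.
  have [[i j] /= E] : exists ij, `|X t| = `|X t ij.1 ij.2|.
    by apply: mx_norm_neq0; move: X1; rewrite -normr_eq0.
  rewrite E real_normK ?num_real// /q (bigD1 (i, j))//= lerDl sumr_ge0// => ij _.
  by rewrite exprn_even_ge0.
have cq : continuous q.
  apply: continuous_sum => ij t.
  by apply: cvgM; exact: continuous_mx_coord.
have Dq (t : R) : 0 < t < 1 -> is_derive t 1 q (dq t).
  move=> t01; rewrite /q /dq.
  have -> : (fun t => \sum_(ij : 'I_r * 'I_s) X t ij.1 ij.2 ^+ 2) =
     \sum_(ij : 'I_r * 'I_s) (fun t => X t ij.1 ij.2 ^+ 2).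
    by apply/funext => u; rewrite fct_sumE.
  have D1 (ij : 'I_r * 'I_s) : is_derive t 1 (fun t => X t ij.1 ij.2 ^+ 2)
      (2 * X t ij.1 ij.2 * (B t *m X t + A t) ij.1 ij.2).
    have h := dX t t01 ij.1 ij.2.
    have := @is_deriveX _ _ (fun t => X t ij.1 ij.2) 2 t 1 _ h.
    by rewrite /= expr1.
  elim/big_ind2 : _ => // [|f x g y]; first exact: is_derive_cst.
  exact: is_deriveD.
have Hq (t : R) : 0 < t < 1 -> dq t <= c * q t + N * e ^+ 2.
  move=> t01.
  have -> : c * q t = 2 * N * r%:R * a * q t + q t by rewrite mulrDl mul1r.
  have -> : 2 * N * r%:R * a * q t = \sum_(ij : 'I_r * 'I_s) (2 * r%:R * a * q t).
    by rewrite sumr_const -mulr_natl /N; ring.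
  have -> : N * e ^+ 2 = \sum_(ij : 'I_r * 'I_s) e ^+ 2.
    by rewrite sumr_const -mulr_natl.
  rewrite {2}/q -!big_split/=; apply: ler_sum => -[i j] _ /=.
  rewrite mxE mulrDr -addrA lerD//.
    rewrite (le_trans (ler_norm _))// !normrM normr_nat -!mulrA ler_pM2l//.
    have H1 := mx_coord_le (X t) i j.
    have H2 : `|(B t *m X t) i j| <= r%:R * (a * `|X t|).
      rewrite (le_trans (mx_coord_le _ _ _))// (le_trans (mx_norm_mul _ _))//.
      by rewrite ler_wpM2l// ler_wpM2r// Ba.
    rewrite (le_trans (ler_pM _ _ H1 H2))//.
    rewrite mulrCA [X in _ * X]mulrCA; apply: ler_wpM2l => //; apply: ler_wpM2l => //.
    by rewrite -expr2.
  have := le_trans (mx_coord_le _ i j) (Ae t t01); rewrite ler_norml => /andP[h1 h2].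
  move: (X t i j) (A t i j) h1 h2 => x y h1 h2; rewrite -subr_ge0.
  have -> : x ^+ 2 + e ^+ 2 - 2 * x * y = (x - y) ^+ 2 + (e - y) * (e + y) by ring.
  by rewrite addr_ge0 ?sqr_ge0// mulr_ge0// ?subr_ge0// -lerBlDl sub0r.
have q0 : q 0 = 0.
  by rewrite /q X0 big1// => ij _; rewrite mxE expr0n.
have := gronwall c1 (mulr_ge0 N0 (sqr_ge0 e)) cq q0 Dq Hq.
move=> /(le_trans (Xq 1)) H.
rewrite -(@ler_pXn2r _ 2)// ?nnegrE ?mulr_ge0 ?addr_ge0 ?mulr_ge0 ?expR_ge0//.
rewrite (le_trans H)// exprMn mulrAC ler_wpM2r ?sqr_ge0//.
have : 0 <= N * expR c by rewrite mulr_ge0// expR_ge0.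
by move: (N * _) => z; nra.
Qed.

End LinearODE.

(** * Flat systems dB = - w B *)

Section FlatSystem.
Variable R : realType.

Lemma norm_lincomb m a b (v : 'rV[R]_m) (M : 'I_m -> 'M[R]_(a, b)) (c : R) :
  (forall k, `|M k| <= c) -> `|\sum_k v 0 k *: M k| <= m%:R * `|v| * c.
Proof.
move=> Mc; rewrite (le_trans (ler_norm_sum _ _ _))//.
rewrite (le_trans (ler_sum _ (G := fun=> `|v| * c) _))//.
  move=> k _; rewrite normrZ ler_pM//; exact: mx_coord_le.
by rewrite sumr_const card_ord -[leLHS]mulr_natl mulrA.
Qed.

Lemma norm_mx1 n : `|1%:M : 'M[R]_n| <= 1.
Proof.
apply: mx_norm_le => // i j; rewrite mxE.
by case: (i == j); rewrite ?normr1 ?normr0.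
Qed.

Lemma is_derive_mulmx a b c (A : R -> 'M[R]_(a, b)) (B : R -> 'M[R]_(b, c))
    (A' : 'M[R]_(a, b)) (B' : 'M[R]_(b, c)) (t : R) :
  (forall i j, is_derive t 1 (fun t => A t i j) (A' i j)) ->
  (forall i j, is_derive t 1 (fun t => B t i j) (B' i j)) ->
  forall i j, is_derive t 1 (fun t => (A t *m B t) i j) ((A' *m B t + A t *m B') i j).
Proof.
move=> dA dB i j.
have -> : (fun t => (A t *m B t) i j) = \sum_k (fun t => A t i k * B t k j).
  by apply/funext => u; rewrite fct_sumE mxE.
rewrite [X in is_derive _ _ _ X]mxE [X in is_derive _ _ _ (X + _)]mxE.
rewrite [X in is_derive _ _ _ (_ + X)]mxE -big_split/=.
elim/big_ind2 : _ => [|f x g y|k _]; first exact: is_derive_cst.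
  exact: is_deriveD.
have := @is_deriveM _ _ (fun t => A t i k) (fun t => B t k j) t 1 _ _ (dA i k) (dB k j).
by rewrite addrC [B t k j *: _]mulrC.
Qed.

Section Taylor.
Variables (m : nat) (D : set 'rV[R]_m) (f : 'rV[R]_m -> R).
Hypothesis fs : euclid_smooth D f.

(** Two uses of the mean value theorem, for f and then for its partial derivatives; each costs a
    factor m |h|. *)
Lemma taylor1 (p h : 'rV[R]_m) (c : R) :
  (forall t : R, 0 <= t <= 1 -> D (p + t *: h)) ->
  (forall t a b, 0 <= t <= 1 ->
     `|'D_(delta_mx 0 a) ('D_(delta_mx 0 b) f) (p + t *: h)| <= c) ->
  `|f (p + h) - f p - \sum_l h 0 l * 'D_(delta_mx 0 l) f p| <= (m%:R * `|h|) ^+ 2 * c.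
Proof.
move=> Dh fc.
have d0 := euclid_smooth_differentiable fs.
have d1 v := euclid_smooth_differentiable (euclid_smooth_derive v fs).
have sum_le (F : 'I_m -> R) (e : R) : (forall l, `|F l| <= e) ->
    `|\sum_l h 0 l * F l| <= m%:R * `|h| * e.
  move=> Fe; rewrite (le_trans (ler_norm_sum _ _ _))//.
  rewrite (le_trans (ler_sum _ (G := fun=> `|h| * e) _))//.
    move=> k _; rewrite normrM ler_pM//; exact: mx_coord_le.
  by rewrite sumr_const card_ord -[leLHS]mulr_natl mulrA.
have [t t01 ->] := MVT_line (fun t t01 => d0 _ (Dh t t01)).
rewrite derive_linear; last exact/d0/Dh.
rewrite -sumrB (eq_bigr (fun l => h 0 l *
  ('D_(delta_mx 0 l) f (p + t *: h) - 'D_(delta_mx 0 l) f p))); last first.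
  by move=> l _; rewrite mulrBr.
rewrite expr2 -mulrA; apply/sum_le => l.
have st (s : R) : 0 <= s <= 1 -> 0 <= s * t <= 1.
  move=> /andP[s0 s1]; move: t01 => /andP[t0 t1].
  by rewrite mulr_ge0//= mulr_ile1.
have [|s s01 ->] := @MVT_line _ _ ('D_(delta_mx 0 l) f) p (t *: h).
  by move=> s s01; rewrite scalerA; apply: d1; apply: Dh; exact: st.
rewrite scalerA; set q := p + _.
have Dq : D q by apply: Dh; exact: st.
rewrite derive_linear; last exact: d1.
have -> : \sum_i (t *: h) 0 i * 'D_(delta_mx 0 i) ('D_(delta_mx 0 l) f) q =
   t * \sum_i h 0 i * 'D_(delta_mx 0 i) ('D_(delta_mx 0 l) f) q.
  by rewrite mulr_sumr; apply: eq_bigr => i _; rewrite mxE mulrA.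
rewrite normrM -[leRHS]mul1r ler_pM//.
  by move: t01 => /andP[t0 t1]; rewrite ger0_norm.
by apply/sum_le => i; apply: fc; exact: st.
Qed.

End Taylor.

Section System.
Variables (m r : nat) (D : set 'rV[R]_m) (w : 'I_m -> 'rV[R]_m -> 'M[R]_r).
Hypothesis ws : forall k i j, euclid_smooth D (fun p => w k p i j).

Let dw l k p : 'M[R]_r := \matrix_(i, j) 'D_(delta_mx 0 l) (fun p => w k p i j) p.

Hypothesis flatw : forall p, D p -> forall k l,
  dw k l p - dw l k p + w k p *m w l p - w l p *m w k p = 0.

(* om is the connection form, and dom p h its derivative at p in the direction h. *)
Let om p (v : 'rV[R]_m) : 'M[R]_r := \sum_k v 0 k *: w k p.
Let dom p (h v : 'rV[R]_m) : 'M[R]_r := \sum_k v 0 k *: \sum_l h 0 l *: dw l k p.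

Let omD p u v : om p (u + v) = om p u + om p v.
Proof. by rewrite -big_split; apply: eq_bigr => k _; rewrite mxE scalerDl. Qed.

Let domD p h u v : dom p h (u + v) = dom p h u + dom p h v.
Proof. by rewrite -big_split; apply: eq_bigr => k _; rewrite mxE scalerDl. Qed.

Let domZ p t h v : dom p (t *: h) v = t *: dom p h v.
Proof.
rewrite scaler_sumr; apply: eq_bigr => k _; rewrite scalerA mulrC -scalerA; congr (_ *: _).
by rewrite scaler_sumr; apply: eq_bigr => l _; rewrite mxE scalerA.
Qed.

Let flat_om p h v : D p ->
  dom p h v - dom p v h + om p h *m om p v - om p v *m om p h = 0.
Proof.
move=> Dp.
have domE a b : dom p a b = \sum_k \sum_l (b 0 k * a 0 l) *: dw l k p.
  apply: eq_bigr => k _; rewrite scaler_sumr; apply: eq_bigr => l _.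
  by rewrite scalerA.
have ommE a b : om p a *m om p b = \sum_k \sum_l (b 0 k * a 0 l) *: (w l p *m w k p).
  rewrite mulmx_sumr; apply: eq_bigr => k _.
  rewrite mulmx_suml; apply: eq_bigr => l _.
  by rewrite -scalemxAl -scalemxAr scalerA mulrC.
rewrite (domE v h) (ommE v h) exchange_big/= [X in _ - X]exchange_big/=.
rewrite domE ommE -sumrB -big_split -sumrB; apply: big1 => k _ /=.
rewrite -sumrB -big_split -sumrB; apply: big1 => l _ /=.
rewrite [h 0 l * v 0 k]mulrC -!scalerBr -scalerDr -scalerBr.
by rewrite flatw// scaler0.
Qed.

Variables (p0 : 'rV[R]_m) (L rho : R).
Hypothesis rho0 : 0 < rho.
Hypothesis L0 : 0 <= L.
Hypothesis BD : forall p, `|p - p0| <= rho -> D p.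
Hypothesis om_le : forall p v, `|p - p0| <= rho -> `|om p v| <= L * `|v|.
Hypothesis dom_le : forall p h v, `|p - p0| <= rho -> `|dom p h v| <= L * `|h| * `|v|.
Hypothesis taylor_om : forall p h v, `|p - p0| <= rho -> `|p + h - p0| <= rho ->
  `|om (p + h) v - om p v - dom p h v| <= L * `|h| ^+ 2 * `|v|.
Hypothesis rhoL : r%:R * (L * rho) <= 2^-1.
Hypothesis rho1 : rho <= 2^-1.

Let seg x t : `|x| <= rho -> 0 <= t <= 1 -> `|p0 + t *: x - p0| <= rho.
Proof.
move=> xr t01; apply: ball_segment => //; first by rewrite subrr normr0 ltW.
by rewrite addrC addKr.
Qed.

Let cont_om x v : `|x| <= rho -> continuous (fun t => om (p0 + clamp t *: x) v).
Proof.
move=> xr; apply: continuous_mx => i j.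
have -> : (fun t => om (p0 + clamp t *: x) v i j) =
  (fun t => \sum_k (v 0 k * w k (p0 + clamp t *: x) i j)).
  apply/funext => t; rewrite summxE; apply: eq_bigr => k _.
  by rewrite mxE.
apply: continuous_sum => k.
have c2 (s : R) : 0 <= s <= 1 -> {for s, continuous (fun s : R => w k (p0 + s *: x) i j)}.
  move=> s01; apply: is_derive_continuous (@is_derive_line _ _ (fun p => w k p i j) _ _ _ _).
  by apply: euclid_smooth_differentiable (ws k i j) _; apply: BD; apply: seg.
have c3 : continuous (fun t => w k (p0 + clamp t *: x) i j).
  pose f (s : R) : R := w k (p0 + s *: x) i j.
  have : continuous (f \o @clamp R); last exact.
  move=> t; apply: continuous_comp; first exact: continuous_clamp.
  exact/c2/clamp01.
by move=> t; apply: cvgM; [exact: cvg_cst|exact: c3].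
Qed.

(** The bound on x stands under the existential so that [choice] gives a single family of solutions
    indexed by all x; outside the ball the value is the default 0. *)
Let radial x : exists Y : R -> 'M[R]_r, `|x| <= rho ->
  [/\ continuous Y, Y 0 = 1%:M, forall t, `|Y t| <= 2 &
   forall t : R, 0 < t < 1 -> forall i j,
     is_derive t 1 (fun t => Y t i j) ((- om (p0 + t *: x) x *m Y t) i j)].
Proof.
have [xr|_] := boolP (`|x| <= rho); last by exists (fun=> 0).
have [||Y [cY Y0 Y1 dY]] := @linear_ode R r r (fun t => - om (p0 + clamp t *: x) x) 1%:M.
- by move=> t; apply: cvgN; exact: cont_om.
- move=> t; rewrite normrN (le_trans _ rhoL)// ler_wpM2l//.
  rewrite (le_trans (om_le _ (seg xr (clamp01 t))))// ler_wpM2l//.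
exists Y => _; split => // [t|t t01 i j].
  have := ler_normD (Y t - 1%:M) 1%:M; rewrite subrK => /le_trans -> //.
  rewrite (le_trans (lerD (Y1 t) (lexx _)))// (le_trans (lerD (norm_mx1 r) (norm_mx1 r)))//.
have := dY t t01 i j; rewrite clamp_id//.
by move: t01 => /andP[/ltW -> /ltW ->].
Qed.

(* If Y solves the system along the ray x, then (1 - t *: om q h) *m Y solves it
   along the ray x + h up to this remainder: flatness cancels the terms of first
   order in h, which identifies the derivative of the radial solution. *)
Let remainder_le (x h q : 'rV[R]_m) (t : R) :
  `|x| <= rho -> `|x + h| <= rho -> 0 <= t <= 1 -> q = p0 + t *: x ->
  `| - om (p0 + t *: (x + h)) (x + h) *m (1%:M - t *: om q h)
     + (om q h + t *: dom q x h) + (1%:M - t *: om q h) *m om q x |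
  <= (2 * L + 3 * r%:R * L ^+ 2) * `|h| ^+ 2.
Proof.
move=> xr xhr t01 qx; have /andP[t0 t1] := t01.
have qr : `|q - p0| <= rho by rewrite qx; exact: seg.
have qE : p0 + t *: (x + h) = q + t *: h by rewrite qx scalerDr addrA.
have qhr : `|q + t *: h - p0| <= rho by rewrite -qE; exact: seg.
set S := om (p0 + t *: (x + h)) (x + h); set U := om q x; set H := om q h.
pose e := S - om q (x + h) - t *: dom q h (x + h).
(* With rho <= 1/2 both |x + h| and |h| are at most 1, so higher powers of |h| can be bounded by
   lower ones. *)
have y1 : `|x + h| <= 1 by rewrite (le_trans xhr)// (le_trans rho1)// invf_le1// ler1n.
have h1 : `|h| <= 1.
  have := ler_normB (x + h) x; rewrite [x + h]addrC addrK => /le_trans -> //.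
  rewrite addrC in xhr; rewrite (le_trans (lerD xhr xr))//.
  by rewrite (le_trans (lerD rho1 rho1))// -mulr2n -[leLHS]mulr_natl mulfV.
have th : `|t *: h| <= `|h| by rewrite normrZ ger0_norm// ler_piMl.
have ee : `|e| <= L * `|h| ^+ 2.
  rewrite /e /S qE -domZ (le_trans (taylor_om _ qr qhr))// -[leRHS]mulr1.
  apply: ler_pM => //; first by rewrite mulr_ge0// exprn_ge0.
  by rewrite ler_wpM2l// ler_pXn2r// nnegrE.
have SE : S = U + H + t *: dom q h x + t *: dom q h h + e.
  rewrite /e omD domD scalerDr; apply/matrixP => i j; rewrite !mxE; ring.
have hh : `|dom q h h| <= L * `|h| ^+ 2.
  by rewrite (le_trans (dom_le _ _ qr))// expr2 mulrA.
have HL : `|H| <= L * `|h| by exact: om_le.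
have SU : `|S - U| <= 3 * (L * `|h|).
  have -> : S - U = H + (t *: dom q h (x + h) + e).
    by rewrite /e omD; apply/matrixP => i j; rewrite !mxE; ring.
  have d : `|t *: dom q h (x + h)| <= L * `|h|.
    rewrite normrZ ger0_norm// -[leRHS]mul1r ler_pM//.
    by rewrite (le_trans (dom_le _ _ qr))// -[leRHS]mulr1 ler_wpM2l// mulr_ge0.
  have e' : `|e| <= L * `|h|.
    by rewrite (le_trans ee)// expr2 mulrA ler_piMr// mulr_ge0.
  rewrite (le_trans (ler_normD _ _))//.
  have -> : 3 * (L * `|h|) = L * `|h| + (L * `|h| + L * `|h|) by ring.
  by rewrite lerD// (le_trans (ler_normD _ _))// lerD.
(* Adding t times the flatness identity for h and x cancels every term of first order in h; what
   remains is a product of two terms of order |h|, [dom q h h], and the Taylor remainder e. *)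
have -> : - S *m (1%:M - t *: H) + (H + t *: dom q x h) + (1%:M - t *: H) *m U =
   t *: ((S - U) *m H) - (t *: dom q h h + e).
  have F := flat_om h x (BD qr).
  rewrite -[LHS]addr0 -(scaler0 _ t) -F -/U -/H.
  rewrite mulmxBr mulmxBl mulmx1 mul1mx -scalemxAr -scalemxAl mulNmx mulmxBl.
  rewrite !scalerBr !scalerDr {1}SE; move: (S *m H) => SH.
  by apply/matrixP => i j; rewrite !mxE; ring.
have -> : (2 * L + 3 * r%:R * L ^+ 2) * `|h| ^+ 2 =
  r%:R * (3 * (L * `|h|) * (L * `|h|)) + (L * `|h| ^+ 2 + L * `|h| ^+ 2) by ring.
rewrite (le_trans (ler_normB _ _))// lerD//.
  rewrite normrZ ger0_norm// -[leRHS]mul1r ler_pM//.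
  by rewrite (le_trans (mx_norm_mul _ _))// ler_wpM2l// ler_pM.
rewrite (le_trans (ler_normD _ _))// lerD//.
by rewrite normrZ ger0_norm// -[leRHS]mul1r ler_pM.
Qed.

(** B p is the value at time 1 of the solution along the ray p - p0. The estimate [main] says B (p +
    h) = (1 - om p h) B p + O(|h|^2), which gives differentiability and the whole system at once. *)
Lemma radial_solution : exists B : 'rV[R]_m -> 'M[R]_r, B p0 = 1%:M /\
  forall p, `|p - p0| < rho -> forall i j,
    differentiable (fun p => B p i j) p /\
    forall v, 'D_v (fun p => B p i j) p = \sum_k v 0 k * (- (w k p *m B p)) i j.
Proof.
have [Y HY] := choice radial.
pose B p := Y (p - p0) 1; exists B; split.
  have r0 : `|0 : 'rV[R]_m| <= rho by rewrite normr0 ltW.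
  have [cY Y0 _ dY] := HY 0 r0.
  (* On the constant ray the coefficient vanishes; the estimate with a = 0 and e = 0 forces the
     solution to stay at 1. *)
  have [k k0 Hk] := @ode_estimate R r r 0 (lexx 0).
  apply/eqP; rewrite -subr_eq0 -normr_le0 /B subrr.
  have := Hk (fun t => Y 0 t - 1%:M) (fun=> 0) (fun=> 0) 0 (lexx 0).
  rewrite mulr0; apply.
  - by move=> t; apply: cvgB; [exact: cY|exact: cvg_cst].
  - by rewrite Y0 subrr.
  - by move=> t _; rewrite normr0.
  - by move=> t _; rewrite normr0.
  move=> t t01 i j; have := dY t t01 i j.
  have -> : om (p0 + t *: 0) 0 = 0 by rewrite /om big1// => l _; rewrite mxE scale0r.
  rewrite oppr0 !mul0mx addr0 => d.
  have -> : (fun t => (Y 0 t - 1%:M) i j) = (fun t => Y 0 t i j - (1%:M : 'M[R]_r) i j).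
    by apply/funext => u; rewrite !mxE.
  by rewrite -[X in is_derive _ _ _ X]subr0; apply: is_deriveB.
have [k k0 Hk] := @ode_estimate R r r (L * rho) (mulr_ge0 L0 (ltW rho0)).
(* The factors are the Gronwall constant k, r for the norm of a product, the constant of
   [remainder_le], and the bound 2 on Y. *)
pose K := k * (r%:R * ((2 * L + 3 * r%:R * L ^+ 2) * 2)).
have main x h : `|x| <= rho -> `|x + h| <= rho ->
   `|Y (x + h) 1 - (1%:M - om (p0 + x) h) *m Y x 1| <= K * `|h| ^+ 2.
  move=> xr xhr; have [cY Y0 Y2 dY] := HY x xr; have [cZ Z0 Z2 dZ] := HY (x + h) xhr.
  (* [Q t *m Y x t] is the first order guess for the solution along x + h; at t = 1 it is (1 - om
     (p0 + x) h) times the solution along x. *)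
  pose Q t := 1%:M - clamp t *: om (p0 + clamp t *: x) h.
  have c11 : clamp 1 = 1 :> R by rewrite clamp_id// ler01 lexx.
  have c00 : clamp 0 = 0 :> R by rewrite clamp_id// ler01 lexx.
  have cQ : continuous Q.
    move=> t; apply: cvgB; first exact: cvg_cst.
    by apply: cvgZ; [exact: continuous_clamp|exact: cont_om].
  have dQ (t : R) : 0 < t < 1 -> forall i j, is_derive t 1 (fun t => Q t i j)
     ((- (om (p0 + t *: x) h + t *: dom (p0 + t *: x) x h)) i j).
    move=> t01 i j; have /andP[t0 t1] := t01.
    have d1 (k' : 'I_m) : is_derive t 1 (fun t => w k' (p0 + t *: x) i j)
        (\sum_l x 0 l * dw l k' (p0 + t *: x) i j).
      have Dq : differentiable (fun p => w k' p i j) (p0 + t *: x).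
        by apply: euclid_smooth_differentiable (ws k' i j) _; apply: BD; apply: seg => //; rewrite !ltW.
      have := is_derive_line Dq; rewrite derive_linear//.
      by under eq_bigr do rewrite -[X in _ * X](mxE matrix_key (fun i j => 'D_(delta_mx 0 _) (fun p => w k' p i j) (p0 + t *: x))).
    have d2 : is_derive t 1 (fun t => om (p0 + t *: x) h i j) (dom (p0 + t *: x) x h i j).
      have -> : (fun t => om (p0 + t *: x) h i j) =
        \sum_k' (fun t => h 0 k' * w k' (p0 + t *: x) i j).
        apply/funext => u; rewrite fct_sumE summxE; apply: eq_bigr => k' _.
        by rewrite mxE.
      have -> : dom (p0 + t *: x) x h i j =
        \sum_k' (h 0 k' * \sum_l x 0 l * dw l k' (p0 + t *: x) i j).
        rewrite summxE; apply: eq_bigr => k' _; rewrite mxE summxE; congr (_ * _).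
        by apply: eq_bigr => l _; rewrite mxE.
      elim/big_ind2 : _ => [|f a g b|k' _]; first exact: is_derive_cst.
        exact: is_deriveD.
      exact: is_deriveZ.
    have d3 : is_derive t 1 (fun t => (1%:M : 'M[R]_r) i j - t * om (p0 + t *: x) h i j)
       ((- (om (p0 + t *: x) h + t *: dom (p0 + t *: x) x h)) i j).
      have := @is_deriveM _ _ id (fun t => om (p0 + t *: x) h i j) t 1 _ _ (is_derive_id _ _) d2.
      move=> d; have := is_deriveB (is_derive_cst ((1%:M : 'M[R]_r) i j) t 1) d.
      by rewrite !mxE sub0r addrC [_ *: 1]mulr1.
    apply: near_eq_is_derive d3.
    have : nbhs t `]0, 1[%classic.
      by apply: open_nbhs_nbhs; split; [exact: interval_open|rewrite /= in_itv/=].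
    apply: filterS => u; rewrite /= in_itv/= => /andP[u0 u1].
    by rewrite /Q clamp_id ?ltW// !mxE.
  pose X t := Y (x + h) t - Q t *m Y x t.
  (* The defect X satisfies X' = - om X + A, where A is the quantity of [remainder_le] multiplied by
     Y. *)
  pose A t := (- om (p0 + t *: (x + h)) (x + h) *m (1%:M - t *: om (p0 + t *: x) h)
     + (om (p0 + t *: x) h + t *: dom (p0 + t *: x) x h)
     + (1%:M - t *: om (p0 + t *: x) h) *m om (p0 + t *: x) x) *m Y x t.
  have := Hk X A (fun t => - om (p0 + t *: (x + h)) (x + h))
    (r%:R * ((2 * L + 3 * r%:R * L ^+ 2) * 2) * `|h| ^+ 2).
  have -> : X 1 = Y (x + h) 1 - (1%:M - om (p0 + x) h) *m Y x 1 by rewrite /X /Q c11 !scale1r.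
  have -> : K * `|h| ^+ 2 =
    k * (r%:R * ((2 * L + 3 * r%:R * L ^+ 2) * 2) * `|h| ^+ 2) by rewrite /K -mulrA.
  apply.
  - by rewrite !mulr_ge0// ?exprn_ge0// addr_ge0// !mulr_ge0// exprn_ge0.
  - by move=> t; apply: cvgB; [exact: cZ|exact: continuous_mulmx].
  - by rewrite /X /Q Z0 c00 scale0r subr0 mul1mx Y0 subrr.
  - move=> t /andP[t0 t1]; rewrite normrN (le_trans (om_le _ (seg xhr _)))//.
      by rewrite !ltW.
    by rewrite ler_wpM2l.
  - move=> t /andP[t0 t1]; rewrite (le_trans (mx_norm_mul _ _))//.
    have t01 : 0 <= t <= 1 by rewrite !ltW.
    have H := ler_pM (normr_ge0 _) (normr_ge0 _) (remainder_le xr xhr t01 erefl) (Y2 t).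
    rewrite (le_trans (ler_wpM2l _ H))//.
    have alg (a b c : R) : a * (b * c * 2) = a * (b * 2) * c by ring.
    by rewrite alg.
  - move=> t t01 i j; have /andP[t0 t1] := t01.
    have := is_deriveB (dZ t t01 i j) (is_derive_mulmx (dQ t t01) (dY t t01) i j).
    have -> : (fun t => Y (x + h) t i j) - (fun t => (Q t *m Y x t) i j) =
       (fun t => X t i j).
      by apply/funext => u; rewrite /X [RHS]mxE [X in _ = _ + X]mxE.
    suff -> : - om (p0 + t *: (x + h)) (x + h) *m X t + A t =
       - om (p0 + t *: (x + h)) (x + h) *m Y (x + h) t -
       (- (om (p0 + t *: x) h + t *: dom (p0 + t *: x) x h) *m Y x t +
        Q t *m (- om (p0 + t *: x) x *m Y x t)).
      by rewrite [X in _ -> is_derive _ _ _ X]mxE [X in _ -> is_derive _ _ _ (_ + X)]mxE.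
    have Qt : 1%:M - t *: om (p0 + t *: x) h = Q t by rewrite /Q clamp_id// !ltW.
    rewrite /A /X Qt; move: (Q t) (om (p0 + t *: x) h + _) => Qm G.
    rewrite mulmxBr !mulmxDl !mulNmx mulmxN !mulmxA opprD opprK.
    move: (_ *m Y (x + h) t) (_ *m Qm *m _) (G *m _) (Qm *m _ *m _) => a b c d.
    by apply/matrixP => i' j'; rewrite !mxE; ring.
move=> p pr i j.
apply: expansion_differentiable => e e0.
have [d d0 Hd] : exists2 d : R, 0 < d & forall h : 'rV[R]_m, `|h| < d ->
    `|p - p0 + h| <= rho /\ K * `|h| <= e.
  pose K1 := K + 1; have K1_gt0 : 0 < K1.
    by rewrite ltr_wpDl// !mulr_ge0// ?(ltW k0)// addr_ge0// !mulr_ge0// exprn_ge0.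
  exists (Num.min (rho - `|p - p0|) (e / K1)).
    by rewrite lt_min subr_gt0 pr divr_gt0.
  move=> h; rewrite lt_min => /andP[h1 h2]; split.
    by rewrite (le_trans (ler_normD _ _))// -lerBrDl ltW.
  apply: (@le_trans _ _ (K1 * `|h|)); first by rewrite ler_wpM2r// lerDl.
  by rewrite mulrC -ler_pdivlMr// ltW.
apply/nbhs_ballP; exists d => // h; rewrite -ball_normE/= sub0r normrN => hd.
have [xhr Ke] := Hd h hd.
have := main (p - p0) h (ltW pr) xhr.
rewrite [p0 + _]addrC subrK => H.
have -> : B (p + h) i j - B p i j - \sum_i0 h 0 i0 * (- (w i0 p *m B p)) i j =
  (Y (p - p0 + h) 1 - (1%:M - om p h) *m Y (p - p0) 1) i j.
  have -> : \sum_i0 h 0 i0 * (- (w i0 p *m B p)) i j = - (om p h *m B p) i j.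
    rewrite mulmx_suml summxE -sumrN; apply: eq_bigr => l _.
    by rewrite -scalemxAl mxE [in RHS]mxE mulrN.
  rewrite /B [p + h - p0]addrAC mulmxBl mul1mx.
  by move: (om p h *m _) => Z; rewrite !mxE; ring.
rewrite (le_trans (mx_coord_le _ _ _))// (le_trans H)//.
by rewrite expr2 mulrA ler_wpM2r.
Qed.

End System.

Lemma locally_bounded m (D : set 'rV[R]_m) (I : finType) (f : I -> 'rV[R]_m -> R)
    (p : 'rV[R]_m) :
  D p -> (forall i, euclid_smooth D (f i)) ->
  exists2 C : R, 0 <= C & \forall q \near p, forall i, `|f i q| <= C.
Proof.
move=> Dp fs; exists (\sum_i (`|f i p| + 1)).
  by apply: sumr_ge0 => i _; rewrite addr_ge0.
pose P i q : Prop := `|f i q| <= \sum_i (`|f i p| + 1).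
apply: (@filter_forall _ _ P (nbhs p)) => i; rewrite /P.
have : {for p, continuous (f i)}.
  exact/differentiable_continuous/(euclid_smooth_differentiable (fs i)).
move=> /cvgrPdist_le /(_ 1 ltr01); apply: filterS => q H.
have := ler_normB (f i p) (f i p - f i q).
rewrite subKr => /le_trans -> //.
rewrite (bigD1 i)//= -[leLHS]addr0; apply: lerD; first by rewrite lerD2l.
by apply: sumr_ge0 => j _; rewrite addr_ge0.
Qed.

Theorem flat_system m r (D : set 'rV[R]_m) (w : 'I_m -> 'rV[R]_m -> 'M[R]_r) p0 :
  open D -> D p0 -> (forall k i j, euclid_smooth D (fun p => w k p i j)) ->
  (forall p, D p -> forall k l i j,
    'D_(delta_mx 0 k) (fun p => w l p i j) p - 'D_(delta_mx 0 l) (fun p => w k p i j) p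
    + (w k p *m w l p - w l p *m w k p) i j = 0) ->
  exists (rho : R) (B : 'rV[R]_m -> 'M[R]_r),
    [/\ 0 < rho, [set p | `|p - p0| < rho] `<=` D, B p0 = 1%:M,
        forall i j, euclid_smooth [set p | `|p - p0| < rho] (fun p => B p i j) &
        forall p, `|p - p0| < rho -> forall v i j,
          'D_v (fun p => B p i j) p = - ((\sum_k v 0 k *: w k p) *m B p) i j].
Proof.
move=> oD Dp0 ws wflat.
have [C1 C10 H1] := @locally_bounded m D ('I_m * 'I_r * 'I_r)%type
  (fun x p => w x.1.1 p x.1.2 x.2) p0 Dp0 (fun x => ws x.1.1 x.1.2 x.2).
have [C2 C20 H2] := @locally_bounded m D ('I_m * 'I_r * 'I_r * 'I_m)%type
  (fun x => 'D_(delta_mx 0 x.2) (fun p => w x.1.1.1 p x.1.1.2 x.1.2)) p0 Dp0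
  (fun x => euclid_smooth_derive _ (ws x.1.1.1 x.1.1.2 x.1.2)).
have [C3 C30 H3] := @locally_bounded m D ('I_m * 'I_r * 'I_r * 'I_m * 'I_m)%type
  (fun x => 'D_(delta_mx 0 x.2) ('D_(delta_mx 0 x.1.2)
     (fun p => w x.1.1.1.1 p x.1.1.1.2 x.1.1.2))) p0 Dp0
  (fun x => euclid_smooth_derive _ (euclid_smooth_derive _ (ws x.1.1.1.1 x.1.1.1.2 x.1.1.2))).
pose C := C1 + C2 + C3.
have C0 : 0 <= C by rewrite !addr_ge0.
have C1C : C1 <= C by rewrite /C -addrA lerDl addr_ge0.
have C2C : C2 <= C by rewrite /C addrAC lerDr addr_ge0.
have C3C : C3 <= C by rewrite /C lerDr addr_ge0.
have HD : \forall p \near p0, D p by exact: open_nbhs_nbhs.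
have [d/= d0 Hd] : nbhs_ball p0 (fun p => D p /\ (forall k i j, `|w k p i j| <= C) /\
   (forall k i j l, `|'D_(delta_mx 0 l) (fun p => w k p i j) p| <= C) /\
   (forall k i j l l',
      `|'D_(delta_mx 0 l') ('D_(delta_mx 0 l) (fun p => w k p i j)) p| <= C)).
  apply/nbhs_ballP; apply: filterS2 (filterI HD H1) (filterI H2 H3).
  move=> p [Dp K1] [K2 K3]; split=> //; split.
    by move=> k i j; exact: le_trans (K1 (k, i, j)) C1C.
  split; first by move=> k i j l; exact: le_trans (K2 (k, i, j, l)) C2C.
  by move=> k i j l l'; exact: le_trans (K3 (k, i, j, l, l')) C3C.
(* The bounds on the form, its derivative and its Taylor remainder lose factors m, m^2 and m^3; n^3
   dominates all three because n >= 1, even for m = 0. *)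
pose n : R := m%:R + 1.
have n1 : 1 <= n by rewrite lerDr.
have n0 : 0 <= n by rewrite addr_ge0.
have mn : m%:R <= n by rewrite lerDl.
pose L := n ^+ 3 * C.
have L0 : 0 <= L by rewrite mulr_ge0// exprn_ge0.
(* Here (r + 1) (L + 1) z = 1/2, the smallness that Picard iteration needs over a whole ray. *)
pose z : R := (2 * ((r%:R + 1) * (L + 1)))^-1.
have z0 : 0 < z by rewrite invr_gt0 !mulr_gt0// ltr_wpDl.
pose rho := Num.min (d / 2) (Num.min 2^-1 z).
have rho0 : 0 < rho by rewrite !lt_min z0 divr_gt0//= invr_gt0 ltr0n.
have rho1 : rho <= 2^-1 by rewrite !ge_min lexx orbT.
have rhoz : rho <= z by rewrite !ge_min lexx !orbT.
have rhoL : r%:R * (L * rho) <= 2^-1.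
  apply: (@le_trans _ _ ((r%:R + 1) * ((L + 1) * z))).
    apply: ler_pM => //; [by rewrite mulr_ge0// ltW|by rewrite lerDl|].
    by apply: ler_pM => //; rewrite ?lerDl// ltW.
  rewrite /z invfM mulrA mulrCA divff ?mulr1//.
  by rewrite gt_eqF// mulr_gt0// ltr_wpDl.
have {Hd} Hd p : `|p - p0| <= rho -> D p /\ (forall k i j, `|w k p i j| <= C) /\
   (forall k i j l, `|'D_(delta_mx 0 l) (fun p => w k p i j) p| <= C) /\
   (forall k i j l l',
      `|'D_(delta_mx 0 l') ('D_(delta_mx 0 l) (fun p => w k p i j)) p| <= C).
  move=> pr; apply: Hd; rewrite -ball_normE/= distrC (le_lt_trans pr)//.
  rewrite (@le_lt_trans _ _ (d / 2))//; first by rewrite ge_min lexx.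
  by rewrite ltr_pdivrMr// ltr_pMr// ltr1n.
have BD p : `|p - p0| <= rho -> D p by move=> /Hd[].
pose dw l k p : 'M[R]_r := \matrix_(i, j) 'D_(delta_mx 0 l) (fun p => w k p i j) p.
have n13 : n <= n ^+ 3 by rewrite -[X in X <= _]expr1 ler_weXn2l.
have n23 : n ^+ 2 <= n ^+ 3 by rewrite ler_weXn2l.
have om_le p (v : 'rV[R]_m) : `|p - p0| <= rho -> `|\sum_k v 0 k *: w k p| <= L * `|v|.
  move=> /Hd[_ [K _]]; rewrite (le_trans (norm_lincomb v (c := C) _))//.
    by move=> k; apply: mx_norm_le => // i j; exact: K.
  rewrite /L mulrAC; apply: ler_wpM2r => //; apply: ler_wpM2r => //.
  exact: le_trans mn n13.
have dom_le p (h v : 'rV[R]_m) : `|p - p0| <= rho ->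
    `|\sum_k v 0 k *: \sum_l h 0 l *: dw l k p| <= L * `|h| * `|v|.
  move=> /Hd[_ [_ [K _]]].
  rewrite (le_trans (norm_lincomb v (c := m%:R * `|h| * C) _))//.
    move=> k; apply: norm_lincomb => l; apply: mx_norm_le => // i j.
    by rewrite mxE; exact: K.
  have -> : m%:R * `|v| * (m%:R * `|h| * C) = m%:R ^+ 2 * C * `|h| * `|v| by ring.
  rewrite /L; do 3![apply: ler_wpM2r => //].
  by apply: le_trans n23; rewrite ler_pXn2r// nnegrE.
have taylor_om p (h v : 'rV[R]_m) : `|p - p0| <= rho -> `|p + h - p0| <= rho ->
  `|\sum_k v 0 k *: w k (p + h) - \sum_k v 0 k *: w k p -
    \sum_k v 0 k *: \sum_l h 0 l *: dw l k p| <= L * `|h| ^+ 2 * `|v|.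
  move=> pr phr.
  have sg (t : R) : 0 <= t <= 1 -> `|p + t *: h - p0| <= rho by exact: ball_segment.
  rewrite -!sumrB; under eq_bigr do rewrite -!scalerBr.
  rewrite (le_trans (norm_lincomb v (c := (m%:R * `|h|) ^+ 2 * C) _))//.
    move=> k; apply: mx_norm_le => [|i j].
      by rewrite mulr_ge0// exprn_ge0// mulr_ge0.
    rewrite !mxE summxE; under eq_bigr do rewrite !mxE.
    apply: (taylor1 (ws k i j)) => [t /sg /BD//|t a b /sg /Hd[_ [_ [_ K]]]].
    exact: K.
  have -> : m%:R * `|v| * ((m%:R * `|h|) ^+ 2 * C) = m%:R ^+ 3 * C * `|h| ^+ 2 * `|v|.
    by ring.
  rewrite /L; do 2![apply: ler_wpM2r; rewrite ?exprn_ge0//].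
  by apply: ler_wpM2r => //; rewrite ler_pXn2r// nnegrE.
have flatw p : D p -> forall k l,
    dw k l p - dw l k p + w k p *m w l p - w l p *m w k p = 0.
  move=> Dp k l; apply/matrixP => i j; rewrite -addrA mxE [RHS]mxE.
  by rewrite -[RHS](wflat p Dp k l i j); congr (_ + _); rewrite !mxE.
have [B [B0 dB]] := radial_solution ws flatw rho0 L0 BD om_le dom_le taylor_om rhoL rho1.
pose V := [set p | `|p - p0| < rho]; exists rho, B; split => //.
- by move=> p pr; apply: BD; exact: ltW.
- have oV : open V.
    have -> : V = ball p0 rho.
      by apply/seteqP; split => p; rewrite -ball_normE/= distrC.
    exact: ball_open.
  have VD : V `<=` D by move=> p pr; apply: BD; exact: ltW.
  rewrite -/V; suff H k : forall i j, Ck k V (fun p => B p i j).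
    by move=> i j; apply/euclid_smooth_Ck => k; exact: H.
  elim: k => [|k IH] i j; first by split=> // p /dB -/(_ i j)[].
  (* The l-th partial derivative of B is - w_l B, hence as regular as B is known to be. *)
  apply: Ck_partials => // [p /dB -/(_ i j)[]//|l].
  have wC i' j' : Ck k V (fun p => w l p i' j').
    by apply: sub_Ck VD _; exact: (euclid_smooth_Ck _ _).1.
  apply: (eq_Ck oV _ (CkN oV (Ck_mulmx oV wC IH i j))) => p /dB -/(_ i j)[_ ->].
  rewrite (bigD1 l)//= big1 => [|l' ll']; last by rewrite mxE (negPf ll') andbF mul0r.
  by rewrite addr0 [_ 0 l]mxE !eqxx mul1r [RHS]mxE.
- move=> p /dB H v i j; have [_ ->] := H i j.
  rewrite mulmx_suml summxE -sumrN; apply: eq_bigr => l _.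
  by rewrite -scalemxAl mxE [in RHS]mxE mulrN.
Qed.

End FlatSystem.

(** * Lifting to immersed Lie subgroups *)

Section Lift.
Variable R : realType.

Lemma smooth_Ck m (D : set 'rV[R]_m) f k : euclid_smooth D f -> Ck k D f.
Proof. by move=> /euclid_smooth_Ck. Qed.

(** Restricted to a segment issued from p0, the system is a linear ODE with zero initial value, and
    [ode_estimate] with zero inhomogeneity applies. *)
Lemma linear_system_unique m q (D : set 'rV[R]_m) (X : 'rV[R]_m -> 'rV[R]_q)
    (N : 'I_m -> 'rV[R]_m -> 'M[R]_q) p0 :
  open D -> D p0 -> X p0 = 0 ->
  (forall k i j, euclid_smooth D (fun p => N k p i j)) ->
  (forall p, D p -> forall j, differentiable (fun p => X p 0 j) p) ->
  (forall p, D p -> forall k j,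
     'D_(delta_mx 0 k) (fun p => X p 0 j) p = (X p *m N k p) 0 j) ->
  \forall p \near p0, X p = 0.
Proof.
move=> oD Dp0 X0 Ns dX DX.
have [C C0 HC] := @locally_bounded _ m D ('I_m * 'I_q * 'I_q)%type
  (fun x p => N x.1.1 p x.1.2 x.2) p0 Dp0 (fun x => Ns x.1.1 x.1.2 x.2).
have HD : \forall p \near p0, D p by exact: open_nbhs_nbhs.
have [d/= d0 Hd] : nbhs_ball p0 (fun p => D p /\ forall k i j, `|N k p i j| <= C).
  apply/nbhs_ballP; apply: filterS2 HD HC => p Dp K; split=> // k i j.
  exact: (K (k, i, j)).
(* A radius at most 1 gives |x| <= 1, so the coefficient along the segment is bounded by m C. *)
apply/nbhs_ballP; exists (Num.min d 1) => /=; first by rewrite lt_min d0 ltr01.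
move=> p; rewrite -ball_normE/= lt_min distrC => /andP[pd p1].
pose x := p - p0.
have seg (t : R) : 0 <= t <= 1 -> D (p0 + t *: x) /\ forall k i j, `|N k (p0 + t *: x) i j| <= C.
  move=> /andP[t0 t1]; apply: Hd; rewrite -ball_normE/= opprD addrA subrr sub0r.
  by rewrite normrN normrZ ger0_norm// (le_lt_trans _ pd)// ler_piMl.
have dseg (t : R) j : 0 <= t <= 1 ->
    is_derive t 1 (fun t => X (p0 + t *: x) 0 j)
      ((X (p0 + t *: x) *m \sum_k x 0 k *: N k (p0 + t *: x)) 0 j).
  move=> t01; have [Dt _] := seg t t01.
  have := is_derive_line (dX _ Dt j); rewrite derive_linear; last exact: dX.
  rewrite mulmx_sumr summxE.
  by under eq_bigr do rewrite DX//;
    under [X in _ -> is_derive _ _ _ X]eq_bigr do rewrite -scalemxAr mxE.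
have [k k0 Hk] := @ode_estimate R q 1 (m%:R * C) (mulr_ge0 (ler0n _ _) C0).
(* Transposition moves the coefficient to the left, as in [ode_estimate]. *)
have := Hk (fun t => (X (p0 + clamp t *: x))^T) (fun=> 0)
  (fun t => (\sum_k x 0 k *: N k (p0 + clamp t *: x))^T) 0 (lexx 0).
have c11 : clamp 1 = 1 :> R by rewrite clamp_id// ler01 lexx.
have c00 : clamp 0 = 0 :> R by rewrite clamp_id// ler01 lexx.
rewrite mulr0 c11 c00 scale1r scale0r addr0 X0 trmx0 [p0 + x]addrC subrK.
move=> H; apply: trmx_inj; rewrite trmx0; apply/eqP; rewrite -normr_le0; apply: H => //.
- apply: continuous_mx => i j.
  have -> : (fun t => (X (p0 + clamp t *: x))^T i j) =
      (fun t => X (p0 + t *: x) 0 i) \o @clamp R.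
    by apply/funext => t; rewrite mxE (ord1 j).
  move=> t; apply: continuous_comp; first exact: continuous_clamp.
  exact: is_derive_continuous (dseg _ _ (clamp01 t)).
- move=> t _; rewrite (_ : `|_^T| = `|\sum_k x 0 k *: N k (p0 + clamp t *: x)|).
    rewrite (le_trans (norm_lincomb x (c := C) _))//.
      by move=> l; apply: mx_norm_le => // i j; have [_] := seg _ (clamp01 t); exact.
    rewrite mulrAC ler_piMr ?mulr_ge0//; exact: ltW.
  apply/eqP; rewrite eq_le; apply/andP; split; apply: mx_norm_le => // i j.
    by rewrite mxE mx_coord_le.
  by rewrite (le_trans _ (mx_coord_le _ j i))// mxE.
- by move=> t _; rewrite normr0.
- move=> t /andP[t0 t1] i j; rewrite (ord1 j) addr0.
  have t01 : 0 <= t <= 1 by rewrite !ltW.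
  rewrite clamp_id// -trmx_mul mxE.
  have := dseg t i t01; apply: near_eq_is_derive.
  have : nbhs t `]0, 1[%classic.
    by apply: open_nbhs_nbhs; split; [exact: interval_open|rewrite /= in_itv/= t0].
  apply: filterS => u; rewrite /= in_itv/= => /andP[u0 u1].
  by rewrite clamp_id ?mxE// !ltW.
Qed.

Lemma near_ball_sub m (P : 'rV[R]_m -> Prop) (p0 : 'rV[R]_m) : (\forall p \near p0, P p) ->
  exists2 rho : R, 0 < rho & forall p, `|p - p0| < rho -> P p.
Proof.
move=> /nbhs_ballP[r /= r0 H]; exists r => // p pr; apply: H.
by rewrite -ball_normE/= distrC.
Qed.

Lemma open_ball_rV m (p0 : 'rV[R]_m) (rho : R) : open [set p | `|p - p0| < rho].
Proof.
have -> : [set p | `|p - p0| < rho] = ball p0 rho.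
  by apply/seteqP; split => p; rewrite -ball_normE/= distrC.
exact: ball_open.
Qed.

(* A solution b of a linear system which is tangent to the immersed submanifold
   g, and which starts on it, stays on it: the left inverse of g given by the
   inverse function theorem provides the candidate lift u, and the difference
   b - g u solves a linear system. *)
Lemma integral_lift m d q (D : set 'rV[R]_m) (D0 : set 'rV[R]_d)
    (g : 'rV[R]_d -> 'rV[R]_q) (b : 'rV[R]_m -> 'rV[R]_q)
    (M : 'I_m -> 'rV[R]_m -> 'M[R]_q) (p0 : 'rV[R]_m) (u0 : 'rV[R]_d) :
  open D -> D p0 -> open D0 -> D0 u0 -> b p0 = g u0 ->
  (forall j, euclid_smooth D0 (fun u => g u 0 j)) ->
  (forall j, euclid_smooth D (fun p => b p 0 j)) ->
  (forall k i j, euclid_smooth D (fun p => M k p i j)) ->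
  (forall v : 'rV[R]_d, v *m Jac g u0 = 0 -> v = 0) ->
  (forall p, D p -> forall k j,
     'D_(delta_mx 0 k) (fun p => b p 0 j) p = (b p *m M k p) 0 j) ->
  (forall (p : 'rV[R]_m) (u : 'rV[R]_d) k, D p -> D0 u -> exists v : 'rV[R]_d, g u *m M k p = v *m Jac g u) ->
  exists (rho : R) (u : 'rV[R]_m -> 'rV[R]_d),
    [/\ 0 < rho, [set p | `|p - p0| < rho] `<=` D,
        forall p, `|p - p0| < rho -> D0 (u p) /\ g (u p) = b p &
        forall j, euclid_smooth [set p | `|p - p0| < rho] (fun p => u p 0 j)].
Proof.
move=> oD Dp0 oD0 D0u0 bg0 gs bs Ms inj Db tang.
(* P is a linear left inverse of the differential of g at u0; hence F = g P has Jacobian matrix 1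
   there. *)
have /row_freeP[P JP] : row_free (Jac g u0).
  rewrite -kermx_eq0; apply/eqP/row_matrixP => i; rewrite row0; apply: inj.
  by rewrite -row_mul mulmx_ker row0.
pose F u := g u *m P.
have Fs j : euclid_smooth D0 (fun u => F u 0 j) by exact: euclid_smooth_linear.
have JF u : D0 u -> Jac F u = Jac g u *m P.
  by move=> D0u; apply: Jac_linear => j; exact: euclid_smooth_differentiable (gs j) D0u.
have JF0 : Jac F u0 = 1%:M by rewrite JF.
have [V [phi [oV VF phi0 phiP phis]]] := inverse_function oD0 D0u0 Fs JF0.
(* If b = g u then F u = y, which leaves [phi \o y] as the candidate lift. *)
pose y p := b p *m P.
have ys j : euclid_smooth D (fun p => y p 0 j) by exact: euclid_smooth_linear.
have yp0 : y p0 = F u0 by rewrite /y bg0.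
have [r r0 Hr] : exists2 r : R, 0 < r & forall p, `|p - p0| < r -> D p /\ V (y p).
  apply: near_ball_sub; apply: filterI; first exact: open_nbhs_nbhs.
  have cy : {for p0, continuous y}.
    apply: differentiable_continuous; apply: differentiable_row => j.
    exact: euclid_smooth_differentiable (ys j) Dp0.
  by apply: cy; rewrite yp0; exact: open_nbhs_nbhs.
pose D1 := [set p | `|p - p0| < r].
have oD1 : open D1 by exact: open_ball_rV.
have D1D : D1 `<=` D by move=> p /Hr[].
have D1V p : D1 p -> V (y p) by move=> /Hr[].
have D1p0 : D1 p0 by rewrite /D1/= subrr normr0.
pose u := phi \o y.
have D1u p : D1 p -> D0 (u p) by move=> /D1V/phiP[].
have us j : euclid_smooth D1 (fun p => u p 0 j).
  apply/euclid_smooth_Ck => k.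
  apply: (@Ck_comp _ _ _ oD1 _ _ _ y (fun z => phi z 0 j) D1V).
    by move=> i; move: k; apply/euclid_smooth_Ck; apply: sub_euclid_smooth (ys i).
  by move: k; apply/euclid_smooth_Ck.
have up0 : u p0 = u0 by rewrite /u/= yp0.
(* N is M followed by the projection complementary to P Jac phi Jac g, whose image lies in the
   tangent space of g at u p. *)
pose N k p := M k p - M k p *m P *m Jac phi (y p) *m Jac g (u p).
have Jphi p : D1 p -> Jac g (u p) *m P *m Jac phi (y p) = 1%:M.
  move=> D1p; have [Du Fu] := phiP _ (D1V p D1p).
  (* F o phi = id gives the product in one order; for square matrices the other order follows. *)
  suff JJ : Jac phi (y p) *m Jac F (phi (y p)) = 1%:M.
    by rewrite -(JF _ (D1u p D1p)); exact: mulmx1C JJ.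
  rewrite -Jac_comp.
  - by rewrite -[RHS](Jac_id (y p)); apply: (eq_Jac oV) (D1V p D1p) => z /phiP[].
  - by move=> j; exact: euclid_smooth_differentiable (phis j) (D1V p D1p).
  - by move=> j; exact: euclid_smooth_differentiable (Fs j) Du.
have Ns k i j : euclid_smooth D1 (fun p => N k p i j).
  apply/euclid_smooth_Ck => l; rewrite /N.
  have MC i' j' : Ck l D1 (fun p => M k p i' j').
    by apply: smooth_Ck; apply: sub_euclid_smooth (Ms k i' j').
  have yC j' : Ck l D1 (fun p => y p 0 j').
    by apply: smooth_Ck; apply: sub_euclid_smooth (ys j').
  have uC j' : Ck l D1 (fun p => u p 0 j') by exact: smooth_Ck.
  under eq_fun do rewrite mxE [X in _ + X]mxE.
  apply: CkB => //; apply: Ck_mulmx => // [i1 j1|i1 j1]; last first.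
    exact: (@Ck_comp _ _ _ oD1 l _ D0 u (fun z => Jac g z i1 j1) D1u uC (Ck_Jac l gs i1 j1)).
  apply: Ck_mulmx => // [i2 j2|i2 j2]; last first.
    exact: (@Ck_comp _ _ _ oD1 l _ V y (fun z => Jac phi z i2 j2) D1V yC (Ck_Jac l phis i2 j2)).
  by apply: Ck_mulmx => // i3 j3; exact: Ck_cst.
pose X p := b p - g (u p).
have gus j : euclid_smooth D1 (fun p => g (u p) 0 j).
  apply/euclid_smooth_Ck => k.
  apply: (@Ck_comp _ _ _ oD1 _ _ _ u (fun z => g z 0 j) D1u).
    by move=> i; move: k; apply/euclid_smooth_Ck.
  by move: k; apply/euclid_smooth_Ck.
have dX p : D1 p -> forall j, differentiable (fun p => X p 0 j) p.
  move=> D1p j.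
  have -> : (fun p => X p 0 j) = (fun p => b p 0 j) - (fun p => g (u p) 0 j).
    by apply/funext => z; rewrite /X !mxE.
  apply: differentiableB; first exact: euclid_smooth_differentiable (bs j) (D1D _ D1p).
  exact: euclid_smooth_differentiable (gus j) D1p.
have [k k0 Hk] : exists2 k : R, 0 < k & forall p, `|p - p0| < k -> X p = 0 /\ D1 p.
  apply: near_ball_sub; apply: filterI; last exact: open_nbhs_nbhs.
  apply: (linear_system_unique oD1 D1p0 _ Ns dX).
    by rewrite /X up0 bg0 subrr.
  move=> p D1p k j.
  have Dp := D1D p D1p.
  have JbE : row k (Jac b p) = b p *m M k p.
    by apply/rowP => i; rewrite mxE [LHS]mxE Db.
  have Jgu : Jac (g \o u) p = Jac b p *m P *m Jac phi (y p) *m Jac g (u p).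
    rewrite Jac_comp; last 2 first.
    - by move=> i; exact: euclid_smooth_differentiable (us i) D1p.
    - by move=> i; exact: euclid_smooth_differentiable (gs i) (D1u p D1p).
    rewrite Jac_comp; last 2 first.
    - by move=> i; exact: euclid_smooth_differentiable (ys i) Dp.
    - by move=> i; exact: euclid_smooth_differentiable (phis i) (D1V p D1p).
    by rewrite Jac_linear// => i; exact: euclid_smooth_differentiable (bs i) Dp.
  have -> : 'D_(delta_mx 0 k) (fun p => X p 0 j) p =
     (row k (Jac b p) - row k (Jac (g \o u) p)) 0 j.
    have -> : (fun p => X p 0 j) = (fun p => b p 0 j) - (fun p => g (u p) 0 j).
      by apply/funext => z; rewrite /X !mxE.
    rewrite deriveB; last 2 first.
    - apply: diff_derivable; exact: euclid_smooth_differentiable (bs j) (D1D _ D1p).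
    - apply: diff_derivable; exact: euclid_smooth_differentiable (gus j) D1p.
    by rewrite !mxE.
  congr ((_ : 'rV[R]_q) 0 j).
  (* Write b = X + g u. By tangency the part in g u becomes v Jac g, which P Jac phi Jac g fixes; it
     cancels and X N remains. *)
  rewrite Jgu !row_mul JbE; have [v vE] := tang p (u p) k Dp (D1u p D1p).
  have bE : b p = X p + g (u p) by rewrite /X subrK.
  rewrite bE /N; move: (X p) => e; rewrite !mulmxDl vE.
  have := congr1 (mulmx v) (Jphi p D1p).
  rewrite mulmx1 !mulmxA => ->.
  by rewrite mulmxBr !mulmxA opprD addrACA subrr addr0.
exists k, u; split => //.
- by move=> p /Hk[_ /D1D].
- move=> p /Hk[X0 D1p]; split; first exact: D1u.
  by apply/eqP; rewrite eq_sym -subr_eq0 -/(X p) X0.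
- by move=> j; apply: sub_euclid_smooth (us j) => p /Hk[].
Qed.

End Lift.

Lemma continuous_at_pair (T U V : topologicalType) (f : T -> U) (g : T -> V) (x : T) :
  {for x, continuous f} -> {for x, continuous g} ->
  {for x, continuous (fun z => (f z, g z))}.
Proof. by move=> cf cg; exact: (cvg_pair cf cg). Qed.

Section LieLift.
Variables (R : realType) (r : nat) (S : set 'M[R]_r) (K : lie_subgroup S).

Let c0 := chart_at (ls_one K).
Let u0 := chart c0 (ls_one K).
Let D0 := chart c0 @` chart_dom c0.
Let io (u : 'rV[R]_(ls_dim K)) : 'M[R]_r := ls_incl (chartV c0 u).

Let oD0 : open D0. Proof. exact: chart_img_open. Qed.
Let D0u0 : D0 u0. Proof. by exists (ls_one K) => //; exact: chart_at_dom. Qed.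

Let ios a b : euclid_smooth D0 (fun u => io u a b).
Proof. by have := @ls_incl_smooth _ _ _ K a b c0; rewrite setTI. Qed.

Let D0P u : D0 u -> chart_dom c0 (chartV c0 u) /\ chart c0 (chartV c0 u) = u.
Proof. by move=> [x xd <-]; rewrite chartK. Qed.

Let io1 : io u0 = 1%:M.
Proof. by rewrite /io /u0 chartK ?ls_incl_one//; exact: chart_at_dom. Qed.

(* Differentiating the right translation by an element of the group: the tangent
   spaces of K are the translates of its Lie algebra. *)
Lemma lie_algebra_translate W u : lie_algebra K W -> D0 u ->
  exists v : 'rV[R]_(ls_dim K),
    forall a b, (W *m io u) a b = 'D_v (fun z => io z a b) u.
Proof.
move=> [v0 WE] D0u.
have [bd bu] := D0P D0u.
pose bb := chartV c0 u.
pose nu z := chart c0 (ls_mul (chartV c0 z) bb).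
have oneb : ls_mul (ls_one K) bb = bb.
  by apply: ls_incl_inj; rewrite ls_incl_mul ls_incl_one mul1mx.
have V0 : chartV c0 u0 = ls_one K by rewrite chartK//; exact: chart_at_dom.
have nu0 : nu u0 = u by rewrite /nu V0 oneb.
have dnu k : differentiable (fun z => nu z 0 k) u0.
  have Z0 : [set w : 'rV[R]_(ls_dim K + ls_dim K) | exists a b : K,
      [/\ chart_dom c0 a, chart_dom c0 b, chart_dom c0 (ls_mul a b)
          & w = row_mx (chart c0 a) (chart c0 b)]] (row_mx u0 u).
    exists (ls_one K), bb; split => //; first exact: chart_at_dom.
      by rewrite oneb.
    by rewrite bu.
  have dmu := euclid_smooth_differentiable (@ls_mul_smooth _ _ _ K c0 c0 c0 k) Z0.
  have dF (j : 'I_(ls_dim K + ls_dim K)) :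
      differentiable (fun z : 'rV[R]_(ls_dim K) => row_mx z u 0 j) u0.
    case: (split_ordP j) => i ->.
      by under eq_fun do rewrite row_mxEl; exact: differentiable_coord.
    by under eq_fun do rewrite row_mxEr; exact: differentiable_cst.
  have := chain_differentiable dF dmu; set f := (_ \o _).
  by rewrite (_ : f = fun z => nu z 0 k)//; apply/funext => z; rewrite /f/= row_mxKl row_mxKr.
have cm : {for u0, continuous (fun z => ls_mul (chartV c0 z) bb)}.
  have cV : {for u0, continuous (chartV c0)}.
    by apply: chartV_continuous; exact: chart_at_dom.
  have cp : {for u0, continuous (fun z => (chartV c0 z, bb))}.
    by apply: (continuous_at_pair cV); exact: cst_continuous.
  exact: (continuous_comp cp (@ls_mul_continuous _ _ _ K _)).
have nearE : \forall z \near u0, io (nu z) = io z *m io u.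
  have : \forall z \near u0, chart_dom c0 (ls_mul (chartV c0 z) bb).
    by apply: cm; rewrite V0 oneb; apply: open_nbhs_nbhs; split => //; exact: chart_dom_open.
  by apply: filterS => z zd; rewrite /io /nu chartK// ls_incl_mul.
exists (\row_k 'D_v0 (fun z => nu z 0 k) u0) => a b.
have dio c d : differentiable (fun z => io z c d) u.
  exact: euclid_smooth_differentiable (ios c d) D0u.
have dio0 c d : differentiable (fun z => io z c d) u0.
  exact: euclid_smooth_differentiable (ios c d) D0u0.
have := @chain_derive _ _ _ nu (fun z => io z a b) u0 v0 dnu.
rewrite nu0 => <-//.
have -> : 'D_v0 ((fun z => io z a b) \o nu) u0 = 'D_v0 (fun z => (io z *m io u) a b) u0.
  by apply: near_eq_derive; apply: filterS nearE => z /= ->.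
have -> : (fun z => (io z *m io u) a b) = (fun z => (row a (io z) *m io u) 0 b).
  by apply/funext => z; rewrite -row_mul [RHS]mxE.
have drow c : differentiable (fun z => row a (io z) 0 c) u0.
  by under eq_fun do rewrite mxE.
rewrite (@derive_Jac _ _ _ (fun z => row a (io z) *m io u)); last first.
  have -> : (fun z => (row a (io z) *m io u) 0 b) = \sum_k (fun z => row a (io z) 0 k * io u k b).
    by apply/funext => z; rewrite fct_sumE mxE.
  by apply: differentiable_sum => k; exact: differentiableM.
rewrite (Jac_linear _ drow) mulmxA !mxE; apply: eq_bigr => c _; congr (_ * _).
rewrite -derive_Jac// WE mxE /tderiv.
by congr ('D_v0 _ _); apply/funext => z; rewrite mxE.
Qed.

(** Matrices are flattened by [mxvec], so that left multiplication by - w_k becomes right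
    multiplication of a row vector by a matrix, the form required by [integral_lift]. Tangency is
    [lie_algebra_translate], up to sign. *)
Lemma lie_lift m (D : set 'rV[R]_m) (B : 'rV[R]_m -> 'M[R]_r)
    (w : 'I_m -> 'rV[R]_m -> 'M[R]_r) (p0 : 'rV[R]_m) :
  open D -> D p0 -> B p0 = 1%:M ->
  (forall a b, euclid_smooth D (fun p => B p a b)) ->
  (forall k a b, euclid_smooth D (fun p => w k p a b)) ->
  (forall p k, D p -> lie_algebra K (w k p)) ->
  (forall p k, D p -> forall a b,
     'D_(delta_mx 0 k) (fun p => B p a b) p = - (w k p *m B p) a b) ->
  exists (rho : R) (u : 'rV[R]_m -> 'rV[R]_(ls_dim K)),
    [/\ 0 < rho, [set p | `|p - p0| < rho] `<=` D,
        forall p, `|p - p0| < rho -> D0 (u p) /\ ls_incl (chartV c0 (u p)) = B p &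
        forall j, euclid_smooth [set p | `|p - p0| < rho] (fun p => u p 0 j)].
Proof.
move=> oD Dp0 B1 Bs ws wK DB.
pose g u : 'rV[R]_(r * r) := mxvec (io u).
pose b p : 'rV[R]_(r * r) := mxvec (B p).
pose M k p : 'M[R]_(r * r) := - lin_mulmx (w k p).
have gs j : euclid_smooth D0 (fun u => g u 0 j).
  by case/mxvec_indexP: j => i j; under eq_fun do rewrite mxvecE; exact: ios.
have bs j : euclid_smooth D (fun p => b p 0 j).
  by case/mxvec_indexP: j => i j; under eq_fun do rewrite mxvecE; exact: Bs.
have Ms k i j : euclid_smooth D (fun p => M k p i j).
  apply/euclid_smooth_Ck => l; case/mxvec_indexP: j => a c.
  under eq_fun do rewrite mxE [lin_mx _ _ _]mxE /= mxvecE.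
  apply: CkN => //; apply: Ck_mulmx => // [a' b'|a' b']; first exact: smooth_Ck.
  exact: Ck_cst.
have dg u a c v : D0 u -> 'D_v (fun z => io z a c) u = (v *m Jac g u) 0 (mxvec_index a c).
  move=> D0u; rewrite -derive_Jac; last exact: euclid_smooth_differentiable (gs _) D0u.
  by under [in RHS]eq_fun do rewrite mxvecE.
have bg0 : b p0 = g u0 by rewrite /b /g B1 io1.
have [v vJ|p Dp k j|p u k Dp D0u|rho [u [rho0 rhoD uP us]]] := @integral_lift R m _ (r * r) D D0 g b M p0 u0 oD Dp0 oD0 D0u0 bg0 gs bs Ms.
- apply: (@ls_incl_immersion _ _ _ K (ls_one K)) => i j.
  by rewrite -[LHS]/('D_v (fun z => io z i j) u0) dg// vJ mxE.
- case/mxvec_indexP: j => a c; under eq_fun do rewrite mxvecE.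
  by rewrite DB// /M /b mulmxN [in RHS]mxE mul_vec_lin mxvecE.
- have [v vE] := lie_algebra_translate (wK p k Dp) D0u.
  exists (- v); apply/rowP => j; case/mxvec_indexP: j => a c.
  by rewrite mulmxN mulNmx mxE [RHS]mxE mul_vec_lin mxvecE -dg// vE.
exists rho, u; split => // p /uP[Du E]; split => //.
by apply: (can_inj mxvecK).
Qed.

End LieLift.

(** * Smooth functions and maps on manifolds *)

Section ManifoldCalculus.
Variables (R : realType) (m : nat) (M : manifold R m).
Implicit Types (U V : set M) (c : chart_idx M) (x y : M).

Lemma euclid_smooth_local d (D : set 'rV[R]_d) (f : 'rV[R]_d -> R) :
  (forall p, D p -> exists2 D', D' p & euclid_smooth D' f) -> euclid_smooth D f.
Proof. by move=> H vs p /H[D' D'p fs]; exact: fs. Qed.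

Lemma eq_euclid_smooth d (D : set 'rV[R]_d) (f g : 'rV[R]_d -> R) : open D ->
  (forall p, D p -> f p = g p) -> euclid_smooth D f -> euclid_smooth D g.
Proof.
move=> oD fg fs; apply/euclid_smooth_Ck => k.
by apply: (eq_Ck oD fg); exact: smooth_Ck.
Qed.

Lemma euclid_smooth_comp a b (D : set 'rV[R]_a) (D' : set 'rV[R]_b)
    (F : 'rV[R]_a -> 'rV[R]_b) (g : 'rV[R]_b -> R) :
  open D -> (forall p, D p -> D' (F p)) ->
  (forall j, euclid_smooth D (fun p => F p 0 j)) -> euclid_smooth D' g ->
  euclid_smooth D (g \o F).
Proof.
move=> oD DF Fs gs; apply/euclid_smooth_Ck => k.
by apply: (Ck_comp oD DF) => [j|]; exact: smooth_Ck.
Qed.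

Lemma open_chart_img U c : open U -> open (chart c @` (U `&` chart_dom c)).
Proof.
move=> oU; rewrite openE => _ [x [Ux xd] <-].
have H1 : nbhs (chart c x) (chart c @` chart_dom c).
  by apply: open_nbhs_nbhs; split; [exact: chart_img_open|exists x].
have H2 : nbhs (chart c x) [set p | U (chartV c p)].
  apply: (chartV_continuous xd); rewrite chartK//.
  exact: open_nbhs_nbhs.
apply: filterS2 H1 H2 => p [y yd <-] /=; rewrite chartK// => Uy.
by exists y.
Qed.

Lemma open_chart_preimage U c (D : set 'rV[R]_m) : open U -> U `<=` chart_dom c ->
  open D -> open [set y | U y /\ D (chart c y)].
Proof.
move=> oU Uc oD; rewrite openE => y [Uy Dy].
have H1 : nbhs y U by exact: open_nbhs_nbhs.
have H2 : nbhs y [set z | D (chart c z)].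
  by apply: (chart_continuous (Uc y Uy)); exact: open_nbhs_nbhs.
by apply: filterS2 H1 H2.
Qed.

Lemma transition_smooth c c' k :
  euclid_smooth (chart c @` (chart_dom c' `&` chart_dom c))
    (fun p => chart c' (chartV c p) 0 k).
Proof. by rewrite setIC; exact: chart_transition. Qed.
Arguments transition_smooth : clear implicits.

Lemma smooth_on_chart U c (f : M -> R) : open U -> U `<=` chart_dom c ->
  euclid_smooth (chart c @` U) (f \o chartV c) -> smooth_on U f.
Proof.
move=> oU Uc fs c'; pose D := chart c' @` (U `&` chart_dom c').
have oD : open D by exact: open_chart_img.
have DP p : D p -> U (chartV c' p) by move=> [x [Ux xd] <-]; rewrite chartK.
apply: (@eq_euclid_smooth _ _ ((f \o chartV c) \o (fun p => chart c (chartV c' p)))) => //.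
  by move=> p /DP Up /=; rewrite chartK//; exact: Uc.
apply: (euclid_smooth_comp oD _ _ fs) => [p /DP Up|j]; first by exists (chartV c' p).
apply: sub_euclid_smooth (transition_smooth c' c j) => p [x [Ux xd] <-].
by exists x => //; split => //; exact: Uc.
Qed.

Lemma sub_smooth_on U V f : V `<=` U -> smooth_on U f -> smooth_on V f.
Proof.
move=> VU fs c; apply: sub_euclid_smooth (fs c) => p [x [Vx xd] <-].
by exists x => //; split => //; exact: VU.
Qed.

Lemma smooth_on_local U f : (forall x, U x -> exists2 V, V x & smooth_on V f) ->
  smooth_on U f.
Proof.
move=> H c; apply: euclid_smooth_local => p [x [Ux xd] <-].
have [V Vx fs] := H x Ux; exists (chart c @` (V `&` chart_dom c)) => //.
by exists x.
Qed.

Lemma eq_smooth_on U f g : open U -> (forall x, U x -> f x = g x) ->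
  smooth_on U f -> smooth_on U g.
Proof.
move=> oU fg fs c; apply: eq_euclid_smooth (fs c); first exact: open_chart_img.
by move=> p [x [Ux xd] <-] /=; rewrite chartK// fg.
Qed.

Lemma smooth_on_coord c k : smooth_on (chart_dom c) (fun x => chart c x 0 k).
Proof. by move=> c'; exact: transition_smooth. Qed.
Arguments smooth_on_coord : clear implicits.

Lemma smooth_on_cst U (a : R) : smooth_on U (fun=> a).
Proof. by move=> c; apply/euclid_smooth_Ck => k; exact: Ck_cst. Qed.

Section SmoothAlgebra.
Variable U : set M.
Hypothesis oU : open U.

Lemma smooth_onD f g : smooth_on U f -> smooth_on U g -> smooth_on U (fun x => f x + g x).
Proof.
move=> fs gs c; apply/euclid_smooth_Ck => k.
apply: (CkD (open_chart_img oU) (f := f \o chartV c) (g := g \o chartV c));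
  apply: smooth_Ck; [exact: fs|exact: gs].
Qed.

Lemma smooth_onM f g : smooth_on U f -> smooth_on U g -> smooth_on U (fun x => f x * g x).
Proof.
move=> fs gs c; apply/euclid_smooth_Ck => k.
apply: (CkM (open_chart_img oU) (f := f \o chartV c) (g := g \o chartV c));
  apply: smooth_Ck; [exact: fs|exact: gs].
Qed.

Lemma smooth_on_sum (I : Type) (s : seq I) (P : pred I) (f : I -> M -> R) :
  (forall i, smooth_on U (f i)) -> smooth_on U (fun x => \sum_(i <- s | P i) f i x).
Proof.
move=> fs; elim: s => [|i s IH].
  by under eq_fun do rewrite big_nil; exact: smooth_on_cst.
under eq_fun do rewrite big_cons.
by case: (P i) => //; exact: smooth_onD.
Qed.

End SmoothAlgebra.

Lemma smooth_on_comp_chart U c (g : 'rV[R]_m -> R) (D : set 'rV[R]_m) :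
  open U -> U `<=` chart_dom c -> (forall y, U y -> D (chart c y)) ->
  euclid_smooth D g -> smooth_on U (fun y => g (chart c y)).
Proof.
move=> oU Uc UD gs; apply: (smooth_on_chart oU Uc).
have oI : open (chart c @` U).
  by have := @open_chart_img U c oU; rewrite setIidl.
apply: (@eq_euclid_smooth _ _ g) => //.
  by move=> p [x Ux <-] /=; rewrite chartK//; exact: Uc.
by apply: sub_euclid_smooth gs => p [x Ux <-]; exact: UD.
Qed.

(* The matrix, acting on row vectors, of the change of coordinates from the
   chart a to the chart b at x. *)
Definition trans_mx (a b : chart_idx M) (x : M) : 'M[R]_m :=
  Jac (fun p => chart b (chartV a p)) (chart a x).

Lemma transition_differentiable a b x k : chart_dom a x -> chart_dom b x ->
  differentiable (fun p => chart b (chartV a p) 0 k) (chart a x).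
Proof.
move=> xa xb; have T := transition_smooth a b k; apply: (euclid_smooth_differentiable T).
by exists x.
Qed.

Lemma trans_mxK a b x : chart_dom a x -> chart_dom b x ->
  trans_mx a b x *m trans_mx b a x = 1%:M.
Proof.
move=> xa xb; rewrite /trans_mx -{2}(chartK xa).
rewrite -(@Jac_comp _ _ _ _ (fun p => chart b (chartV a p)) (fun p => chart a (chartV b p))).
- rewrite -(Jac_id (chart a x)).
  apply: (eq_Jac (@open_chart_img _ a (chart_dom_open b))); last by exists x.
  by move=> p [y [yb ya] <-] /=; rewrite !chartK.
- by move=> j; exact: transition_differentiable.
- by move=> j; rewrite chartK//; exact: transition_differentiable.
Qed.

Lemma tderiv_chart c U x v f : open U -> U x -> chart_dom c x -> smooth_on U f ->
  tderiv x v f = 'D_(v *m trans_mx (chart_at x) c x) (f \o chartV c) (chart c x).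
Proof.
move=> oU Ux xc fs; rewrite /tderiv; set a := chart_at x.
have xa : chart_dom a x by exact: chart_at_dom.
have dt j := transition_differentiable j xa xc.
have df : differentiable (f \o chartV c) (chart c x).
  by apply: euclid_smooth_differentiable (fs c) _; exists x.
have E := @chain_derive _ _ _ (fun p => chart c (chartV a p)) (f \o chartV c) (chart a x) v dt.
rewrite chartK// in E; have {}E := E df.
have -> : v *m trans_mx a c x =
    \row_j 'D_v (fun p => chart c (chartV a p) 0 j) (chart a x).
  by apply/rowP => j; rewrite [RHS]mxE /trans_mx -(derive_Jac v (dt j)).
rewrite -E; apply: (eq_derive _ (@open_chart_img _ a (chart_dom_open c))); last by exists x.
by move=> p [y [yc ya] <-] /=; rewrite (chartK ya) (chartK yc).
Qed.

(** The k-th coordinate vector field of the chart c; vector fields are expressed in the preferred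
    chart at each point, whence the transition matrix. *)
Definition coord_field c (k : 'I_m) (y : M) : 'rV[R]_m :=
  row k (trans_mx c (chart_at y) y).

Lemma tderiv_coord_field c k U y f : open U -> U y -> chart_dom c y -> smooth_on U f ->
  tderiv y (coord_field c k y) f = 'D_(delta_mx 0 k) (f \o chartV c) (chart c y).
Proof.
move=> oU Uy yc fs; rewrite (tderiv_chart _ oU Uy yc fs) /coord_field -row_mul.
by rewrite trans_mxK ?row1//; exact: chart_at_dom.
Qed.

Lemma coord_field_expansion c y v : chart_dom c y ->
  v = \sum_k (v *m trans_mx (chart_at y) c y) 0 k *: coord_field c k y.
Proof.
move=> yc; rewrite -[LHS]mulmx1 -(trans_mxK (chart_at_dom y) yc) mulmxA.
by rewrite -mulmx_sum_row.
Qed.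

Lemma tderiv_coord_field_smooth U c k c' i : open U -> U `<=` chart_dom c ->
  smooth_on (U `&` chart_dom c')
    (fun y => tderiv y (coord_field c k y) (fun z => chart c' z 0 i)) /\
  forall p, (chart c @` (U `&` chart_dom c')) p ->
    tderiv (chartV c p) (coord_field c k (chartV c p)) (fun z => chart c' z 0 i)
    = 'D_(delta_mx 0 k) (fun q => chart c' (chartV c q) 0 i) p.
Proof.
move=> oU Uc.
have oU' : open (U `&` chart_dom c') by apply: openI => //; exact: chart_dom_open.
have Uc' : U `&` chart_dom c' `<=` chart_dom c by move=> y [/Uc].
have E p : (chart c @` (U `&` chart_dom c')) p ->
    tderiv (chartV c p) (coord_field c k (chartV c p)) (fun z => chart c' z 0 i)
    = 'D_(delta_mx 0 k) (fun q => chart c' (chartV c q) 0 i) p.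
  move=> [y [Uy yc'] <-]; rewrite chartK; last exact: Uc.
  by rewrite (tderiv_coord_field _ (chart_dom_open c') yc' (Uc _ Uy) (smooth_on_coord c' i)).
split => //; apply: (smooth_on_chart oU' Uc').
have oI : open (chart c @` (U `&` chart_dom c')).
  by have := @open_chart_img _ c oU'; rewrite setIidl.
apply: (@eq_euclid_smooth _ _ _ _ oI (fun p Hp => esym (E p Hp))).
apply: sub_euclid_smooth (euclid_smooth_derive _ (transition_smooth c c' i)).
by move=> p [y [Uy yc'] <-]; exists y => //; split => //; exact: Uc.
Qed.

Lemma coord_field_smooth U c k : open U -> U `<=` chart_dom c ->
  smooth_vector_field U (coord_field c k).
Proof. by move=> oU Uc c' i; have [] := tderiv_coord_field_smooth k c' i oU Uc. Qed.

(** Both terms of the bracket are mixed second derivatives of a transition map, which agree by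
    [derive_commute]. *)
Lemma coord_field_bracket U c k l x : open U -> U `<=` chart_dom c -> U x ->
  lie_bracket (coord_field c k) (coord_field c l) x = 0.
Proof.
move=> oU Uc Ux; apply/rowP => i; rewrite !mxE.
set a := chart_at x; have xa : chart_dom a x by exact: chart_at_dom.
have oU' : open (U `&` chart_dom a) by apply: openI => //; exact: chart_dom_open.
have oI : open (chart c @` (U `&` chart_dom a)).
  by have := @open_chart_img _ c oU'; rewrite setIidl// => y [/Uc].
have second k' l' : tderiv x (coord_field c k' x)
    (fun y => tderiv y (coord_field c l' y) (fun z => chart a z 0 i)) =
  'D_(delta_mx 0 k') ('D_(delta_mx 0 l') (fun q => chart a (chartV c q) 0 i)) (chart c x).
  have [fs E] := tderiv_coord_field_smooth l' a i oU Uc.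
  have e1 := @tderiv_coord_field c k' (U `&` chart_dom a) x
    (fun y => tderiv y (coord_field c l' y) (fun z => chart a z 0 i))
    oU' (conj Ux xa) (Uc _ Ux) fs.
  apply: (etrans e1); clear e1; move: fs E; set F := (fun y => tderiv y _ _) => fs E.
  by apply: (eq_derive _ oI) => //; exists x.
rewrite !second (@derive_commute _ _ (chart c @` (U `&` chart_dom a))) ?subrr//.
- by exists x.
- apply: sub_euclid_smooth (transition_smooth c a i).
  by move=> p [y [Uy yc'] <-]; exists y => //; split => //; exact: Uc.
Qed.

End ManifoldCalculus.

(** * Smooth maps between manifolds and products in a Lie subgroup *)

Section SmoothMaps.
Variables (R : realType) (m : nat) (M : manifold R m).
Implicit Types (U : set M).

Lemma smooth_on_comp U d (F : M -> 'rV[R]_d) (Z : set 'rV[R]_d) (g : 'rV[R]_d -> R) :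
  open U -> (forall x, U x -> Z (F x)) -> (forall j, smooth_on U (fun x => F x 0 j)) ->
  euclid_smooth Z g -> smooth_on U (fun x => g (F x)).
Proof.
move=> oU UZ Fs gs c.
apply: (@euclid_smooth_comp _ _ _ _ Z (F \o chartV c) g) => //.
- exact: open_chart_img.
- by move=> p [x [Ux xd] <-] /=; rewrite chartK//; exact: UZ.
- by move=> j; exact: (Fs j c).
Qed.

Section Target.
Variables (d : nat) (M' : manifold R d).

Lemma sub_smooth_map U (V : set M) (F : M -> M') : open V -> V `<=` U ->
  smooth_map U F -> smooth_map V F.
Proof.
move=> oV VU [cF sF]; split => [W oW|c k].
  have -> : V `&` F @^-1` W = V `&` (U `&` F @^-1` W).
    by apply/seteqP; split => y [Vy] => [Wy|[_ Wy]]; do 2?split => //; exact: VU.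
  by apply: openI => //; exact: cF.
by apply: sub_smooth_on (sF c k) => y [/VU Uy Wy]; split.
Qed.

(** Turns a lift found in coordinates into a smooth map to M'. Continuity is for the topology of M'
    itself, which for a Lie subgroup may be finer than that of the matrices. *)
Lemma smooth_map_param U (c : chart_idx M) (c0 : chart_idx M') (D : set 'rV[R]_m)
    (u : 'rV[R]_m -> 'rV[R]_d) :
  open U -> U `<=` chart_dom c -> (forall y, U y -> D (chart c y)) ->
  (forall p, D p -> (chart c0 @` chart_dom c0) (u p)) ->
  (forall j, euclid_smooth D (fun p => u p 0 j)) ->
  smooth_map U (fun y => chartV c0 (u (chart c y))).
Proof.
move=> oU Uc UD Du us; set b := fun y => _.
have cb : forall V : set M', open V -> open (U `&` b @^-1` V).
  move=> V oV; rewrite openE => y [Uy Vby].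
  have H1 : nbhs y U by exact: open_nbhs_nbhs.
  suff H2 : nbhs y (b @^-1` V) by apply: filterI.
  have [a ad ay] := Du _ (UD _ Uy).
  have cu : {for chart c y, continuous u}.
    apply: differentiable_continuous; apply: differentiable_row => j.
    exact: euclid_smooth_differentiable (us j) (UD _ Uy).
  have nV : nbhs (u (chart c y)) [set q | V (chartV c0 q)].
    rewrite -ay; apply: (chartV_continuous ad); rewrite chartK//.
    by apply: open_nbhs_nbhs; split => //; move: Vby; rewrite /= /b -ay chartK.
  exact: (chart_continuous (Uc _ Uy) (cu _ nV)).
split=> // c' k.
have oU' := cb _ (chart_dom_open c').
have Uc' : U `&` b @^-1` chart_dom c' `<=` chart_dom c by move=> y [/Uc].
apply: (@smooth_on_comp_chart _ _ _ _ c (fun p => chart c' (chartV c0 (u p)) 0 k)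
  (chart c @` (U `&` b @^-1` chart_dom c'))) => //.
have oI : open (chart c @` (U `&` b @^-1` chart_dom c')).
  by have := @open_chart_img _ _ _ _ c oU'; rewrite setIidl.
apply: (@euclid_smooth_comp _ _ _ _ (chart c0 @` (chart_dom c' `&` chart_dom c0)) u
  (fun p => chart c' (chartV c0 p) 0 k)) => //.
- move=> _ [y [Uy by'] <-]; have [a ad ay] := Du _ (UD _ Uy).
  exists a => //; split => //.
  by move: by'; rewrite /= /b -ay chartK.
- by move=> j; apply: sub_euclid_smooth (us j) => _ [y [Uy _] <-]; exact: UD.
- exact: transition_smooth.
Qed.

End Target.

Lemma smooth_map_mul r (S : set 'M[R]_r) (K : lie_subgroup S) U (A b : M -> K) :
  open U -> smooth_map U A -> smooth_map U b ->
  smooth_map U (fun x => ls_mul (A x) (b x)).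
Proof.
move=> oU [cA sA] [cb sb].
have cm : forall V : set K, open V -> open (U `&` (fun x => ls_mul (A x) (b x)) @^-1` V).
  move=> V oV; rewrite openE => x [Ux Vx].
  have : nbhs (A x, b x) [set ab : K * K | V (ls_mul ab.1 ab.2)].
    by apply: (@ls_mul_continuous _ _ _ K); exact: open_nbhs_nbhs.
  case=> -[P Q] /= [nP nQ] PQ.
  have NA : nbhs x (U `&` A @^-1` (interior P)).
    by apply: open_nbhs_nbhs; split; [apply: cA; exact: open_interior|split].
  have Nb : nbhs x (U `&` b @^-1` (interior Q)).
    by apply: open_nbhs_nbhs; split; [apply: cb; exact: open_interior|split].
  apply: filterS2 NA Nb => z [Uz Pz] [_ Qz]; split => //.
  by apply: (PQ (A z, b z)); split; exact: interior_subset.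
split=> // c k; apply: smooth_on_local => x [Ux xc].
(* The smoothness of the product is known in product charts, so one localises to where A and b stay
   in charts around their values at x. *)
set c1 := chart_at (A x); set c2 := chart_at (b x).
pose V := (U `&` (fun x => ls_mul (A x) (b x)) @^-1` chart_dom c) `&`
  ((U `&` A @^-1` chart_dom c1) `&` (U `&` b @^-1` chart_dom c2)).
have oV : open V.
  apply: openI; first exact: cm (chart_dom_open c).
  by apply: openI; [apply: cA|apply: cb]; exact: chart_dom_open.
exists V; first by do !split => //; exact: chart_at_dom.
apply: (@eq_smooth_on _ _ _ V (fun y => (fun w : 'rV[R]_(ls_dim K + ls_dim K) =>
  chart c (ls_mul (chartV c1 (lsubmx w)) (chartV c2 (rsubmx w))) 0 k)
    (row_mx (chart c1 (A y)) (chart c2 (b y))))) => //.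
  by move=> y [_ [[_ Ay] [_ By]]]; rewrite row_mxKl row_mxKr !chartK.
apply: smooth_on_comp (@ls_mul_smooth _ _ _ K c1 c2 c k) => //.
  by move=> y [[_ Cy] [[_ Ay] [_ By]]]; exists (A y), (b y).
move=> j; case: (splitP j) => j' jj.
- have -> : (fun y => row_mx (chart c1 (A y)) (chart c2 (b y)) 0 j) = (fun y => chart c1 (A y) 0 j').
    apply: funext => y; rewrite (_ : j = lshift _ j') ?row_mxEl//; exact: val_inj.
  by apply: sub_smooth_on (sA c1 j') => y [_ [[]]].
- have -> : (fun y => row_mx (chart c1 (A y)) (chart c2 (b y)) 0 j) = (fun y => chart c2 (b y) 0 j').
    apply: funext => y; rewrite (_ : j = rshift _ j') ?row_mxEr//; exact: val_inj.
  by apply: sub_smooth_on (sb c2 j') => y [_ [_ []]].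
Qed.

End SmoothMaps.

(** * Frames and connections *)

Section BasisChange.
Variables (R : realType) (r : nat) (V : lmodType R).
Implicit Types (b : 'I_r -> V) (A B : 'M[R]_r).

Lemma sum_basis_mul b A (c : 'rV[R]_r) :
  \sum_j c 0 j *: basis_mul b A j = \sum_i (c *m A^T) 0 i *: b i.
Proof.
rewrite /basis_mul; under eq_bigr do rewrite scaler_sumr.
rewrite exchange_big /=; apply: eq_bigr => i _; rewrite mxE scaler_suml.
by apply: eq_bigr => j _; rewrite mxE scalerA.
Qed.

Lemma basis_mulA b A B : basis_mul (basis_mul b A) B = basis_mul b (A *m B).
Proof.
apply: funext => j; rewrite {1}/basis_mul.
have := sum_basis_mul b A (\row_i B i j).
under eq_bigr do rewrite mxE; move=> ->; apply: eq_bigr => i _.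
congr (_ *: _); rewrite !mxE; apply: eq_bigr => k _; rewrite !mxE; exact: mulrC.
Qed.

Lemma basis_mul1 b : basis_mul b 1%:M = b.
Proof.
apply: funext => j; rewrite /basis_mul (bigD1 j)//= mxE eqxx scale1r big1 ?addr0// => i ij.
by rewrite mxE (negPf ij) scale0r.
Qed.

Lemma basis_coord_inj b (c d : 'rV[R]_r) : is_basis b ->
  \sum_i c 0 i *: b i = \sum_i d 0 i *: b i -> c = d.
Proof.
move=> bb E; have [a [_ ua]] := bb (\sum_i c 0 i *: b i).
by rewrite -(ua c)// -(ua d).
Qed.

Lemma is_basis_mul b A : is_basis b -> A \in unitmx -> is_basis (basis_mul b A).
Proof.
move=> bb uA v; have [c [vc uc]] := bb v; exists (c *m invmx A^T); split.
  by rewrite sum_basis_mul mulmxKV// unitmx_tr.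
move=> d vd; have -> : c = d *m A^T by apply: uc; rewrite vd sum_basis_mul.
by rewrite mulmxK// unitmx_tr.
Qed.

End BasisChange.

Section Sections.
Variables (R : realType) (m : nat) (M : manifold R m) (r : nat) (E : vbundle M r).
Implicit Types (U V : set M) (s t : section E).

Lemma sub_smooth_section U V s : V `<=` U -> smooth_section U s -> smooth_section V s.
Proof. by move=> VU ss a i; apply: sub_smooth_on (ss a i) => y [/VU]. Qed.

Section OpenSet.
Variable U : set M.
Hypothesis oU : open U.

Let oUa a : open (U `&` triv_dom (a : triv_idx E)).
Proof. by apply: openI => //; exact: triv_dom_open. Qed.

Lemma eq_smooth_section s t : (forall x, U x -> s x = t x) ->
  smooth_section U s -> smooth_section U t.
Proof. by move=> st ss a i; apply: eq_smooth_on (ss a i) => // x [Ux _]; rewrite st. Qed.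

Lemma smooth_section0 : smooth_section U (fun x => 0 : fiber E x).
Proof.
move=> a i; under eq_fun do rewrite linear0 mxE; exact: smooth_on_cst.
Qed.

Lemma smooth_sectionD s t : smooth_section U s -> smooth_section U t ->
  smooth_section U (fun x => s x + t x).
Proof.
by move=> ss ts a i; under eq_fun do rewrite linearD mxE; exact: smooth_onD.
Qed.

Lemma smooth_sectionZ (f : M -> R) s : smooth_on U f -> smooth_section U s ->
  smooth_section U (fun x => f x *: s x).
Proof.
move=> fs ss a i; under eq_fun do rewrite linearZ mxE; apply: smooth_onM => //.
by apply: sub_smooth_on fs => y [].
Qed.

Lemma smooth_section_comb (I : Type) (q : seq I) (f : I -> M -> R) (s : I -> section E) :
  (forall i, smooth_on U (f i)) -> (forall i, smooth_section U (s i)) ->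
  smooth_section U (fun x => \sum_(i <- q) f i x *: s i x).
Proof.
move=> fs ss; elim: q => [|i q IH].
  rewrite (_ : (fun x => _) = fun x => 0 : fiber E x); first exact: smooth_section0.
  by apply: functional_extensionality_dep => x; rewrite big_nil.
rewrite (_ : (fun x => _) = fun x => f i x *: s i x + \sum_(j <- q) f j x *: s j x).
  by apply: smooth_sectionD => //; exact: smooth_sectionZ.
by apply: functional_extensionality_dep => x; rewrite big_cons.
Qed.

Lemma smooth_frame_mul (e : 'I_r -> section E) (A : M -> 'M[R]_r) :
  smooth_frame U e -> (forall i j, smooth_on U (fun x => A x i j)) ->
  (forall x, U x -> A x \in unitmx) ->
  smooth_frame U (fun j x => basis_mul (frame_at e x) (A x) j).
Proof.
move=> [es eb] As uA; split => [j|x Ux].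
  by apply: smooth_section_comb.
exact: is_basis_mul (eb x Ux) (uA x Ux).
Qed.

End OpenSet.

Variable D : connection E.

(* The values of s outside U are killed by multiplying with the indicator
   function of U, which the Leibniz rule allows. *)
Lemma nabla_local U x v s t : open U -> U x -> smooth_section U s ->
  (forall y, U y -> s y = t y) -> nabla D x v s = nabla D x v t.
Proof.
move=> oU Ux ss st; pose f (y : M) : R := (`[< U y >])%:R.
have f1 y : U y -> f y = 1 by move=> Uy; rewrite /f asboolT.
have fs : smooth_on U f.
  by apply: (eq_smooth_on oU _ (@smooth_on_cst _ _ _ U 1)) => y /f1.
have ts : smooth_section U t by exact: eq_smooth_section ss.
have := nabla_leibniz D v oU Ux fs ss.
rewrite (_ : (fun y => f y *: s y) = (fun y => f y *: t y)).
  rewrite (nabla_leibniz D v oU Ux fs ts) f1// !scale1r (st _ Ux).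
  by move=> /addrI ->.
apply: functional_extensionality_dep => y; rewrite /f; case: asboolP => [/st->//|_].
by rewrite !scale0r.
Qed.

Lemma nabla_comb U x v (f : 'I_r -> M -> R) (s : 'I_r -> section E) :
  open U -> U x -> (forall i, smooth_on U (f i)) -> (forall i, smooth_section U (s i)) ->
  nabla D x v (fun y => \sum_i f i y *: s i y) =
  \sum_i (tderiv x v (f i) *: s i x + f i x *: nabla D x v (s i)).
Proof.
move=> oU Ux fs ss; elim: (index_enum _) => [|i q IH].
  (* The zero section is written as 0 times itself, so that the Leibniz rule computes its
     derivative. *)
  rewrite big_nil (_ : (fun y => _) = fun y => (0 : R) *: (0 : fiber E y)); last first.
    by apply: functional_extensionality_dep => y; rewrite big_nil scale0r.
  rewrite (nabla_leibniz D v oU Ux (@smooth_on_cst _ _ _ U 0) (@smooth_section0 U)).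
  by rewrite scaler0 scale0r addr0.
rewrite big_cons -IH -(nabla_leibniz D v oU Ux)// -(nabla_add D v oU Ux).
- congr nabla; apply: functional_extensionality_dep => y; exact: big_cons.
- exact: smooth_sectionZ.
- exact: smooth_section_comb.
Qed.

Lemma nabla_vector_sum U x s d (a : 'I_d -> R) (X : 'I_d -> 'rV[R]_m) :
  open U -> U x -> smooth_section U s ->
  nabla D x (\sum_k a k *: X k) s = \sum_k a k *: nabla D x (X k) s.
Proof.
move=> oU Ux ss; elim: (index_enum _) => [|k q IH]; last first.
  by rewrite !big_cons (nabla_linear D _ _ _ oU Ux ss) IH.
rewrite !big_nil; have := nabla_linear D 1 0 0 oU Ux ss.
by rewrite scaler0 addr0 scale1r => /eqP; rewrite -subr_eq0 opprD addrA subrr add0r oppr_eq0 => /eqP.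
Qed.

Lemma nabla_frame_comb U x v (e : 'I_r -> section E) (f : 'I_r -> M -> R) W :
  open U -> U x -> (forall i, smooth_on U (f i)) -> (forall i, smooth_section U (e i)) ->
  connection_form_at D e x v W ->
  nabla D x v (fun y => \sum_i f i y *: e i y) =
  \sum_i (tderiv x v (f i) + \sum_a W i a * f a x) *: e i x.
Proof.
move=> oU Ux fs es eW; rewrite (nabla_comb v oU Ux fs es) big_split/=.
under [RHS]eq_bigr do rewrite scalerDl; rewrite big_split/=; congr (_ + _).
under eq_bigr do rewrite eW /basis_mul scaler_sumr.
rewrite exchange_big; apply: eq_bigr => i _; rewrite scaler_suml.
by apply: eq_bigr => a _; rewrite scalerA mulrC.
Qed.

Section CoordinateForms.
Variables (c : chart_idx M) (U : set M) (e : 'I_r -> section E).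
Variable w : 'I_m -> M -> 'M[R]_r.
Hypotheses (oU : open U) (Uc : U `<=` chart_dom c) (es : smooth_frame U e).
Hypothesis ws : forall k i j, smooth_on U (fun y => w k y i j).
Hypothesis we : forall y k, U y -> connection_form_at D e y (coord_field c k y) (w k y).

(** Coordinate fields commute, so the curvature on e_j is a difference of two second covariant
    derivatives; comparing coefficients in the basis e gives the Maurer-Cartan equation. *)
Lemma flat_connection_form x k l i j : flat D -> U x ->
  tderiv x (coord_field c k x) (fun y => w l y i j)
  - tderiv x (coord_field c l x) (fun y => w k y i j)
  + (w k x *m w l x - w l x *m w k x) i j = 0.
Proof.
case: es => es1 es2 Dflat Ux.
have := Dflat U (coord_field c k) (coord_field c l) (e j) oU
  (coord_field_smooth k oU Uc) (coord_field_smooth l oU Uc) (es1 j) x Ux.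
rewrite /curvature (coord_field_bracket k l oU Uc Ux).
have -> : nabla D x 0 (e j) = 0.
  have := nabla_vector_sum (fun i : 'I_0 => 0) (fun i : 'I_0 => 0) oU Ux (es1 j).
  by rewrite !big_ord0.
have second k' l' : nabla D x (coord_field c k' x) (fun y => nabla D y (coord_field c l' y) (e j))
   = \sum_i (tderiv x (coord_field c k' x) (fun y => w l' y i j) + (w k' x *m w l' x) i j) *: e i x.
  rewrite -(@nabla_local U x _ (fun y => \sum_i w l' y i j *: e i y)) => //; last first.
  - by move=> y Uy; rewrite we.
  - exact: smooth_section_comb.
  rewrite (nabla_frame_comb oU Ux (fun i => ws l' i j) es1 (we k' Ux)).
  by apply: eq_bigr => a _; rewrite [in RHS]mxE.
rewrite !second subr0 -sumrB => E0.
pose q : 'rV[R]_r := \row_i (tderiv x (coord_field c k x) (fun y => w l y i j)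
  + (w k x *m w l x) i j - (tderiv x (coord_field c l x) (fun y => w k y i j) + (w l x *m w k x) i j)).
have /rowP/(_ i) : q = 0.
  apply: (basis_coord_inj (es2 x Ux)); rewrite /frame_at.
  rewrite [RHS]big1 => [|a _]; last by rewrite mxE scale0r.
  by rewrite -[RHS]E0; apply: eq_bigr => a _; rewrite mxE scalerBl.
by rewrite !mxE => E1; rewrite -[RHS]E1 opprD [RHS]addrACA.
Qed.

(** Coordinate fields span each tangent space, and along them the coefficients of the derivative are
    those of dB + w B. *)
Lemma parallel_comb (B : M -> 'M[R]_r) V : open V -> V `<=` U ->
  (forall i j, smooth_on V (fun y => B y i j)) ->
  (forall y k i j, V y -> tderiv y (coord_field c k y) (fun z => B z i j) = - (w k y *m B y) i j) ->
  forall j, parallel_on D V (fun y => basis_mul (frame_at e y) (B y) j).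
Proof.
move=> oV VU Bs dB j y v Vy; have [es1 _] := es.
have es1V i : smooth_section V (e i) by exact: sub_smooth_section (es1 i).
have sj : smooth_section V (fun y => basis_mul (frame_at e y) (B y) j).
  exact: smooth_section_comb.
rewrite (coord_field_expansion v (Uc (VU _ Vy))).
rewrite (nabla_vector_sum _ _ oV Vy sj) big1// => k _.
rewrite (@nabla_frame_comb V y _ _ (fun i z => B z i j) (w k y))//; last exact: we (VU _ Vy).
rewrite big1 ?scaler0// => i _; rewrite dB// [X in - X]mxE addNr scale0r//.
Qed.

End CoordinateForms.

End Sections.

(** * Neutral metrics *)

Section NeutralMatrices.
Variables (R : realType) (n : nat).
Local Notation J := (J_mx R n).

Lemma J_mx_sqr : J *m J = 1%:M.
Proof.
rewrite /J_mx mulmx_block !mulmx0 !mul0mx !addr0 !add0r mulmxN mulNmx !mulmx1 opprK.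
by rewrite -scalar_mx_block.
Qed.

Lemma tr_I_eps eps : (I_eps R n eps)^T = I_eps R n eps.
Proof. by apply/matrixP => i j; rewrite !mxE eq_sym; case: eqVneq => // ->. Qed.

Lemma I_eps_sqr eps : I_eps R n eps *m I_eps R n eps = 1%:M.
Proof.
apply/matrixP => i j; rewrite !mxE (bigD1 i)//= big1 => [|k ki]; last first.
  by rewrite !mxE eq_sym ki mul0r.
rewrite addr0 !mxE eqxx; case: (eqVneq i j) => [_|_] /=; last by rewrite mulr0.
by case: ifP => _; rewrite ?mulrNN mulr1.
Qed.

Lemma tr_I'_eps eps : (I'_eps R n eps)^T = I'_eps R n eps.
Proof. by rewrite /I'_eps !tr_block_mx !linear0 !trmx1 tr_I_eps. Qed.

Lemma I'_eps_sqr eps : I'_eps R n eps *m I'_eps R n eps = 1%:M.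
Proof.
by rewrite /I'_eps !mulmx_block !mulmx0 !mul0mx !addr0 !add0r !mulmx1 I_eps_sqr -!scalar_mx_block.
Qed.

(** The two matrices are diagonal and commute; this is why passing from e to e I' keeps a frame
    pseudo-orthonormal. *)
Lemma I'_eps_J_mx eps : I'_eps R n eps *m J *m I'_eps R n eps = J.
Proof.
have C : I'_eps R n eps *m J = J *m I'_eps R n eps.
  by rewrite /I'_eps /J_mx !mulmx_block !mulmx0 !mul0mx !addr0 !add0r !mulmxN !mulNmx !mulmx1 !mul1mx.
by rewrite C -mulmxA I'_eps_sqr mulmx1.
Qed.

Lemma I'_eps_unit eps : I'_eps R n eps \in unitmx.
Proof. by have [] := mulmx1_unit (I'_eps_sqr eps). Qed.

(** I' itself may have determinant -1 and reverse the orientation; conjugation by it does not change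
    the determinant. *)
Lemma det_conj_I'_eps eps B : \det (I'_eps R n eps *m B *m I'_eps R n eps) = \det B.
Proof.
have d1 : \det (I'_eps R n eps) * \det (I'_eps R n eps) = 1.
  by rewrite -det_mulmx I'_eps_sqr det1.
by rewrite !det_mulmx mulrAC d1 mul1r.
Qed.

End NeutralMatrices.

Section NeutralMetric.
Variables (R : realType) (m : nat) (M : manifold R m) (n : nat).
Local Notation rk := ((n + n) + (n + n))%N.
Variables (E : vbundle M rk) (h : neutral_metric E) (x : M).
Implicit Types (b : 'I_rk -> fiber E x).

Lemma metric_sum I (q : seq I) (a : I -> R) (b : I -> fiber E x) (v : fiber E x) :
  metric h (\sum_(i <- q) a i *: b i) v = \sum_(i <- q) a i * metric h (b i) v.
Proof.
elim: q => [|i q IH]; last by rewrite !big_cons metric_linear IH.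
have := metric_linear h 1 0 0 v.
rewrite !big_nil scaler0 addr0 mul1r => /eqP.
by rewrite -subr_eq0 opprD addrA subrr add0r oppr_eq0 => /eqP.
Qed.

Lemma metric_basis_mul b A i j :
  metric h (basis_mul b A i) (basis_mul b A j) =
  (A^T *m (\matrix_(k, l) metric h (b k) (b l)) *m A) i j.
Proof.
rewrite metric_sum -mulmxA mxE; apply: eq_bigr => k _; rewrite !mxE; congr (_ * _).
rewrite Defs.metric_sym metric_sum; apply: eq_bigr => l _.
by rewrite !mxE mulrC Defs.metric_sym.
Qed.

Lemma pseudo_orthonormal_mul b A : pseudo_orthonormal (@metric _ _ _ _ _ h x) b ->
  A^T *m J_mx R n *m A = J_mx R n -> A \in unitmx ->
  pseudo_orthonormal (@metric _ _ _ _ _ h x) (basis_mul b A).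
Proof.
move=> [bb bJ] AJ uA; split=> [|i j]; first exact: is_basis_mul.
rewrite metric_basis_mul -[in RHS]AJ; congr ((_ *m _ *m _) _ _).
by apply/matrixP => k l; rewrite mxE.
Qed.

Lemma pseudo_orthonormal_coord b v : pseudo_orthonormal (@metric _ _ _ _ _ h x) b ->
  v = \sum_i (\sum_j metric h v (b j) * J_mx R n j i) *: b i.
Proof.
move=> [bb bJ]; have [c [-> _]] := bb v.
apply: eq_bigr => i _; congr (_ *: _).
have -> : c 0 i = (c *m J_mx R n *m J_mx R n) 0 i by rewrite -mulmxA J_mx_sqr mulmx1.
rewrite mxE; apply: eq_bigr => j _; congr (_ * _).
by rewrite metric_sum mxE; apply: eq_bigr => k _; rewrite bJ.
Qed.

End NeutralMetric.

Section FrameMul.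
Variables (R : realType) (m : nat) (M : manifold R m) (r : nat) (E : vbundle M r).
Implicit Types (U : set M) (e : 'I_r -> section E).

Lemma frame_at_mul e A y : frame_at (frame_mul e A) y = basis_mul (frame_at e y) A.
Proof. by []. Qed.

Lemma smooth_frame_mul_cst U e A : open U -> smooth_frame U e -> A \in unitmx ->
  smooth_frame U (frame_mul e A).
Proof.
move=> oU es uA.
by apply: (@smooth_frame_mul _ _ _ _ _ U oU e (fun=> A)) => // i j; exact: smooth_on_cst.
Qed.

Lemma tderiv_cst (x : M) v (a : R) : tderiv x v (fun=> a) = 0.
Proof. by rewrite /tderiv (_ : _ \o _ = cst a)// derive_cst. Qed.

Lemma parallel_frame_mul (D : connection E) U e A j : open U ->
  (forall i, smooth_section U (e i)) -> (forall i, parallel_on D U (e i)) ->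
  parallel_on D U (frame_mul e A j).
Proof.
move=> oU es ep y v Uy.
rewrite (@nabla_comb _ _ _ _ _ D U y v (fun i _ => A i j) e)//; last first.
  by move=> i; exact: smooth_on_cst.
by rewrite big1// => i _; rewrite tderiv_cst scale0r add0r ep// scaler0.
Qed.

End FrameMul.

Section MetricConnectionForm.
Variables (R : realType) (m : nat) (M : manifold R m) (n : nat).
Local Notation rk := ((n + n) + (n + n))%N.
Variables (E : vbundle M rk) (h : neutral_metric E) (D : connection E).
Variables (c : chart_idx M) (U : set M) (e : 'I_rk -> section E).
Hypotheses (oU : open U) (Uc : U `<=` chart_dom c) (es : smooth_frame U e).
Hypothesis eo : forall y, U y -> pseudo_orthonormal (@metric _ _ _ _ _ h y) (frame_at e y).

(** The coefficients are computed by pairing with the frame and correcting signs by J, so that their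
    smoothness follows from that of the metric and of [nabla]. *)
Definition metric_connection_form (k : 'I_m) (y : M) : 'M[R]_rk :=
  \matrix_(i, j) \sum_l metric h (nabla D y (coord_field c k y) (e j)) (e l y) * J_mx R n l i.

Lemma metric_connection_formP y k : U y ->
  connection_form_at D e y (coord_field c k y) (metric_connection_form k y).
Proof.
move=> Uy j; rewrite [LHS](pseudo_orthonormal_coord _ (eo Uy)).
by apply: eq_bigr => i _; rewrite mxE.
Qed.

Lemma metric_connection_form_smooth k i j :
  smooth_on U (fun y => metric_connection_form k y i j).
Proof.
under eq_fun do rewrite mxE; apply: (smooth_on_sum oU) => l; apply: (smooth_onM oU).
  apply: metric_smooth => //; last by case: es.
  apply: nabla_smooth => //; first exact: coord_field_smooth.
  by case: es.
exact: smooth_on_cst.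
Qed.

Lemma connection_form_unique y v W W' : U y ->
  connection_form_at D e y v W -> connection_form_at D e y v W' -> W = W'.
Proof.
move=> Uy eW eW'; have [_ /(_ y Uy) eb] := es.
apply/matrixP => i j; have /rowP/(_ i) : (\row_i W i j) = (\row_i W' i j).
  apply: (basis_coord_inj eb); have := eW' j; rewrite eW /basis_mul => E0.
  by under eq_bigr do rewrite mxE; rewrite E0; apply: eq_bigr => a _; rewrite mxE.
by rewrite !mxE.
Qed.

End MetricConnectionForm.

(** * Construction of the parallel K-admissible frame *)

Theorem proposition4p2 (R : realType) (m n : nat) (hn : (0 < n)%N)
    (M : manifold R m) (E : vbundle M ((n + n) + (n + n)))
    (o : orientation E) (h : neutral_metric E) (D : connection E)
    (hD : metric_connection h D) (hflat : flat D)
    (K : lie_subgroup (@SO R n)) (hK : forall a : K, G (ls_incl a))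
    (eps : bool) (N : K_nilpotent_structure o h D K eps) (x : M) :
  exists (U : set M) (e : 'I_((n + n) + (n + n)) -> section E),
    [/\ open U, U x, K_admissible N U e
      & forall i, parallel_on D U (e i)].
Proof.
have [l lx] := kn_cover N x; set c := chart_at x; set I' := I'_eps R n eps.
pose U := kn_dom l `&` chart_dom c.
have oU : open U by apply: openI; [exact: kn_dom_open|exact: chart_dom_open].
have Ux : U x by split => //; exact: chart_at_dom.
have Uc : U `<=` chart_dom c by move=> y [].
have Ul : U `<=` kn_dom l by move=> y [].
set f := kn_frame l; pose e' := frame_mul f I'.
have [[fs fb] fo fp fN] := kn_admissible l.
have fU : smooth_frame U f.
  by split=> [i|y /Ul]; [exact: sub_smooth_section (fs i)|exact: fb].
have eU : smooth_frame U e' by apply: smooth_frame_mul_cst => //; exact: I'_eps_unit.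
have eo y : U y -> pseudo_orthonormal (@metric _ _ _ _ _ h y) (frame_at e' y).
  move=> Uy; apply: pseudo_orthonormal_mul; [exact: fo (Ul _ Uy)| |exact: I'_eps_unit].
  by rewrite tr_I'_eps I'_eps_J_mx.
pose w := metric_connection_form h D c e'.
have wE y k : U y -> connection_form_at D e' y (coord_field c k y) (w k y).
  by move=> Uy; exact: metric_connection_formP eo _ _ Uy.
have ws k i j : smooth_on U (fun y => w k y i j) by exact: metric_connection_form_smooth.
(* The pointwise matrix supplied by the structure coincides with w by uniqueness of coefficients. *)
have wK y k : U y -> lie_algebra K (w k y).
  move=> Uy; have [W LW eW] := kn_connection (coord_field c k y) (Ul _ Uy).
  by rewrite (connection_form_unique eU Uy (wE y k Uy) eW).
pose D0 := chart c @` U; set p0 := chart c x.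
have D0E : chart c @` (U `&` chart_dom c) = D0 by rewrite setIidl.
have oD0 : open D0 by rewrite -D0E; exact: open_chart_img.
have D0p0 : D0 p0 by exists x.
have wsD k i j : euclid_smooth D0 (fun p => w k (chartV c p) i j).
  by rewrite -D0E; exact: ws.
have [rho [B [rho0 rD B0 Bs dB]]] :
  exists rho B, [/\ 0 < rho, [set p | `|p - p0| < rho] `<=` D0, B p0 = 1%:M,
    forall i j, euclid_smooth [set p | `|p - p0| < rho] (fun p => B p i j)
    & forall p, `|p - p0| < rho -> forall v i j, 'D_v (fun p => B p i j) p =
        - ((\sum_k v 0 k *: w k (chartV c p)) *m B p) i j].
  apply: (@flat_system R m _ D0 (fun k p => w k (chartV c p)) p0) => //.
  move=> _ [y Uy <-] k k' i j; rewrite chartK; last exact: Uc.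
  rewrite -(flat_connection_form oU Uc eU ws wE k k' i j hflat Uy).
  by rewrite (tderiv_coord_field k oU Uy (Uc _ Uy) (ws k' i j))
    (tderiv_coord_field k' oU Uy (Uc _ Uy) (ws k i j)).
have dBk p k : `|p - p0| < rho -> forall i j, 'D_(delta_mx 0 k) (fun p => B p i j) p =
    - (w k (chartV c p) *m B p) i j.
  move=> pr i j; rewrite dB//; congr (- (_ *m _) i j).
  rewrite (bigD1 k)//= big1 => [|k' kk']; first by rewrite !mxE !eqxx scale1r addr0.
  by rewrite mxE (negPf kk') andbF scale0r.
pose c0 := chart_at (ls_one K).
pose D1 := [set p : 'rV[R]_m | `|p - p0| < rho].
have oD1 : open D1 by exact: open_ball_rV.
have D1p0 : D1 p0 by rewrite /D1 /= subrr normr0.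
(* Points of D1 are chart images of points of U, where w is valued in the Lie algebra. *)
have [rho' [u [rho'0 r'D uP us]]] := @lie_lift R _ _ K m D1 B (fun k p => w k (chartV c p)) p0
  oD1 D1p0 B0 Bs (fun k i j => sub_euclid_smooth rD (wsD k i j))
  (fun p k Dp => let: ex_intro2 y Uy yp := rD p Dp in
     ltac:(by rewrite -yp chartK; [exact: wK|exact: Uc])) dBk.
pose D2 := [set p : 'rV[R]_m | `|p - p0| < rho'].
have oD2 : open D2 by exact: open_ball_rV.
pose U0 := [set y | U y /\ D2 (chart c y)].
have oU0 : open U0 by exact: open_chart_preimage.
have U0x : U0 x by split => //; rewrite /D2 /= subrr normr0.
have U0U : U0 `<=` U by move=> y [].
have U0c : U0 `<=` chart_dom c by move=> y /U0U/Uc.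
pose b y : K := chartV c0 (u (chart c y)).
have bs : smooth_map U0 b.
  apply: (@smooth_map_param _ _ _ _ _ U0 c c0 D2 u) => // [y []//|p /uP[]//].
pose Bm y := B (chart c y).
have bB y : U0 y -> ls_incl (b y) = Bm y by move=> [_ /uP[]].
have Bms i j : smooth_on U0 (fun y => Bm y i j).
  by apply: (smooth_on_comp_chart oU0 U0c _ (Bs i j)) => y [_ /r'D].
have dBm y k i j : U0 y ->
    tderiv y (coord_field c k y) (fun z => Bm z i j) = - (w k y *m Bm y) i j.
  move=> U0y; rewrite (tderiv_coord_field k oU0 U0y (U0c _ U0y) (Bms i j)).
  have oI : open (chart c @` (U0 `&` chart_dom c)) by exact: open_chart_img.
  rewrite (eq_derive (g := fun p => B p i j) _ oI).
  - by rewrite dBk ?(chartK (U0c _ U0y))//; exact: r'D U0y.2.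
  - by move=> _ [z [_ zc] <-] /=; rewrite /Bm chartK.
  - by exists y => //; split => //; exact: U0c.
pose g j : section E := fun y => basis_mul (frame_at e' y) (Bm y) j.
have gp i : parallel_on D U0 (g i) by exact: (parallel_comb Uc eU wE oU0 U0U Bms dBm).
have gs : smooth_frame U0 g.
  apply: smooth_frame_mul => // [|y U0y].
    by split=> [i|y /U0U]; [exact: sub_smooth_section (eU.1 i)|exact: eU.2].
  rewrite -bB// unitmxE; have [_ ->] := ls_incl_sub (b y); exact: unitr1.
have gI y : frame_at (frame_mul (frame_mul g I') I') y = frame_at g y.
  by rewrite !frame_at_mul basis_mulA I'_eps_sqr basis_mul1.
have gE y : frame_at g y = basis_mul (frame_at e' y) (Bm y) by [].
have gf y : frame_at (frame_mul g I') y = basis_mul (frame_at f y) (I' *m Bm y *m I').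
  by rewrite frame_at_mul gE frame_at_mul !basis_mulA mulmxA.
have [BJ Bdet Bcomm] : [/\ forall y, U0 y -> (Bm y)^T *m J_mx R n *m Bm y = J_mx R n,
    forall y, U0 y -> \det (Bm y) = 1
    & forall y, U0 y -> Bm y *m Lambda R n = Lambda R n *m Bm y].
  by split=> y U0y; rewrite -bB//; have [[]] := hK (b y).
have uI := I'_eps_unit R n eps.
(* The conditions bear on e I', and I' is an involution: with e := g I' this frame is g itself. *)
exists U0, (frame_mul g I'); split => //; last first.
  by move=> i; apply: parallel_frame_mul => //; case: gs.
have es0 : smooth_frame U0 (frame_mul g I') by exact: smooth_frame_mul_cst.
split.
  split => // y U0y.
  - rewrite gf; apply: pseudo_orthonormal_mul; first exact: fo (Ul _ (U0U _ U0y)).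
      rewrite !trmx_mul tr_I'_eps !mulmxA.
      rewrite (_ : _ *m I' = I' *m ((Bm y)^T *m (I' *m J_mx R n *m I') *m Bm y) *m I').
        by rewrite !I'_eps_J_mx BJ// I'_eps_J_mx.
      by rewrite !mulmxA.
    rewrite unitmxE det_conj_I'_eps Bdet//; exact: unitr1.
  (* The change of basis from the positive frame f is I' B I', of determinant 1. *)
  - rewrite gf; apply/(positive_change _ (fp _ (Ul _ (U0U _ U0y)))).
    by rewrite det_conj_I'_eps Bdet//; exact: ltr01.
  - move=> j; have Ly := Ul _ (U0U _ U0y).
    have -> : frame_mul (frame_mul g I') I' j y = g j y by have := congr1 (@^~ j) (gI y).
    (* N (e' B) = (N e') B = e' Lambda B = e' B Lambda, the last equality because B commutes with
       Lambda. *)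
    rewrite /g /basis_mul linear_sum /=.
    rewrite (_ : frame_mul _ _ j y = basis_mul (frame_at e' y) (Lambda R n *m Bm y) j); last first.
      by rewrite -Bcomm// -basis_mulA -gE -gI.
    rewrite -basis_mulA; apply: eq_bigr => i _; rewrite linearZ /=; congr (_ *: _).
    exact: fN.
move=> l' [z [U0z l'z]].
(* From e_l I' = e_l' I' A and e I' = e_l I' b one gets e I' = e_l' I' (A b), the product being
   taken in K. *)
have [|A [As AE]] := @kn_transition _ _ _ _ _ _ _ _ _ _ N l' l.
  by exists z; split => //; exact: Ul (U0U _ U0z).
have oUl : open (U0 `&` kn_dom l') by apply: openI => //; exact: kn_dom_open.
exists (fun y => ls_mul (A y) (b y)); split.
  apply: smooth_map_mul => //; [apply: sub_smooth_map As|apply: sub_smooth_map bs] => //.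
    by move=> y [U0y l'y]; split => //; exact: Ul (U0U _ U0y).
move=> y [U0y l'y] j; rewrite -[LHS]/(frame_at (frame_mul (frame_mul g I') I') y j) gI gE.
rewrite ls_incl_mul bB// -basis_mulA; congr (basis_mul _ _ j).
apply: funext => i; rewrite -AE//.
by split => //; exact: Ul (U0U _ U0y).
Qed.
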